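(* Let $k\ge 3$ be a fixed integer and let $\sigma$ be fixed with $\max(\beta_k,\tfrac12)<\sigma<1$. Then for every $\varepsilon>0$, $$R(k,\sigma;T)\ll_\varepsilon T^{\frac{2(1-\sigma)}{1-\beta_k}+\varepsilon}\qquad (T\to\infty).$$
   Context: $\zeta(s)$ is the Riemann zeta-function, $s=\sigma+it$. For $k\in\mathbb N$, $d_k(n)$ is the number of ways of writing $n$ as an ordered product of $k$ positive integer factors (the coefficients of $\zeta^k(s)$). Define $R(k,\sigma;T)$ by $$\int_1^T|\zeta(\sigma+it)|^{2k}\,dt=T\sum_{n=1}^\infty d_k^2(n)n^{-2\sigma}+R(k,\sigma;T).$$ Write $\sum_{n\le x}d_k(n)=xP_{k-1}(\log x)+\Delta_k(x)$, where $xP_{k-1}(\log x)$ (with $P_{k-1}$ a polynomial of degree $k-1$) is the residue at $s=1$ of $\zeta^k(s)x^s/s$. Let $\beta_k=\inf\{b\ge0:\int_1^x\Delta_k^2(y)\,dy\ll x^{1+2b}\}$. *)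

(* Defs.v *)
From HB Require Import structures.
From mathcomp Require Import all_boot all_order all_algebra.
From mathcomp Require Import complex.
From mathcomp Require Import all_classical all_reals all_analysis.

Set Implicit Arguments.
Unset Strict Implicit.
Unset Printing Implicit Defensive.

Import Order.TTheory GRing.Theory Num.Theory.
Import numFieldNormedType.Exports.

Local Open Scope classical_set_scope.
Local Open Scope ring_scope.
Local Open Scope complex_scope.

(* f x << g x as x --> +oo. *)
Definition vinogradov (R : realType) (f g : R -> R) : Prop :=
  exists C : R, \forall x \near +oo, `|f x| <= C * `|g x|.

(* The norm topology on R[i] is the one carried by its alias R[i]^o. *)

(* x ^ s = exp (s log x), intended for x > 0 only. *)
Definition cpow (R : realType) (x : R) (s : R[i]) : R[i] :=
  (x `^ complex.Re s)%:C *
  (cos (complex.Im s * ln x) +i* sin (complex.Im s * ln x)).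

Definition analytic_at (R : realType) (f : R[i] -> R[i]) (a : R[i]) : Prop :=
  exists u : R[i]^nat,
    \forall z \near (a : R[i]^o),
      series (fun n => u n * (z - a) ^+ n) @ \oo --> (f z : R[i]^o).

(* The analytic continuation to C \ {1} of the Dirichlet series
   \sum_(n >= 1) n ^ (- s); by the identity theorem this determines zeta s for
   every s != 1. The value of zeta at the pole is unconstrained. *)
Definition is_riemann_zeta (R : realType) (zeta : R[i] -> R[i]) : Prop :=
  (forall s, 1 < complex.Re s ->
     series (fun n => cpow n.+1%:R (- s)) @ \oo --> (zeta s : R[i]^o)) /\
  (forall s, s != 1 -> analytic_at zeta s).

(* c is the coefficient of (z - a) ^ -1 in a Laurent expansion of f with finite
   principal part, f z = \sum_n u n * (z - a) ^ (n - (m + 1)), valid in a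
   punctured neighbourhood of a, where f z is written as (z - a) ^ (m + 1) * f z
   to avoid negative powers. *)
Definition is_residue (R : realType) (f : R[i] -> R[i]) (a c : R[i]) : Prop :=
  exists (m : nat) (u : R[i]^nat),
    u m = c /\
    \forall z \near (a : R[i]^o)^',
      series (fun n => u n * (z - a) ^+ n) @ \oo
        --> ((z - a) ^+ m.+1 * f z : R[i]^o).

Definition residue (R : realType) (f : R[i] -> R[i]) (a : R[i]) : R[i] :=
  xget 0 [set c | is_residue f a c].

(* For n >= 1 the factors of an ordered factorization of n all lie in
   {1, ..., n}, so factors in 'I_n.+1 lose nothing. *)
Definition divk (k n : nat) : nat :=
  #|[pred f : {ffun 'I_k -> 'I_n.+1} | (\prod_(i < k) f i)%N == n]|.

(* x P_{k-1}(log x): the residue is real for x > 0, since zeta is real on the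
   real axis. *)
Definition main_term (R : realType) (zeta : R[i] -> R[i]) (k : nat) (x : R) : R :=
  complex.Re (residue (fun s => zeta s ^+ k * cpow x s / s) 1).

Definition Delta (R : realType) (zeta : R[i] -> R[i]) (k : nat) (x : R) : R :=
  (\sum_(1 <= n < (Num.truncn x).+1) (divk k n)%:R) - main_term zeta k x.

Definition beta (R : realType) (zeta : R[i] -> R[i]) (k : nat) : R :=
  inf [set b : R | 0 <= b /\
    vinogradov
      (fun x => \int[lebesgue_measure]_(y in `[1, x]) Delta zeta k y ^+ 2)
      (fun x => x `^ (1 + 2 * b))].

(* R(k, sigma; T) *)
Definition mean_value_error (R : realType) (zeta : R[i] -> R[i]) (k : nat)
    (sigma T : R) : R :=
  (\int[lebesgue_measure]_(t in `[1, T])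
      complex.Re `|zeta (sigma +i* t)| ^+ (2 * k))
  - T * limn (fun N : nat =>
      \sum_(1 <= n < N) (divk k n)%:R ^+ 2 * n%:R `^ (- (2 * sigma)) : R).

(* Main.v *)
(* Write d = d_k, Delta = Delta_k and s = sigma + it, and choose b slightly above
   beta_k, T large, X of order T ^ (1 / (1 - b)) and a huge N > X.  Partial
   summation gives, first for Re s large and then by the identity theorem for
   Re s > b,
     zeta(s)^k = A + B + G + E + r,
     A = sum_(n <= X) d(n) n^-s,    B = - Delta(X) X^-s,
     E = s * int_X^N Delta(y) y^(-s-1) dy,
   where G, coming from the polar part, is O(X^(1 - sigma + eta) / t), and r,
   the tail beyond N, is negligible.  The same argument with k = 1 continues
   zeta to Re s > 0 and identifies the residue defining the main term.
   - The mean square of A is T * sum_(n <= X) d(n)^2 n^(-2 sigma) up to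
     O(X^(2 - 2 sigma + eta)), because the off-diagonal terms are controlled by
     log(m/n).
   - Cutting [X, N] into unit intervals writes E / s as the average over theta
     in [0, 1] of a Dirichlet polynomial with frequencies log(X + theta + l); the
     same mean square bound, Jensen and Fubini give
     int |E|^2 << T^2 int_X^N Delta(y)^2 y^(-2 sigma - 1) dy * log N
               << T^2 X^(2b - 2 sigma + eta) << X^(2 - 2 sigma + eta).
   - The cross term of A and E is handled by integrating in t first, which costs
     T / log(y/m); this needs X at distance >= 1/4 from the integers.
   - X is chosen among points where |Delta(X)| << X^b, which exist by averaging.
   Everything is thus O(X^(2 - 2 sigma + c eta)) = O(T^((2 - 2 sigma + c eta) / (1 - b))). *)
Require Import Defs.
From mathcomp Require Import all_boot all_order all_algebra.
From mathcomp Require Import complex.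
From mathcomp Require Import all_classical all_reals all_analysis measurable_realfun.
From mathcomp Require Import ring lra zify.
Import Order.TTheory GRing.Theory Num.Theory.
Import numFieldNormedType.Exports.
Local Open Scope classical_set_scope.
Local Open Scope ring_scope.

Set Implicit Arguments.
Unset Strict Implicit.
Unset Printing Implicit Defensive.

(** * Complex power series *)

Section ComplexPowerSeries.
Context {R : realType}.
Notation C := R[i].
Notation nc := (@Normc.normc R).
Implicit Types (f g : C -> C) (a b : C).

(** The length X = T^(1/(1-b)) is where T X^b = X: the mean square of E, about T^2 X^(2b-2sigma),
    then equals the off-diagonal error X^(2-2sigma) of A. The obstacle is the cross term of A and E.
    When X^(2-2sigma) < T, the case of an asymptotic formula, Cauchy-Schwarz would only give T^(1/2)
    X^(1-sigma), which is too large; so there the oscillation in t is used, while the square of the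
    remaining terms needs upper bounds only. As Delta is controlled in mean square alone, a single
    Dirichlet polynomial in the values Delta(X + theta + l) cannot be estimated; averaging over
    theta turns its sum of squares into the integral of Delta^2. A finite N keeps sums finite and
    integrands bounded, so that they can be interchanged, and since N is a power of X it costs only
    a logarithm. Logarithms, divisor functions and constants go into one factor H of size X^eta. The
    infimum beta_k need not be attained, so eps is shared between b - beta_k and eta. *)

Lemma normcE (z : C) : `|z| = (nc z)%:C%C.
Proof. by case: z. Qed.

Lemma nc_ge0 (z : C) : 0 <= nc z.
Proof. by case: z => a b; exact: sqrtr_ge0. Qed.

Lemma ncM (x y : C) : nc (x * y) = nc x * nc y.
Proof. exact: Normc.normcM. Qed.

Lemma ncD (x y : C) : nc (x + y) <= nc x + nc y.
Proof. by have := ler_normD x y; rewrite !normcE -rmorphD lecR. Qed.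

Lemma ncN (x : C) : nc (- x) = nc x.
Proof. by case: x => a b /=; rewrite !sqrrN. Qed.

Lemma ncB (x y : C) : nc (x - y) = nc (y - x).
Proof. by rewrite -ncN opprB. Qed.

Lemma nc0 : nc 0 = 0.
Proof. exact: Normc.normc0. Qed.

Lemma nc1 : nc 1 = 1.
Proof. exact: Normc.normc1. Qed.

Lemma nc_eq0 (x : C) : (nc x == 0) = (x == 0).
Proof.
by apply/eqP/eqP => [/Normc.eq0_normc //|->]; exact: nc0.
Qed.

Lemma nc_gt0 (x : C) : (0 < nc x) = (x != 0).
Proof. by rewrite lt_def nc_ge0 andbT nc_eq0. Qed.

Lemma ncX (x : C) n : nc (x ^+ n) = nc x ^+ n.
Proof. by elim: n => [|n IH]; rewrite ?expr0 ?nc1// !exprS ncM IH. Qed.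

Lemma ncV (x : C) : nc x^-1 = (nc x)^-1.
Proof. exact: Normc.normcV. Qed.

Lemma ncR (x : R) : nc x%:C%C = `|x|.
Proof. by rewrite /= expr0n addr0 sqrtr_sqr. Qed.

Lemma nc_nat n : nc n%:R = n%:R.
Proof. by rewrite -(rmorph_nat (real_complex R)) ncR ger0_norm. Qed.

Lemma nc_sum I (r : seq I) (P : pred I) (F : I -> C) :
  nc (\sum_(i <- r | P i) F i) <= \sum_(i <- r | P i) nc (F i).
Proof.
elim/big_rec2: _ => [|i x y _ H]; first by rewrite nc0.
by apply: le_trans (ncD _ _) _; rewrite lerD2l.
Qed.

Lemma ncE (z : C) : nc z ^+ 2 = complex.Re z ^+ 2 + complex.Im z ^+ 2.
Proof. by case: z => a b /=; rewrite sqr_sqrtr// addr_ge0 ?sqr_ge0. Qed.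

Lemma Re_le_nc (z : C) : `|complex.Re z| <= nc z.
Proof.
rewrite -(@ler_pXn2r _ 2) ?nnegrE ?nc_ge0// ncE real_normK ?num_real//.
by rewrite lerDl sqr_ge0.
Qed.

Lemma Im_le_nc (z : C) : `|complex.Im z| <= nc z.
Proof.
rewrite -(@ler_pXn2r _ 2) ?nnegrE ?nc_ge0// ncE real_normK ?num_real//.
by rewrite lerDr sqr_ge0.
Qed.

Lemma nc_le_ReIm (z : C) : nc z <= `|complex.Re z| + `|complex.Im z|.
Proof.
rewrite -(@ler_pXn2r _ 2) ?nnegrE ?nc_ge0 ?addr_ge0// ncE sqrrD.
rewrite !real_normK ?num_real// -addrA lerD2l lerDr mulrn_wge0//.
Qed.

Lemma lerB_nc (x y : C) : nc x - nc y <= nc (x - y).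
Proof. by rewrite lerBlDr; apply: le_trans (ncD _ _); rewrite subrK. Qed.

(** * Convergence of complex sequences *)

Definition ccvg (u : nat -> C) (l : C) := (fun n => nc (u n - l)) @ \oo --> (0 : R).

Lemma ccvgP (u : nat -> C) l :
  ccvg u l <-> forall e : R, 0 < e -> \forall n \near \oo, nc (u n - l) < e.
Proof.
split.
  move=> /cvgrPdist_lt H e e0; have := H e e0.
  apply: filterS => n; rewrite sub0r normrN ger0_norm ?nc_ge0//.
move=> H; apply/cvgrPdist_lt => e e0; apply: filterS (H e e0) => n.
by rewrite sub0r normrN ger0_norm ?nc_ge0.
Qed.

(** The radii of the norm topology on [R[i]] are themselves elements of [R[i]]; positivity for its
    partial order forces them to be real, which reduces everything to real epsilons. *)
Lemma complex_gt0E (e : C) : 0 < e -> e = (complex.Re e)%:C%C /\ 0 < complex.Re e.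
Proof. by case: e => a b; rewrite ltcE /= => /andP[/eqP -> ->]. Qed.

Lemma cvgC (u : nat -> C) (l : C) : (u @ \oo --> (l : C^o)) <-> ccvg u l.
Proof.
have E := @cvgrPdist_lt C (C^o : normedModType C) nat \oo eventually_filter u l.
rewrite ccvgP; split.
  move=> /E H e e0.
  have := H (e%:C)%C; rewrite ltcR => /(_ e0); apply: filterS => n.
  by rewrite distrC normcE ltcR.
move=> H; apply/E => e /complex_gt0E[-> e0].
apply: filterS (H _ e0) => n; by rewrite distrC normcE ltcR.
Qed.

Lemma nearC (a : C) (P : C -> Prop) : (\forall z \near (a : C^o), P z) <->
  exists2 r : R, 0 < r & forall z, nc (z - a) < r -> P z.
Proof.
split.
  move=> /nbhs_ballP[e /= /complex_gt0E[-> e0] H].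
  exists (complex.Re e) => // z zr; apply: H.
  by rewrite /ball /= distrC normcE ltcR.
move=> [r r0 H]; apply/nbhs_ballP; exists (r%:C)%C; first by rewrite /= ltcR.
by move=> z; rewrite /ball /= distrC normcE ltcR => /H.
Qed.

Lemma nearC' (a : C) (P : C -> Prop) : (\forall z \near (a : C^o)^', P z) <->
  exists2 r : R, 0 < r & forall z, z != a -> nc (z - a) < r -> P z.
Proof.
split.
  move=> /nearC[r r0 H]; exists r => // z za zr.
  exact: H.
by move=> [r r0 H]; apply/nearC; exists r => // z zr za; exact: H.
Qed.

Lemma ccvg_le (u : nat -> C) l c (B : R) : ccvg u l ->
  (\forall n \near \oo, nc (u n - c) <= B) -> nc (l - c) <= B.
Proof.
move=> /ccvgP H H'; apply/ler_addgt0Pr => e e0.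
have [N _ HN] := H e e0; have [N' _ HN'] := H'.
have /HN h1 : (N <= maxn N N')%N by rewrite leq_maxl.
have /HN' h2 : (N' <= maxn N N')%N by rewrite leq_maxr.
rewrite [B + e]addrC; apply: le_trans (lerD (ltW h1) h2).
rewrite (_ : l - c = - ((u (maxn N N') - l)) + (u (maxn N N') - c)); last by ring.
by apply: le_trans (ncD _ _) _; rewrite ncN.
Qed.

Lemma ccvg_uniq u l l' : ccvg u l -> ccvg u l' -> l = l'.
Proof.
move=> H /ccvgP H'; apply/eqP; rewrite -subr_eq0 -nc_eq0 eq_le nc_ge0 andbT.
by apply/ler_addgt0Pr => e e0; rewrite add0r; apply: (ccvg_le H); apply: filterS (H' e e0) => n /ltW.
Qed.

Lemma ccvg_eq (u v : nat -> C) l : u =1 v -> ccvg u l -> ccvg v l.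
Proof. by move=> /funext ->. Qed.

Lemma ccvg_cst c : ccvg (fun=> c) c.
Proof. by rewrite /ccvg; under eq_fun do rewrite subrr nc0; exact: cvg_cst. Qed.

Lemma ccvg_squeeze (u : nat -> C) l (v : nat -> R) :
  (\forall n \near \oo, nc (u n - l) <= v n) -> v @ \oo --> (0 : R) -> ccvg u l.
Proof.
move=> H H'; apply: (squeeze_cvgr _ (cvg_cst 0) H').
by apply: filterS H => n h; rewrite nc_ge0.
Qed.

Lemma ccvgD u v l l' : ccvg u l -> ccvg v l' -> ccvg (fun n => u n + v n) (l + l').
Proof.
move=> H H'; apply: (@ccvg_squeeze _ _ (fun n => nc (u n - l) + nc (v n - l'))).
  by apply: nearW => n; rewrite opprD addrACA; exact: ncD.
by rewrite -(addr0 0); exact: cvgD.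
Qed.

Lemma ccvgMl c u l : ccvg u l -> ccvg (fun n => c * u n) (c * l).
Proof.
move=> H; apply: (@ccvg_squeeze _ _ (fun n => nc c * nc (u n - l))).
  by apply: nearW => n; rewrite -mulrBr ncM.
by rewrite -(mulr0 (nc c)); apply: cvgM => //; exact: cvg_cst.
Qed.

Lemma ccvgN u l : ccvg u l -> ccvg (fun n => - u n) (- l).
Proof.
by move=> /(@ccvgMl (-1)); rewrite mulN1r; apply: ccvg_eq => n; rewrite mulN1r.
Qed.

Lemma ccvgB u v l l' : ccvg u l -> ccvg v l' -> ccvg (fun n => u n - v n) (l - l').
Proof. by move=> H /ccvgN; exact: ccvgD. Qed.

Lemma ccvg_bound (u : nat -> C) l : ccvg u l -> exists B, forall n, nc (u n) <= B.
Proof.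
move=> /ccvgP/(_ 1 ltr01)[N _ HN].
exists (nc l + 1 + \sum_(i < N) nc (u i)) => n; have [nN|Nn] := ltnP n N.
  rewrite (bigD1 (Ordinal nN))//= addrCA lerDl addr_ge0 ?addr_ge0 ?nc_ge0//.
  by apply: sumr_ge0 => i _; exact: nc_ge0.
rewrite -[leLHS]addr0 lerD//; last by apply: sumr_ge0 => i _; exact: nc_ge0.
have := ltW (HN n Nn); have := lerB_nc (u n) l; lra.
Qed.

Lemma ccvgM u v l l' : ccvg u l -> ccvg v l' -> ccvg (fun n => u n * v n) (l * l').
Proof.
move=> H H'; have [B HB] := ccvg_bound H.
apply: (@ccvg_squeeze _ _ (fun n => B * nc (v n - l') + nc l' * nc (u n - l))).
  apply: nearW => n.
  rewrite (_ : _ - _ = u n * (v n - l') + l' * (u n - l)); last by ring.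
  apply: le_trans (ncD _ _) _; rewrite !ncM lerD2r ler_wpM2r ?nc_ge0//.
rewrite -(addr0 0) -[X in X + _](mulr0 B) -[X in _ + X](mulr0 (nc l')).
by apply: cvgD; apply: cvgM => //; exact: cvg_cst.
Qed.

Lemma ccvg_shift k u l : ccvg (fun n => u (n + k)%N) l <-> ccvg u l.
Proof.
split; last by move=> H; apply: (cvg_comp (fun n => n + k)%N _ _ H); exact: cvg_addnr.
by move=> H; rewrite /ccvg -(cvg_shiftn k).
Qed.

Lemma ccvg_ReIm (u : nat -> C) l : (fun n => complex.Re (u n)) @ \oo --> complex.Re l ->
  (fun n => complex.Im (u n)) @ \oo --> complex.Im l -> ccvg u l.
Proof.
move=> H1 H2; apply: (@ccvg_squeeze _ _ (fun n => `|complex.Re (u n) - complex.Re l| +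
   `|complex.Im (u n) - complex.Im l|)).
  apply: nearW => n; apply: le_trans (nc_le_ReIm _) _.
  by case: (u n) => a b; case: l {H1 H2}.
have h (f : nat -> R) (c : R) : f @ \oo --> c -> (fun n => `|f n - c|) @ \oo --> (0 : R).
  move=> H; rewrite -(normr0 R) -(subrr c); apply: cvg_norm; apply: cvgB => //; exact: cvg_cst.
by rewrite -(addr0 0); apply: cvgD; exact: h.
Qed.

Lemma ccvg_Re (u : nat -> C) l : ccvg u l -> (fun n => complex.Re (u n)) @ \oo --> complex.Re l.
Proof.
move=> /ccvgP H; apply/cvgrPdist_lt => e e0; apply: filterS (H e e0) => n; apply: le_lt_trans.
by rewrite distrC; apply: le_trans (Re_le_nc _); case: (u n) => a b; case: l {H}.
Qed.

Lemma ccvg_Im (u : nat -> C) l : ccvg u l -> (fun n => complex.Im (u n)) @ \oo --> complex.Im l.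
Proof.
move=> /ccvgP H; apply/cvgrPdist_lt => e e0; apply: filterS (H e e0) => n; apply: le_lt_trans.
by rewrite distrC; apply: le_trans (Im_le_nc _); case: (u n) => a b; case: l {H}.
Qed.

(** * Local power series expansions *)

Definition psum (u : nat -> C) (z : C) (n : nat) : C := \sum_(i < n) u i * z ^+ i.

Lemma seriesE u z : series (fun n => u n * z ^+ n) = psum u z.
Proof. by apply/funext => n; rewrite /series /= big_mkord. Qed.

(** [analytic_at] with its coefficients named: the Cauchy product, the vanishing criterion and the
    residues all compute with them. *)
Definition has_ps (f : C -> C) (a : C) (u : nat -> C) := exists2 r : R, 0 < r &
  forall z, nc (z - a) < r -> ccvg (psum u (z - a)) (f z).

Lemma analytic_atP f a : analytic_at f a <-> exists u, has_ps f a u.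
Proof.
split=> [[u /nearC[r r0 H]]|[u [r r0 H]]]; exists u.
  by exists r => // z /H; rewrite seriesE => /cvgC.
by apply/nearC; exists r => // z /H /cvgC; rewrite seriesE.
Qed.

(** Stands in for the radius of convergence and turns every remainder into an explicit geometric
    sum. *)
Definition geom_bounded (u : nat -> C) (rho B : R) := forall n, nc (u n) * rho ^+ n <= B.

Lemma geom_bounded_ge0 u rho B : geom_bounded u rho B -> 0 <= B.
Proof. by move=> /(_ 0%N); rewrite expr0 mulr1; apply: le_trans; exact: nc_ge0. Qed.

Lemma geom_boundedW u rho rho' B : 0 <= rho -> rho <= rho' ->
  geom_bounded u rho' B -> geom_bounded u rho B.
Proof.
move=> r0 rr H n; apply: le_trans (H n); rewrite ler_wpM2l ?nc_ge0//.
by rewrite lerXn2r ?nnegrE// (le_trans r0).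
Qed.

Lemma psumS u z n : psum u z n.+1 = psum u z n + u n * z ^+ n.
Proof. by rewrite /psum big_ord_recr. Qed.

Lemma psum_diff u z n : u n * z ^+ n = psum u z n.+1 - psum u z n.
Proof. by rewrite psumS addrAC subrr add0r. Qed.

(** A term is the difference of two consecutive partial sums, and these are bounded at the point a +
    r/2; hence the bound B + B. *)
Lemma has_ps_geom f a u : has_ps f a u -> exists rho B, 0 < rho /\ geom_bounded u rho B.
Proof.
move=> [r r0 H]; pose w := (r / 2)%:C%C : C.
have w0 : 0 < r / 2 by lra.
have wr : nc (a + w - a) < r by rewrite addrC addKr ncR gtr0_norm//; lra.
have [B HB] := ccvg_bound (H _ wr).
exists (r / 2), (B + B); split=> // n.
have -> : nc (u n) * (r / 2) ^+ n = nc (u n * (a + w - a) ^+ n).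
  by rewrite ncM ncX addrC addKr ncR gtr0_norm.
rewrite psum_diff.
by apply: le_trans (ncD _ _) _; rewrite ncN; exact: lerD.
Qed.

Lemma geom_psum_le u rho B z n : 0 < rho -> geom_bounded u rho B -> 2 * nc z <= rho ->
  nc (psum u z n.+1 - u 0%N) <= 2 * B * (nc z / rho).
Proof.
move=> r0 H hz; have B0 := geom_bounded_ge0 H.
set t := nc z / rho.
have t0 : 0 <= t by rewrite divr_ge0 ?nc_ge0// ltW.
have t1 : 2 * t <= 1 by rewrite mulrA ler_pdivrMr// mul1r.
have -> : psum u z n.+1 - u 0%N = \sum_(i < n) u i.+1 * z ^+ i.+1.
  by rewrite /psum big_ord_recl expr0 mulr1 addrC addKr.
apply: le_trans (nc_sum _ _ _) _.
apply: le_trans (_ : \sum_(i < n) B * t ^+ i.+1 <= _).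
  apply: ler_sum => i _; rewrite ncM ncX /t expr_div_n mulrA.
  rewrite ler_pdivlMr ?exprn_gt0// mulrAC; apply: ler_wpM2r; last exact: H.
  by rewrite exprn_ge0// nc_ge0.
rewrite -mulr_sumr [2 * B]mulrC -mulrA ler_wpM2l//.
have : \sum_(i < n) t ^+ i.+1 <= 2 * t - 2 * t ^+ n.+1.
  elim: n => [|n IH]; first by rewrite big_ord0 expr1; lra.
  rewrite big_ord_recr /=.
  have := exprn_ge0 n.+1 t0; rewrite [t ^+ n.+2]exprS => h.
  have := ler_wpM2r h t1; lra.
by have := exprn_ge0 n.+1 t0; lra.
Qed.

(** Divides out a zero of order at least m. The value at the centre is prescribed, since the
    quotient does not produce the limit there. *)
Lemma has_ps_shift f a u m : has_ps f a u -> (forall i, (i < m)%N -> u i = 0) ->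
  has_ps (fun z => if z == a then u m else f z / (z - a) ^+ m) a (fun i => u (i + m)%N).
Proof.
move=> [r r0 H] u0; exists r => // z zr; have [->|za] := eqVneq z a.
  rewrite subrr; apply/(ccvg_shift 1); apply: ccvg_eq (ccvg_cst (u m)) => n /=.
  rewrite addn1 /psum big_ord_recl expr0 mulr1 add0n big1 ?addr0// => i _.
  by rewrite exprS mul0r mulr0.
have zm : (z - a) ^+ m != 0 by rewrite expf_neq0// subr_eq0.
have := H z zr => /(iffRL (ccvg_shift m _ _)) /(@ccvgMl ((z - a) ^- m)); rewrite mulrC.
apply: ccvg_eq => n; rewrite /psum addnC big_split_ord /= big1; last first.
  by move=> i _; rewrite u0 ?mul0r.
rewrite add0r mulr_sumr; apply: eq_bigr => i _.
by rewrite mulrCA exprD mulKf// addnC.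
Qed.

Lemma has_ps_center f a u : has_ps f a u -> f a = u 0%N.
Proof.
move=> [r r0 /(_ a)]; rewrite subrr nc0 => /(_ r0) /(iffRL (ccvg_shift 1 _ _)) H.
apply: (ccvg_uniq H); apply: ccvg_eq (ccvg_cst (u 0%N)) => n /=.
rewrite addn1 /psum big_ord_recl expr0 mulr1 big1 ?addr0// => i _.
by rewrite exprS mul0r mulr0.
Qed.

Lemma has_ps_lip f a u : has_ps f a u -> exists r L : R,
  [/\ 0 < r, 0 <= L & forall z, nc (z - a) < r -> nc (f z - f a) <= L * nc (z - a)].
Proof.
move=> H; have [rho [B [rho0 HB]]] := has_ps_geom H.
have [r r0 Hr] := H; exists (Num.min r (rho / 2)), (2 * B / rho); split.
- by rewrite lt_min r0/= divr_gt0.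
- by rewrite divr_ge0 ?mulr_ge0 ?(geom_bounded_ge0 HB)// ltW.
- move=> z; rewrite lt_min => /andP[zr zrho].
  rewrite (has_ps_center H); apply: ccvg_le; first exact: (iffRL (ccvg_shift 1 _ _) (Hr _ zr)).
  apply: nearW => n /=; rewrite addn1.
  apply: le_trans (geom_psum_le _ rho0 HB _) _; first by lra.
  by rewrite mulrA mulrAC.
Qed.

(** Strong induction on the index: dividing by [(z - a) ^+ m] leaves a function that is Lipschitz at
    [a] with value [u m] there, and it vanishes at points arbitrarily close to [a]. *)
Lemma has_ps_zero f a u : has_ps f a u ->
  (forall e : R, 0 < e -> exists z, [/\ z != a, nc (z - a) < e & f z = 0]) ->
  forall n, u n = 0.
Proof.
move=> H H0 n; elim/ltn_ind: n => m IH.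
have [r [L [r0 L0 HL]]] := has_ps_lip (has_ps_shift H IH).
apply/eqP; rewrite -nc_eq0 eq_le nc_ge0 andbT; apply/ler_addgt0Pr => e e0; rewrite add0r.
have e' : 0 < Num.min r (e / (L + 1)) by rewrite lt_min r0/= divr_gt0//; lra.
have [z [za]] := H0 _ e'; rewrite lt_min => /andP[zr ze] fz.
have := HL z zr; rewrite eqxx (negbTE za) fz mul0r sub0r ncN => h.
apply: le_trans h _; move: ze; rewrite ltr_pdivlMr; last lra.
by have := nc_ge0 (z - a); lra.
Qed.

Definition conv (u v : nat -> C) (n : nat) : C := \sum_(i < n.+1) u i * v (n - i)%N.

(** Viewed as polynomials, the two sides differ only by the N terms of degree N + i, i < N, of the
    product. Each is at most (N + i + 1) B B' 8^-N, and the generous ratio 8 allows the crude bounds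
    N + i + 1 <= 2 * 2^N and N <= 2^N. *)
Lemma cauchy_remainder u v rho B B' z N : 0 < rho -> geom_bounded u rho B ->
  geom_bounded v rho B' -> 8 * nc z <= rho ->
  nc (psum u z N * psum v z N - psum (conv u v) z N) <= 2 * B * B' * 2^-1 ^+ N.
Proof.
move=> r0 Hu Hv hz.
have B0 := geom_bounded_ge0 Hu; have B'0 := geom_bounded_ge0 Hv.
pose p := \poly_(i < N) u i; pose q := \poly_(i < N) v i.
have pE : psum u z N = p.[z] by rewrite horner_poly.
have qE : psum v z N = q.[z] by rewrite horner_poly.
have coE i : (i < N)%N -> (p * q)`_i = conv u v i.
  move=> iN; rewrite coefM; apply: eq_bigr => j _.
  have ji : (j <= i)%N by rewrite -ltnS.
  by rewrite !coef_poly (leq_ltn_trans ji iN) (leq_ltn_trans (leq_subr _ _) iN).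
have bp (w : nat -> C) D i : geom_bounded w rho D -> nc (\poly_(j < N) w j)`_i * rho ^+ i <= D.
  move=> H; rewrite coef_poly; case: ifP => _; first exact: H.
  by rewrite nc0 mul0r (geom_bounded_ge0 H).
have bE i : nc (p * q)`_i * rho ^+ i <= i.+1%:R * (B * B').
  rewrite coefM; apply: le_trans (_ : \sum_(j < i.+1) B * B' <= _); last first.
    by rewrite sumr_const card_ord mulr_natl.
  apply: le_trans (ler_wpM2r (exprn_ge0 _ (ltW r0)) (nc_sum _ _ _)) _.
  rewrite mulr_suml; apply: ler_sum => j _; rewrite ncM.
  have -> : rho ^+ i = rho ^+ j * rho ^+ (i - j) by rewrite -exprD subnKC// -ltnS.
  rewrite mulrACA ler_pM// ?mulr_ge0 ?nc_ge0 ?exprn_ge0 ?(ltW r0)//.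
    exact: bp.
  exact: bp.
have -> : psum u z N * psum v z N = \sum_(i < N + N) (p * q)`_i * z ^+ i.
  rewrite pE qE -hornerM; apply: horner_coef_wide.
  apply: leq_trans (size_polyMleq _ _) _.
  by rewrite (leq_trans (leq_pred _))// leq_add// size_poly.
rewrite big_split_ord /= [X in X + _ - _](_ : _ = psum (conv u v) z N); last first.
  by apply: eq_bigr => i _; rewrite coE.
rewrite addrAC subrr add0r; apply: le_trans (nc_sum _ _ _) _.
have [t [t0 t1 tE]] : exists t, [/\ 0 <= t, t <= 8^-1 & nc z = t * rho].
  exists (nc z / rho); split; first by rewrite divr_ge0 ?nc_ge0// ltW.
    by rewrite ler_pdivrMr// mulrC ler_pdivlMr// mulrC.
  by rewrite divfK// gt_eqF.
apply: le_trans (_ : \sum_(i < N) (2 ^+ N * 2 * (B * B') * 8^-1 ^+ N) <= _).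
  apply: ler_sum => i _; rewrite ncM ncX.
  rewrite tE exprMn mulrCA mulrC.
  have h1 := bE (N + i)%N.
  have h2 : t ^+ (N + i) <= 8^-1 ^+ N.
    rewrite exprD -[leRHS]mulr1 ler_pM ?exprn_ge0//.
      by rewrite lerXn2r ?nnegrE// invr_ge0.
    by rewrite exprn_ile1//; lra.
  rewrite ler_pM ?exprn_ge0 ?mulr_ge0 ?nc_ge0 ?exprn_ge0 ?(ltW r0)//.
  apply: le_trans h1 _; apply: ler_wpM2r; first exact: mulr_ge0.
  rewrite -natrX -natrM ler_nat muln2 -addnn.
  have iN := ltn_ord i; have := ltn_expl N (isT : (1 < 2)%N); lia.
rewrite sumr_const card_ord -[leLHS]mulr_natl.
apply: le_trans (_ : 2 ^+ N * (2 ^+ N * 2 * (B * B') * 8^-1 ^+ N) <= _).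
  apply: ler_wpM2r; first by rewrite !mulr_ge0 ?exprn_ge0 ?invr_ge0.
  by rewrite -natrX ler_nat ltnW// ltn_expl.
have -> : 2^-1 ^+ N = 2 ^+ N * 2 ^+ N * 8^-1 ^+ N :> R.
  by rewrite -!exprMn; congr (_ ^+ _); lra.
by rewrite le_eqVlt; apply/orP; left; apply/eqP; ring.
Qed.

Lemma ccvg_conv u v rho B B' z l l' : 0 < rho -> geom_bounded u rho B ->
  geom_bounded v rho B' -> 8 * nc z <= rho ->
  ccvg (psum u z) l -> ccvg (psum v z) l' -> ccvg (psum (conv u v) z) (l * l').
Proof.
move=> r0 Hu Hv hz H H'.
have h : ccvg (fun N => psum u z N * psum v z N - psum (conv u v) z N) 0.
  apply: (@ccvg_squeeze _ _ (fun N => 2 * B * B' * 2^-1 ^+ N)).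
    by apply: nearW => N; rewrite subr0; exact: (cauchy_remainder _ r0 Hu Hv).
  rewrite -[X in _ --> X](mulr0 (2 * B * B')); apply: cvgM; first exact: cvg_cst.
  by apply: cvg_expr; rewrite gtr0_norm ?invr_gt0//; lra.
have := ccvgB (ccvgM H H') h; rewrite subr0; apply: ccvg_eq => n.
by rewrite opprB addrC subrK.
Qed.

Lemma has_psM f g a u v : has_ps f a u -> has_ps g a v ->
  has_ps (fun z => f z * g z) a (conv u v).
Proof.
move=> Hf Hg; have [ru [Bu [ru0 Hu]]] := has_ps_geom Hf.
have [rv [Bv [rv0 Hv]]] := has_ps_geom Hg.
have [r r0 Hr] := Hf; have [r' r'0 Hr'] := Hg.
pose rho := Num.min ru rv.
have rho0 : 0 < rho by rewrite lt_min ru0.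
have Hu' : geom_bounded u rho Bu by apply: geom_boundedW Hu; rewrite ?(ltW rho0)// ge_min lexx.
have Hv' : geom_bounded v rho Bv by apply: geom_boundedW Hv; rewrite ?(ltW rho0)// ge_min lexx orbT.
exists (Num.min (Num.min r r') (rho / 8)); first by rewrite !lt_min r0 r'0 divr_gt0.
move=> z; rewrite !lt_min => /andP[/andP[zr zr'] zrho].
by apply: (ccvg_conv rho0 Hu' Hv'); [lra|exact: Hr|exact: Hr'].
Qed.

Lemma has_psD f g a u v : has_ps f a u -> has_ps g a v ->
  has_ps (fun z => f z + g z) a (fun n => u n + v n).
Proof.
move=> [r r0 H] [r' r'0 H']; exists (Num.min r r'); first by rewrite lt_min r0.
move=> z; rewrite lt_min => /andP[zr zr'].
have := ccvgD (H z zr) (H' z zr'); apply: ccvg_eq => n.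
by rewrite /psum -big_split; apply: eq_bigr => i _; rewrite mulrDl.
Qed.

Lemma has_psZ c f a u : has_ps f a u -> has_ps (fun z => c * f z) a (fun n => c * u n).
Proof.
move=> [r r0 H]; exists r => // z zr; have := ccvgMl c (H z zr); apply: ccvg_eq => n.
by rewrite /psum mulr_sumr; apply: eq_bigr => i _; rewrite mulrA.
Qed.

Lemma has_psB f g a u v : has_ps f a u -> has_ps g a v ->
  has_ps (fun z => f z - g z) a (fun n => u n - v n).
Proof.
move=> H H'; have := has_psD H (has_psZ (-1) H').
rewrite (_ : (fun z => _) = (fun z => f z - g z)); last by apply/funext => z; rewrite mulN1r.
by rewrite (_ : (fun n => _) = (fun n => u n - v n))//; apply/funext => n; rewrite mulN1r.
Qed.

Lemma has_ps_cst c a : has_ps (fun=> c) a (fun n => if n == 0%N then c else 0).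
Proof.
exists 1 => // z _; apply/(ccvg_shift 1); apply: ccvg_eq (ccvg_cst c) => n.
by rewrite addn1 /psum big_ord_recl expr0 mulr1 big1 ?addr0// => i _; rewrite mul0r.
Qed.

Lemma has_ps_id a : has_ps id a (fun n => if n == 0%N then a else (n == 1%N)%:R).
Proof.
exists 1 => // z _; apply/(ccvg_shift 2); apply: ccvg_eq (ccvg_cst _) => n.
rewrite addn2 /psum !big_ord_recl expr0 expr1 mulr1 mul1r big1; last by move=> i _; rewrite mul0r.
by rewrite addr0 addrC subrK.
Qed.

Lemma has_ps_inv a : a != 0 -> has_ps (fun z => z^-1) a (fun n => (-1) ^+ n * a ^- n.+1).
Proof.
move=> a0; have na0 : 0 < nc a by rewrite nc_gt0.
exists (nc a / 2); first by rewrite divr_gt0.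
move=> z zr; set w := z - a; set q := - w / a.
have q2 : nc q < 1.
  by rewrite /q ncM ncV ncN ltr_pdivrMr//; lra.
have q1 : 1 - q != 0.
  by apply/eqP => h; move: q2; rewrite (_ : q = 1) ?nc1 ?ltxx//; apply/eqP; rewrite eq_sym -subr_eq0 h.
have z0 : z != 0.
  by apply: contraNneq q1 => z0; rewrite /q /w z0 sub0r opprK divff// subrr.
have E n : psum (fun n => (-1) ^+ n * a ^- n.+1) w n = z^-1 * (1 - q ^+ n).
  rewrite (_ : z^-1 = a^-1 / (1 - q)); last first.
    by rewrite -invfM /q /w mulrBr mulr1 mulrCA divff// mulr1 opprK addrC subrK.
  rewrite -[1 - q ^+ n]opprB subrX1 -[1 - q]opprB invrN !(mulrN, mulNr) opprK.
  rewrite -mulrA mulKf; last by rewrite -opprB oppr_eq0.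
  rewrite mulr_sumr; apply: eq_bigr => i _.
  by rewrite /q exprMn exprVn exprSr invfM -[- w]mulN1r exprMn; ring.
apply: (ccvg_eq (u := fun n => z^-1 * (1 - q ^+ n))) => [n|]; first by rewrite E.
rewrite -[X in ccvg _ X]mulr1; apply: ccvgMl; rewrite -[X in ccvg _ X]subr0.
apply: ccvgB; first exact: ccvg_cst.
apply: (@ccvg_squeeze _ _ (fun n => nc q ^+ n)).
  by apply: nearW => n; rewrite subr0 ncX.
by apply: cvg_expr; rewrite ger0_norm ?nc_ge0.
Qed.

(** * Closure properties of analyticity *)

Lemma analyticD f g a : analytic_at f a -> analytic_at g a -> analytic_at (fun z => f z + g z) a.
Proof. by move=> /analytic_atP[u Hu] /analytic_atP[v Hv]; apply/analytic_atP; eexists; exact: has_psD Hu Hv. Qed.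

Lemma analyticB f g a : analytic_at f a -> analytic_at g a -> analytic_at (fun z => f z - g z) a.
Proof. by move=> /analytic_atP[u Hu] /analytic_atP[v Hv]; apply/analytic_atP; eexists; exact: has_psB Hu Hv. Qed.

Lemma analyticM f g a : analytic_at f a -> analytic_at g a -> analytic_at (fun z => f z * g z) a.
Proof. by move=> /analytic_atP[u Hu] /analytic_atP[v Hv]; apply/analytic_atP; eexists; exact: has_psM Hu Hv. Qed.

Lemma analytic_cst c a : analytic_at (fun=> c) a.
Proof. by apply/analytic_atP; eexists; exact: has_ps_cst. Qed.

Lemma analytic_id a : analytic_at id a.
Proof. by apply/analytic_atP; eexists; exact: has_ps_id. Qed.

Lemma analyticX f n a : analytic_at f a -> analytic_at (fun z => f z ^+ n) a.
Proof.
move=> H; elim: n => [|n IH]; first exact: analytic_cst.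
rewrite (_ : (fun z => _) = (fun z => f z * f z ^+ n)); last by apply/funext => z; rewrite exprS.
exact: analyticM.
Qed.

Lemma analytic_sum I (r : seq I) (F : I -> C -> C) a : (forall i, analytic_at (F i) a) ->
  analytic_at (fun z => \sum_(i <- r) F i z) a.
Proof.
move=> H; elim: r => [|i r IH].
  rewrite (_ : (fun z => _) = (fun=> 0)); first exact: analytic_cst.
  by apply/funext => z; rewrite big_nil.
rewrite (_ : (fun z => _) = (fun z => F i z + \sum_(j <- r) F j z)).
  exact (@analyticD (F i) (fun z => \sum_(j <- r) F j z) a (H i) IH).
by apply/funext => z; rewrite big_cons.
Qed.

Lemma has_ps_trans f a b u : has_ps f (a - b) u -> has_ps (fun z => f (z - b)) a u.
Proof.
move=> [r r0 H]; exists r => // z zr; have := H (z - b).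
by rewrite opprB addrA subrK; apply.
Qed.

Lemma analytic_inv_sub b a : a != b -> analytic_at (fun z => (z - b)^-1) a.
Proof.
move=> ab; apply/analytic_atP; eexists; apply: (has_ps_trans (f := fun z => z^-1)).
by apply: has_ps_inv; rewrite subr_eq0.
Qed.

Lemma analytic_lip f a : analytic_at f a -> exists r L : R,
  [/\ 0 < r, 0 <= L & forall z, nc (z - a) < r -> nc (f z - f a) <= L * nc (z - a)].
Proof. by move=> /analytic_atP[u /has_ps_lip]. Qed.

(* The set of t such that f vanishes on [0, t] is closed by definition of the
   supremum and open because the zeros accumulate. *)
Lemma identity_segment (f : C -> C) (a v : C) (d : R) : v != 0 -> 0 < d ->
  (forall t : R, 0 <= t <= 1 -> analytic_at f (a + t%:C%C * v)) ->
  (forall t : R, 0 <= t < d -> f (a + t%:C%C * v) = 0) -> f (a + v) = 0.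
Proof.
move=> v0 d0 fan f0; have nv0 : 0 < nc v by rewrite nc_gt0.
pose S := [set t : R | 0 <= t <= 1 /\ forall t', 0 <= t' <= t -> f (a + t'%:C%C * v) = 0].
have S0 : S 0.
  split; first by rewrite lexx ler01.
  by move=> t /andP[h1 h2]; apply: f0; rewrite h1 (le_lt_trans h2).
have hS : has_sup S.
  by split; [exists 0|exists 1 => t [/andP[]]].
set c := sup S.
have c0 : 0 <= c by apply: sup_upper_bound.
have c1 : c <= 1 by apply: ge_sup; [exists 0|move=> t [/andP[]]].
have below t : 0 <= t -> t < c -> f (a + t%:C%C * v) = 0.
  move=> t0 tc; have ct : 0 < c - t by rewrite subr_gt0.
  have [t' [_ H]] := sup_adherent ct hS.
  by rewrite subKr => tt'; apply: H; rewrite t0 ltW.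
have fc : analytic_at f (a + c%:C%C * v) by apply: fan; rewrite c0.
(* This makes [c] positive: the zeros that accumulate at [c] come from its left. *)
have dc : Num.min d 1 / 2 <= c.
  apply: sup_upper_bound => //; have md : 0 < Num.min d 1 by rewrite lt_min d0 ltr01.
  have [m1 m2] : Num.min d 1 <= 1 /\ Num.min d 1 <= d by rewrite !ge_min !lexx orbT.
  split; first by apply/andP; lra.
  by move=> t /andP[t0 t2]; apply: f0; rewrite t0/=; lra.
have c0' : 0 < c by apply: lt_le_trans dc; rewrite divr_gt0// lt_min d0 ltr01.
have [u Hu] := (analytic_atP _ _).1 fc.
have u0 : forall n, u n = 0.
  apply: (has_ps_zero Hu) => e e0.
  pose h := Num.min (e / nc v) c / 2.
  have m0 : 0 < Num.min (e / nc v) c by rewrite lt_min c0' divr_gt0.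
  have [m1 m2] : Num.min (e / nc v) c <= e / nc v /\ Num.min (e / nc v) c <= c by rewrite !ge_min !lexx orbT.
  exists (a + (c - h)%:C%C * v).
  have -> : a + (c - h)%:C%C * v - (a + c%:C%C * v) = - (h%:C%C * v) by rewrite rmorphB /=; ring.
  rewrite ncN ncM ncR gtr0_norm ?divr_gt0//; split.
  - rewrite -subr_eq0 (_ : _ - _ = - (h%:C%C * v)); last by rewrite rmorphB /=; ring.
    by rewrite oppr_eq0 mulf_neq0// -nc_eq0 ncR normr_eq0 gt_eqF// divr_gt0.
  - by rewrite -ltr_pdivlMr//; rewrite /h; lra.
  - by apply: below; rewrite /h; lra.
have [r r0 Hr] := Hu.
have fz z : nc (z - (a + c%:C%C * v)) < r -> f z = 0.
  move=> /Hr; move/ccvg_uniq; apply; apply: ccvg_eq (ccvg_cst 0) => n.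
  by rewrite /psum big1// => i _; rewrite u0 mul0r.
have fnear t : `|t - c| * nc v < r -> f (a + t%:C%C * v) = 0.
  move=> h; apply: fz; rewrite (_ : _ - _ = (t - c)%:C%C * v); last by rewrite rmorphB /=; ring.
  by rewrite ncM ncR.
suff : c = 1 by move=> c1'; have := fnear 1; rewrite c1' subrr normr0 mul0r mul1r; apply.
apply/eqP; rewrite eq_le c1 leNgt; apply/negP => cl1.
pose h := Num.min (r / nc v) (1 - c) / 2.
have m0 : 0 < Num.min (r / nc v) (1 - c) by rewrite lt_min subr_gt0 cl1 divr_gt0.
have [m1 m2] : Num.min (r / nc v) (1 - c) <= r / nc v /\ Num.min (r / nc v) (1 - c) <= 1 - c by rewrite !ge_min !lexx orbT.
suff : S (c + h) by move=> /(sup_upper_bound hS); rewrite -/c /h; lra.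
split; first by apply/andP; rewrite /h; lra.
move=> t /andP[t0 th]; have [tc|tc] := ltP t c; first exact: below.
apply: fnear; rewrite -ltr_pdivlMr// ger0_norm ?subr_ge0//.
by apply: (@le_lt_trans _ _ h); rewrite /h in th *; lra.
Qed.

End ComplexPowerSeries.

(** * Complex-valued calculus on the real line *)

Section RealCalculus.
Context {R : realType}.
Implicit Types f g : R -> R.

Lemma der_cst (c x : R) : is_derive x 1 (fun=> c) 0.
Proof. exact: is_derive_cst. Qed.

Lemma der_id (x : R) : is_derive x 1 (fun y : R => y) 1.
Proof. exact: is_derive_id. Qed.

Lemma derD f g (x a b : R) : is_derive x 1 f a -> is_derive x 1 g b ->
  is_derive x 1 (fun y => f y + g y) (a + b).
Proof. by move=> H H'; exact: is_deriveD. Qed.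

Lemma derN f (x a : R) : is_derive x 1 f a -> is_derive x 1 (fun y => - f y) (- a).
Proof. by move=> H; exact: is_deriveN. Qed.

Lemma derM f g (x a b : R) : is_derive x 1 f a -> is_derive x 1 g b ->
  is_derive x 1 (fun y => f y * g y) (f x * b + g x * a).
Proof. by move=> H H'; exact: is_deriveM. Qed.

Lemma derC (h f : R -> R) (x a b : R) : is_derive (f x) 1 h a -> is_derive x 1 f b ->
  is_derive x 1 (fun y => h (f y)) (a * b).
Proof. by move=> H H'; exact: is_derive1_comp. Qed.

Lemma derMl c f (x a : R) : is_derive x 1 f a -> is_derive x 1 (fun y => c * f y) (c * a).
Proof. by move=> /(derM (der_cst c x)); rewrite mulr0 addr0. Qed.

Lemma derX f n (x a : R) : is_derive x 1 f a ->
  is_derive x 1 (fun y => f y ^+ n.+1) (n.+1%:R * f x ^+ n * a).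
Proof.
move=> H; elim: n => [|n IH]; first by rewrite expr0 mulr1 mul1r.
rewrite (_ : (fun y => _) = (fun y => f y * f y ^+ n.+1)); last by apply/funext => y; rewrite exprS.
apply: (is_derive_eq (derM H IH)); rewrite -[n.+2]addn1 natrD !exprS; ring.
Qed.

Lemma der_eq f (x a b : R) : is_derive x 1 f a -> a = b -> is_derive x 1 f b.
Proof. by move=> H <-. Qed.

Lemma der_continuous f (x a : R) : is_derive x 1 f a -> {for x, continuous f}.
Proof. by move=> H; apply: differentiable_continuous; apply/derivable1_diffP; case: H. Qed.

Lemma within_continuous_in (f : R -> R) (A : set R) : (forall y, A y -> {for y, continuous f}) ->
  {within A, continuous f}.
Proof.
move=> H; apply: continuous_in_subspaceT => y; rewrite inE; exact: H.
Qed.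

Lemma integrable_continuous f (a b : R) : (forall y, a <= y <= b -> {for y, continuous f}) ->
  lebesgue_measure.-integrable `[a, b] (EFin \o f).
Proof.
move=> H; apply: continuous_compact_integrable; first exact: segment_compact.
by apply: within_continuous_in => y /=; rewrite in_itv /=; exact: H.
Qed.

Lemma FTC (F f : R -> R) (a b : R) : a <= b ->
  (forall y, a <= y <= b -> is_derive y 1 F (f y)) ->
  (forall y, a <= y <= b -> {for y, continuous f}) ->
  \int[lebesgue_measure]_(y in `[a, b]) f y = F b - F a.
Proof.
rewrite le_eqVlt => /predU1P[->|ab] HF Hf.
  by rewrite subrr set_itv1 Rintegral_set1.
have cF y : a <= y <= b -> {for y, continuous F} by move=> /HF; exact: der_continuous.
rewrite /Rintegral (continuous_FTC2 (F := F) ab)//.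
- by apply: within_continuous_in => y /=; rewrite in_itv /=; exact: Hf.
- split.
  + move=> y; rewrite in_itv /= => /andP[y1 y2].
    by case: (HF y _) => //; rewrite !ltW.
  + by apply: cvg_at_right_filter; apply: cF; rewrite lexx ltW.
  + by apply: cvg_at_left_filter; apply: cF; rewrite lexx ltW.
- move=> y; rewrite in_itv /= => /andP[y1 y2].
  rewrite derive1E; have := HF y _; rewrite (ltW y1) (ltW y2) => /(_ isT) h.
  by rewrite derive_val.
Qed.

End RealCalculus.

Section ComplexCalculus.
Context {R : realType}.
Notation C := R[i].
Notation nc := (@Normc.normc R).
Notation mu := (@lebesgue_measure R).

Lemma complex_eqP (x y : C) : complex.Re x = complex.Re y -> complex.Im x = complex.Im y -> x = y.
Proof. by case: x => a b; case: y => c d /= -> ->. Qed.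

Lemma ReM (x y : C) : complex.Re (x * y) = complex.Re x * complex.Re y - complex.Im x * complex.Im y.
Proof. by case: x; case: y. Qed.
Lemma ImM (x y : C) : complex.Im (x * y) = complex.Re x * complex.Im y + complex.Im x * complex.Re y.
Proof. by case: x; case: y. Qed.
Lemma ReD (x y : C) : complex.Re (x + y) = complex.Re x + complex.Re y.
Proof. by case: x; case: y. Qed.
Lemma ImD (x y : C) : complex.Im (x + y) = complex.Im x + complex.Im y.
Proof. by case: x; case: y. Qed.
Lemma ReN (x : C) : complex.Re (- x) = - complex.Re x.
Proof. by case: x. Qed.
Lemma ImN (x : C) : complex.Im (- x) = - complex.Im x.
Proof. by case: x. Qed.
Lemma ReRM (r : R) (y : C) : complex.Re (r%:C%C * y) = r * complex.Re y.
Proof. by rewrite ReM /= mul0r subr0. Qed.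
Lemma ImRM (r : R) (y : C) : complex.Im (r%:C%C * y) = r * complex.Im y.
Proof. by rewrite ImM /= mul0r addr0. Qed.
Lemma Re_sum I (r : seq I) (P : pred I) (F : I -> C) :
  complex.Re (\sum_(i <- r | P i) F i) = \sum_(i <- r | P i) complex.Re (F i).
Proof. by elim/big_rec2: _ => // i x y _ <-; rewrite ReD. Qed.
Lemma Im_sum I (r : seq I) (P : pred I) (F : I -> C) :
  complex.Im (\sum_(i <- r | P i) F i) = \sum_(i <- r | P i) complex.Im (F i).
Proof. by elim/big_rec2: _ => // i x y _ <-; rewrite ImD. Qed.
Definition ReImE := (ReD, ImD, ReN, ImN, ReRM, ImRM, ReM, ImM).

(** * The complex exponential and powers of a positive base *)

Definition cexp (z : C) : C :=
  (expR (complex.Re z))%:C%C * (cos (complex.Im z) +i* sin (complex.Im z))%C.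

Lemma cexpD x y : cexp (x + y) = cexp x * cexp y.
Proof.
rewrite /cexp !(ReD, ImD) expRD cosD sinD.
by apply: complex_eqP; rewrite !(ReRM, ImRM, ReM, ImM) /=; ring.
Qed.

Lemma cexp0 : cexp 0 = 1.
Proof. by rewrite /cexp /= expR0 cos0 sin0; apply: complex_eqP; rewrite !(ReRM, ImRM) /= ?mul1r. Qed.

Lemma nc_cexp z : nc (cexp z) = expR (complex.Re z).
Proof.
rewrite /cexp ncM ncR ger0_norm ?expR_ge0// -[RHS]mulr1; congr (_ * _).
by rewrite /= cos2Dsin2 sqrtr1.
Qed.

Lemma expi_coeff (y : R) n : ((0 +i* y)%C ^+ n / n`!%:R : C) = (cos_coeff y n +i* sin_coeff y n)%C.
Proof.
have -> : (n`!%:R^-1 : C) = (n`!%:R^-1)%:C%C by rewrite fmorphV rmorph_nat.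
have E2 m : (0 +i* y)%C ^+ m.*2 = ((-1) ^+ m * y ^+ m.*2)%:C%C :> C.
  rewrite -mul2n !exprM -exprMn (_ : (0 +i* y)%C ^+ 2 = (-1 * y ^+ 2)%:C%C) -?rmorphXn//.
  by rewrite expr2; apply: complex_eqP; rewrite !(ReM, ImM) /=; ring.
rewrite -(odd_double_half n); case: (odd n); rewrite /= ?add1n ?add0n.
  rewrite cos_coeff_odd -sin_coeff'E /sin_coeff' exprS E2 exprS.
  by apply: complex_eqP; rewrite !(ReM, ImM) /= -?exprnP; ring.
rewrite sin_coeff_even -cos_coeff'E /cos_coeff' E2.
by apply: complex_eqP; rewrite !(ReM, ImM) /= -?exprnP; ring.
Qed.

Lemma psum_expR (x : R) : ccvg (psum (fun n => (x%:C%C) ^+ n / n`!%:R) 1) (expR x)%:C%C.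
Proof.
apply: ccvg_ReIm.
  rewrite (_ : (fun n => _) = series (exp_coeff x)); first exact: is_cvg_series_exp_coeff.
  apply/funext => n; rewrite /psum Re_sum /series /= big_mkord; apply: eq_bigr => i _.
  rewrite expr1n mulr1 /exp_coeff /= -rmorphXn (_ : i`!%:R^-1 = (i`!%:R^-1)%:C%C) ?ReRM//.
  by rewrite fmorphV rmorph_nat.
rewrite (_ : (fun n => _) = fun=> 0); first exact: cvg_cst.
apply/funext => n; rewrite /psum Im_sum big1// => i _.
rewrite expr1n mulr1 -rmorphXn (_ : i`!%:R^-1 = (i`!%:R^-1)%:C%C) ?ImRM ?mulr0//.
by rewrite fmorphV rmorph_nat.
Qed.

Lemma psum_expi (y : R) : ccvg (psum (fun n => ((0 +i* y)%C) ^+ n / n`!%:R) 1) (cos y +i* sin y)%C.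
Proof.
apply: ccvg_ReIm; rewrite /psum.
  rewrite (_ : (fun n => _) = series (cos_coeff y)).
    by rewrite /= cos.unlock; exact: is_cvg_series_cos_coeff.
  apply/funext => n; rewrite Re_sum /series /= big_mkord; apply: eq_bigr => i _.
  by rewrite expr1n mulr1 expi_coeff.
rewrite (_ : (fun n => _) = series (sin_coeff y)).
  by rewrite /= sin.unlock; exact: is_cvg_series_sin_coeff.
apply/funext => n; rewrite Im_sum /series /= big_mkord; apply: eq_bigr => i _.
by rewrite expr1n mulr1 expi_coeff.
Qed.

Lemma exp_geom_bounded (z : C) rho : 0 < rho ->
  geom_bounded (fun n => z ^+ n / n`!%:R) rho (expR (nc z * rho)).
Proof.
move=> r0 n; rewrite ncM ncX ncV nc_nat mulrAC -exprMn.
have h : 0 <= nc z * rho by rewrite mulr_ge0 ?nc_ge0 ?ltW.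
case: n => [|n].
  by rewrite expr0 fact0 invr1 mulr1; apply: le_trans (expR_ge1Dx _); rewrite lerDl.
by apply: le_trans (expR_ge1Dxn n h); rewrite lerDr.
Qed.

(** The series of exp(x) and exp(iy) are read as power series in an auxiliary variable, evaluated at
    1. Their coefficients are geometrically bounded for every radius, in particular for the radius 8
    that the Cauchy product asks for, and the binomial theorem identifies the product. *)
Lemma cexp_series (z : C) : ccvg (psum (fun n => z ^+ n / n`!%:R) 1) (cexp z).
Proof.
case: z => x y; rewrite /cexp /=.
have r8 : (0 : R) < 8 by [].
have H := ccvg_conv r8 (exp_geom_bounded (x%:C%C) r8) (exp_geom_bounded (0 +i* y)%C r8) _
  (psum_expR x) (psum_expi y).
have h1 : 8 * nc 1 <= 8 by rewrite nc1 mulr1.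
apply: ccvg_eq (H h1) => N; apply: eq_bigr => n _; congr (_ * _).
have -> : (x +i* y)%C = x%:C%C + (0 +i* y)%C by apply: complex_eqP => /=; rewrite ?addr0 ?add0r.
rewrite exprDn /conv mulr_suml.
rewrite (reindex_inj rev_ord_inj) /=; apply: eq_bigr => i _.
have iN : (i <= n)%N by rewrite -ltnS.
rewrite subSS subKn//.
have -> : n`!%:R = 'C(n, i)%:R * (i`!%:R * (n - i)`!%:R) :> C.
  by rewrite -!natrM -(bin_fact iN).
have f0 m : (m`!%:R : C) != 0 by rewrite pnatr_eq0 -lt0n fact_gt0.
have b0 : ('C(n, i)%:R : C) != 0 by rewrite pnatr_eq0 -lt0n bin_gt0.
by rewrite -[in RHS]mulr_natl; field; rewrite ?f0 ?b0.
Qed.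

Lemma has_ps_cexp (c : C) : has_ps (fun z => cexp (c * z)) 0 (fun n => c ^+ n / n`!%:R).
Proof.
exists 1 => // z _; rewrite subr0; apply: ccvg_eq (cexp_series (c * z)) => n.
by apply: eq_bigr => i _; rewrite expr1n mulr1 exprMn mulrAC.
Qed.

Lemma cpowE (x : R) s : 0 < x -> cpow x s = cexp ((ln x)%:C%C * s).
Proof.
move=> x0; rewrite /cpow /cexp ReRM ImRM /powR gt_eqF// [complex.Re s * _]mulrC.
by rewrite [complex.Im s * _]mulrC.
Qed.

Lemma cpowD (x : R) s t : 0 < x -> cpow x (s + t) = cpow x s * cpow x t.
Proof. by move=> x0; rewrite !cpowE// mulrDr cexpD. Qed.

Lemma cpowMx (x y : R) s : 0 < x -> 0 < y -> cpow (x * y) s = cpow x s * cpow y s.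
Proof. by move=> x0 y0; rewrite !cpowE ?mulr_gt0// lnM// rmorphD mulrDl cexpD. Qed.

Lemma nc_cpow (x : R) s : 0 < x -> nc (cpow x s) = x `^ complex.Re s.
Proof. by move=> x0; rewrite cpowE// nc_cexp ReRM /powR gt_eqF// mulrC. Qed.

Lemma cpow1x s : cpow 1 s = 1 :> C.
Proof. by rewrite cpowE// ln1 mul0r cexp0. Qed.

Lemma cpowx1 (x : R) : 0 < x -> cpow x 1 = x%:C%C.
Proof.
move=> x0; rewrite /cpow /= mul0r cos0 sin0 powRr1 ?ltW//.
by apply: complex_eqP; rewrite !ReImE /=; ring.
Qed.

Lemma cpowB1 (x : R) s : 0 < x -> cpow x (s - 1) = (x^-1)%:C%C * cpow x s.
Proof.
move=> x0; have -> : cpow x s = cpow x (s - 1) * x%:C%C by rewrite -cpowx1// -cpowD// subrK.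
by rewrite mulrCA -rmorphM mulVf ?gt_eqF// rmorph1 mulr1.
Qed.

Lemma Re_cpow (x : R) (s : C) : complex.Re (cpow x s) = x `^ complex.Re s * cos (complex.Im s * ln x).
Proof. by rewrite /cpow ReRM. Qed.
Lemma Im_cpow (x : R) (s : C) : complex.Im (cpow x s) = x `^ complex.Re s * sin (complex.Im s * ln x).
Proof. by rewrite /cpow ImRM. Qed.

(** * Derivatives of complex-valued functions of a real variable *)

Definition cderive (y : R) (f : R -> C) (d : C) :=
  is_derive y 1 (fun x => complex.Re (f x)) (complex.Re d) /\
  is_derive y 1 (fun x => complex.Im (f x)) (complex.Im d).

Lemma cderive_eq y f a b : cderive y f a -> a = b -> cderive y f b.
Proof. by move=> H <-. Qed.

Lemma cderive_cst y c : cderive y (fun=> c) 0.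
Proof. by split; exact: der_cst. Qed.

Lemma cderiveD y f g a b : cderive y f a -> cderive y g b ->
  cderive y (fun x => f x + g x) (a + b).
Proof.
move=> [f1 f2] [g1 g2]; split.
  by rewrite ReD; under eq_fun do rewrite ReD; exact: derD.
by rewrite ImD; under eq_fun do rewrite ImD; exact: derD.
Qed.

Lemma cderiveM y f g a b : cderive y f a -> cderive y g b ->
  cderive y (fun x => f x * g x) (f y * b + g y * a).
Proof.
move=> [f1 f2] [g1 g2]; split.
  under eq_fun do rewrite ReM.
  apply: (der_eq (derD (derM f1 g1) (derN (derM f2 g2)))).
  by rewrite ReD !ReM; ring.
under eq_fun do rewrite ImM.
apply: (der_eq (derD (derM f1 g2) (derM f2 g1))).
by rewrite ImD !ImM; ring.
Qed.

Lemma cderiveZ c y f a : cderive y f a -> cderive y (fun x => c * f x) (c * a).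
Proof. by move=> H; apply: (cderive_eq (cderiveM (cderive_cst y c) H)); rewrite mulr0 addr0. Qed.

Lemma cderiveN y f a : cderive y f a -> cderive y (fun x => - f x) (- a).
Proof.
move=> /(cderiveZ (-1)); rewrite mulN1r.
by rewrite (_ : (fun x => _) = (fun x => - f x))//; apply/funext => x; rewrite mulN1r.
Qed.

Lemma cderive_real (y : R) (f : R -> R) (a : R) : is_derive y 1 f a -> cderive y (fun x => (f x)%:C%C) a%:C%C.
Proof. by move=> H; split => //; exact: der_cst. Qed.

Lemma cderive_cpow y s : 0 < y -> cderive y (fun x => cpow x s) (s * cpow y (s - 1)).
Proof.
move=> y0; rewrite cpowB1//.
have Dp := is_derive1_powR (complex.Re s) y0.
have Dl : is_derive y 1 (fun x => complex.Im s * ln x) (complex.Im s * y^-1).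
  by apply: derMl; exact: is_derive1_ln.
have Dc := derC (is_derive_cos _) Dl; have Ds := derC (is_derive_sin _) Dl.
have pE : y `^ (complex.Re s - 1) = y^-1 * y `^ complex.Re s.
  rewrite powRD; last by rewrite (gt_eqF y0) implybT.
  by rewrite powR_inv1 ?(ltW y0)// mulrC.
split.
  under eq_fun do rewrite Re_cpow.
  by apply: (der_eq (derM Dp Dc)); rewrite ReM ReRM ImRM Re_cpow Im_cpow pE; ring.
under eq_fun do rewrite Im_cpow.
by apply: (der_eq (derM Dp Ds)); rewrite ImM ReRM ImRM Re_cpow Im_cpow pE; ring.
Qed.

(** * Integrals of complex-valued functions *)

Definition cint (D : set R) (f : R -> C) : C :=
  (\int[mu]_(y in D) complex.Re (f y) +i* \int[mu]_(y in D) complex.Im (f y))%C.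

Definition cintegrable (D : set R) (f : R -> C) :=
  mu.-integrable D (fun y => (complex.Re (f y))%:E) /\
  mu.-integrable D (fun y => (complex.Im (f y))%:E).

Lemma integrableMl D (c : R) (f : R -> R) : measurable D -> mu.-integrable D (EFin \o f) ->
  mu.-integrable D (EFin \o (fun y => c * f y)).
Proof.
move=> mD f1.
have : mu.-integrable D (fun x => (c * f x)%:E); last by [].
by under eq_fun do rewrite EFinM; exact: integrableZl.
Qed.

Lemma integrableDr D (f g : R -> R) : measurable D -> mu.-integrable D (EFin \o f) ->
  mu.-integrable D (EFin \o g) -> mu.-integrable D (EFin \o (fun y => f y + g y)).
Proof.
move=> mD f1 g1.
have : mu.-integrable D (fun x => (f x + g x)%:E); last by [].
by under eq_fun do rewrite EFinD; exact: integrableD.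
Qed.

Lemma cintegrableZ D c f : measurable D -> cintegrable D f -> cintegrable D (fun y => c * f y).
Proof.
move=> mD [f1 f2].
have h (a b : R) : mu.-integrable D (fun y => (a * complex.Re (f y) + b * complex.Im (f y))%:E).
  by under eq_fun do rewrite EFinD !EFinM; apply: integrableD => //; exact: integrableZl.
split.
  have := h (complex.Re c) (- complex.Im c).
  by apply: eq_integrable => // y _; rewrite ReM mulNr.
have := h (complex.Im c) (complex.Re c).
by apply: eq_integrable => // y _; rewrite ImM addrC.
Qed.

Lemma cintegrableD D f g : measurable D -> cintegrable D f -> cintegrable D g ->
  cintegrable D (fun y => f y + g y).
Proof.
move=> mD [f1 f2] [g1 g2]; split.
  under eq_fun do rewrite ReD EFinD; exact: integrableD.
under eq_fun do rewrite ImD EFinD; exact: integrableD.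
Qed.

Lemma cintD D f g : measurable D -> cintegrable D f -> cintegrable D g ->
  cint D (fun y => f y + g y) = cint D f + cint D g.
Proof.
move=> mD [f1 f2] [g1 g2]; apply: complex_eqP => /=.
  by under eq_Rintegral do rewrite ReD; rewrite RintegralD.
by under eq_Rintegral do rewrite ImD; rewrite RintegralD.
Qed.

Lemma cintZ D c f : measurable D -> cintegrable D f ->
  cint D (fun y => c * f y) = c * cint D f.
Proof.
move=> mD [f1 f2].
have h (a b : R) : \int[mu]_(y in D) (a * complex.Re (f y) + b * complex.Im (f y)) =
    a * (\int[mu]_(y in D) complex.Re (f y)) + b * \int[mu]_(y in D) complex.Im (f y).
  rewrite RintegralD//; last 2 first.
  - have : mu.-integrable D (fun x => (a * complex.Re (f x))%:E); last by [].
    by under eq_fun do rewrite EFinM; exact: integrableZl.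
  - have : mu.-integrable D (fun x => (b * complex.Im (f x))%:E); last by [].
    by under eq_fun do rewrite EFinM; exact: integrableZl.
  by rewrite !RintegralZl.
apply: complex_eqP => /=; rewrite !(ReM, ImM) /=.
  rewrite -mulNr -h; apply: eq_Rintegral => y _; by rewrite ReM mulNr.
by rewrite addrC -h; apply: eq_Rintegral => y _; rewrite ImM addrC.
Qed.

Lemma cint0 D : cint D (fun=> 0) = 0.
Proof.
by rewrite /cint /= /Rintegral integral0.
Qed.

Lemma cintegrable0 D : cintegrable D (fun=> 0).
Proof. by split; exact: integrable0. Qed.

Lemma cintegrable_sum D I (r : seq I) (F : I -> R -> C) : measurable D ->
  (forall i, cintegrable D (F i)) -> cintegrable D (fun y => \sum_(i <- r) F i y).
Proof.
move=> mD H; elim: r => [|i r IH].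
  rewrite (_ : (fun x => _) = fun=> 0); first exact: cintegrable0.
  by apply/funext => x; rewrite big_nil.
rewrite (_ : (fun x => _) = fun x => F i x + \sum_(j <- r) F j x).
  exact (cintegrableD mD (H i) IH).
by apply/funext => x; rewrite big_cons.
Qed.

Lemma cint_sum D I (r : seq I) (F : I -> R -> C) : measurable D ->
  (forall i, cintegrable D (F i)) ->
  cint D (fun y => \sum_(i <- r) F i y) = \sum_(i <- r) cint D (F i).
Proof.
move=> mD H; elim: r => [|i r IH].
  rewrite (_ : (fun x => _) = fun=> 0); first by rewrite cint0 big_nil.
  by apply/funext => x; rewrite big_nil.
rewrite big_cons -IH -(cintD mD (H i) (cintegrable_sum r mD H)).
by congr cint; apply/funext => x; rewrite big_cons.
Qed.

Lemma eq_cint D f g : {in D, f =1 g} -> cint D f = cint D g.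
Proof. by move=> fg; rewrite /cint; congr Complex; apply: eq_Rintegral => y /fg ->. Qed.

Lemma eq_cintegrable D f g : measurable D -> {in D, f =1 g} -> cintegrable D f -> cintegrable D g.
Proof.
move=> mD fg [f1 f2]; split.
  by apply: eq_integrable f1 => // y /fg ->.
by apply: eq_integrable f2 => // y /fg ->.
Qed.

Lemma cint_setU A B f : measurable A -> measurable B -> cintegrable (A `|` B) f ->
  [disjoint A & B] -> cint (A `|` B) f = cint A f + cint B f.
Proof. by move=> mA mB [f1 f2] AB; apply: complex_eqP => /=; rewrite Rintegral_setU. Qed.

(** The two components are bounded separately, which costs the factor 2. *)
Lemma nc_cint_le D f (g : R -> R) : measurable D -> cintegrable D f ->
  mu.-integrable D (EFin \o g) -> (forall y, D y -> nc (f y) <= g y) ->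
  nc (cint D f) <= 2 * \int[mu]_(y in D) g y.
Proof.
move=> mD [f1 f2] ig fg; apply: le_trans (nc_le_ReIm _) _ => /=.
rewrite -[2]/(1 + 1) mulrDl !mul1r; apply: lerD.
  apply: le_trans (@le_normr_Rintegral _ _ _ mu D (fun y => complex.Re (f y)) mD f1) _; apply: le_Rintegral => //.
    exact: (integrable_norm f1).
  by move=> y /fg; apply: le_trans; exact: Re_le_nc.
apply: le_trans (@le_normr_Rintegral _ _ _ mu D (fun y => complex.Im (f y)) mD f2) _; apply: le_Rintegral => //.
  exact: (integrable_norm f2).
by move=> y /fg; apply: le_trans; exact: Im_le_nc.
Qed.

Definition cmeasurable (D : set R) (f : R -> C) :=
  measurable_fun D (fun y => complex.Re (f y)) /\ measurable_fun D (fun y => complex.Im (f y)).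

Lemma cintegrable_le D f (g : R -> R) : measurable D -> cmeasurable D f ->
  mu.-integrable D (EFin \o g) -> (forall y, D y -> nc (f y) <= g y) -> cintegrable D f.
Proof.
move=> mD [f1 f2] ig fg; split; apply: (@le_integrable _ _ _ mu D mD _ (EFin \o g)) => //.
- exact/measurable_EFinP.
- move=> y Dy; rewrite lee_fin; apply: le_trans (Re_le_nc _) _.
  by apply: le_trans (fg _ Dy) _; exact: ler_norm.
- exact/measurable_EFinP.
- move=> y Dy; rewrite lee_fin; apply: le_trans (Im_le_nc _) _.
  by apply: le_trans (fg _ Dy) _; exact: ler_norm.
Qed.

Lemma dominated_Rintegral D (f_ : nat -> R -> R) f (g : R -> R) : measurable D ->
  (forall n, measurable_fun D (f_ n)) -> (forall y, D y -> f_ ^~ y @ \oo --> f y) ->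
  mu.-integrable D (EFin \o g) -> (forall n y, D y -> `|f_ n y| <= g y) ->
  mu.-integrable D (EFin \o f) /\
  (fun n => \int[mu]_(y in D) f_ n y) @ \oo --> \int[mu]_(y in D) f y.
Proof.
move=> mD mf cf ig fg.
have mF n : measurable_fun D (fun y => (f_ n y)%:E) by apply/measurable_EFinP.
have cF : {ae mu, forall y, D y -> (f_ n y)%:E @[n --> \oo] --> (f y)%:E}.
  by apply/aeW => y Dy; apply: cvg_EFin; [exact: nearW|exact: cf].
have mf' : measurable_fun D (fun y => (f y)%:E).
  apply: (emeasurable_fun_cvg (fun n y => (f_ n y)%:E)) => //.
  by move=> y Dy; apply: cvg_EFin; [exact: nearW|exact: cf].
have dF : {ae mu, forall y n, D y -> (`|(f_ n y)%:E| <= (g y)%:E)%E}.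
  by apply/aeW => y n Dy; rewrite lee_fin fg.
have [i1 _ i3] := @dominated_convergence _ _ _ mu D mD (fun n y => (f_ n y)%:E) _ (fun y => (g y)%:E) mF mf' cF ig dF.
split => //; rewrite /Rintegral; apply: fine_cvg.
by rewrite fineK//; exact: integrable_fin_num.
Qed.

Lemma cint_dominated D (f_ : nat -> R -> C) f (g : R -> R) : measurable D ->
  (forall n, cmeasurable D (f_ n)) -> (forall y, D y -> ccvg (f_ ^~ y) (f y)) ->
  mu.-integrable D (EFin \o g) -> (forall n y, D y -> nc (f_ n y) <= g y) ->
  cintegrable D f /\ ccvg (fun n => cint D (f_ n)) (cint D f).
Proof.
move=> mD mf cf ig fg.
have [i1 c1] : mu.-integrable D (EFin \o (fun y => complex.Re (f y))) /\
    (fun n => \int[mu]_(y in D) complex.Re (f_ n y)) @ \oo --> \int[mu]_(y in D) complex.Re (f y).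
  apply: (dominated_Rintegral (f_ := fun n y => complex.Re (f_ n y)) mD _ _ ig).
  - by move=> n; case: (mf n).
  - by move=> y Dy; exact: (ccvg_Re (cf y Dy)).
  - by move=> n y Dy; apply: le_trans (fg n y Dy); exact: Re_le_nc.
have [i2 c2] : mu.-integrable D (EFin \o (fun y => complex.Im (f y))) /\
    (fun n => \int[mu]_(y in D) complex.Im (f_ n y)) @ \oo --> \int[mu]_(y in D) complex.Im (f y).
  apply: (dominated_Rintegral (f_ := fun n y => complex.Im (f_ n y)) mD _ _ ig).
  - by move=> n; case: (mf n).
  - by move=> y Dy; exact: (ccvg_Im (cf y Dy)).
  - by move=> n y Dy; apply: le_trans (fg n y Dy); exact: Im_le_nc.
by split => //; exact: ccvg_ReIm.
Qed.

Lemma CFTC (F f f' : R -> C) (a b : R) : a <= b ->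
  (forall y, a <= y <= b -> cderive y F (f y)) ->
  (forall y, a <= y <= b -> cderive y f (f' y)) ->
  cintegrable `[a, b] f /\ cint `[a, b] f = F b - F a.
Proof.
move=> ab HF Hf.
have c1 y : a <= y <= b -> {for y, continuous (fun y => complex.Re (f y))}.
  by move=> /Hf[h _]; exact: der_continuous h.
have c2 y : a <= y <= b -> {for y, continuous (fun y => complex.Im (f y))}.
  by move=> /Hf[_ h]; exact: der_continuous h.
split; first by split; exact: integrable_continuous.
apply: complex_eqP; rewrite ?(ReD, ImD, ReN, ImN) /=.
  by apply: (FTC (F := fun y => complex.Re (F y))) => // y /HF[].
by apply: (FTC (F := fun y => complex.Im (F y))) => // y /HF[].
Qed.

Lemma cmeasurableM D f g : cmeasurable D f -> cmeasurable D g -> cmeasurable D (fun y => f y * g y).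
Proof.
move=> [f1 f2] [g1 g2]; split.
  by under eq_fun do rewrite ReM; apply: measurable_funB; exact: measurable_funM.
by under eq_fun do rewrite ImM; apply: measurable_funD; exact: measurable_funM.
Qed.

Lemma cmeasurable_real D (f : R -> R) : measurable_fun D f -> cmeasurable D (fun y => (f y)%:C%C).
Proof. by move=> mf; split => //=; exact: measurable_cst. Qed.

Lemma cmeasurable_cst D c : cmeasurable D (fun=> c).
Proof. by split; exact: measurable_cst. Qed.

Lemma cmeasurableD D f g : cmeasurable D f -> cmeasurable D g -> cmeasurable D (fun y => f y + g y).
Proof.
move=> [f1 f2] [g1 g2]; split.
  by under eq_fun do rewrite ReD; exact: measurable_funD.
by under eq_fun do rewrite ImD; exact: measurable_funD.
Qed.

Lemma cmeasurable_sum D I (r : seq I) (F : I -> R -> C) : (forall i, cmeasurable D (F i)) ->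
  cmeasurable D (fun y => \sum_(i <- r) F i y).
Proof.
move=> H; elim: r => [|i r IH].
  rewrite (_ : (fun x => _) = fun=> 0); first exact: cmeasurable_cst.
  by apply/funext => x; rewrite big_nil.
rewrite (_ : (fun x => _) = fun x => F i x + \sum_(j <- r) F j x).
  exact (cmeasurableD (H i) IH).
by apply/funext => x; rewrite big_cons.
Qed.

Lemma cmeasurable_cpow D s : measurable D -> cmeasurable D (fun y => cpow y s).
Proof.
move=> mD; have ml : measurable_fun [set: R] (fun y => complex.Im s * ln y).
  by apply: measurable_funM => //; exact: measurable_ln.
split; apply: measurable_funTS.
  under eq_fun do rewrite Re_cpow; apply: measurable_funM; first exact: measurable_powR.
  by apply: (measurableT_comp _ ml); apply: continuous_measurable_fun; exact: continuous_cos.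
under eq_fun do rewrite Im_cpow; apply: measurable_funM; first exact: measurable_powR.
by apply: (measurableT_comp _ ml); apply: continuous_measurable_fun; exact: continuous_sin.
Qed.

End ComplexCalculus.

(** * Mellin transforms *)

Section Mellin.
Context {R : realType}.
Notation C := R[i].
Notation nc := (@Normc.normc R).
Notation mu := (@lebesgue_measure R).
Notation D := (`[1, +oo[%classic : set R).

Definition mellin (g : R -> R) (s : C) : C :=
  cint D (fun y => (g y)%:C%C * cpow y (- s - 1)).

Lemma exp_partial_le (x : R) N : 0 <= x -> \sum_(i < N) x ^+ i / i`!%:R <= expR x.
Proof.
move=> x0; rewrite /expR.
have -> : \sum_(i < N) x ^+ i / i`!%:R = series (exp_coeff x) N by rewrite /series /= big_mkord.
apply: nondecreasing_cvgn_le; last exact: is_cvg_series_exp_coeff.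
by apply: nondecreasing_series => i _ _; exact: exp_coeff_ge0.
Qed.

Lemma exp_term_le (x : R) N : 0 <= x -> x ^+ N / N`!%:R <= expR x.
Proof.
move=> x0; apply: le_trans (exp_partial_le N.+1 x0); rewrite big_ord_recr /= lerDr.
by apply: sumr_ge0 => i _; rewrite divr_ge0// exprn_ge0.
Qed.

Lemma measurable_D : measurable D. Proof. exact: measurable_itv. Qed.

Lemma D_ge1 y : D y -> 1 <= y.
Proof. by rewrite /= in_itv /= andbT. Qed.

Lemma nc_kernel (g : R -> R) s y : D y ->
  nc ((g y)%:C%C * cpow y (- s - 1)) = `|g y| * y `^ (- complex.Re s - 1).
Proof.
move=> /D_ge1 y1; rewrite ncM ncR nc_cpow ?(lt_le_trans ltr01)//.
by rewrite !ReD !ReN.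
Qed.

(** The slack [complex.Re s - c] pays for a factor y^r. This is what dominates the exponential
    series in the expansion of a Mellin transform. *)
Lemma kernel_exp_le (g : R -> R) c s r y : D y -> r <= complex.Re s - c ->
  expR (r * ln y) * nc ((g y)%:C%C * cpow y (- s - 1)) <= `|g y| * y `^ (- c - 1).
Proof.
move=> Dy rs; have y1 := D_ge1 Dy; have y0 : 0 < y by apply: lt_le_trans y1.
rewrite nc_kernel// mulrCA ler_wpM2l// /powR gt_eqF// -expRD ler_expR -mulrDl.
by rewrite ler_wpM2r ?ln_ge0//; lra.
Qed.

Lemma cmeasurable_kernel (g : R -> R) s : measurable_fun setT g ->
  cmeasurable D (fun y => (g y)%:C%C * cpow y (- s - 1)).
Proof.
move=> mg; apply: cmeasurableM.
  by apply: cmeasurable_real; exact: measurable_funTS.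
by apply: cmeasurable_cpow; exact: measurable_D.
Qed.

Lemma mellin_integrable (g : R -> R) c s : measurable_fun setT g ->
  mu.-integrable D (EFin \o (fun y => `|g y| * y `^ (- c - 1))) -> c <= complex.Re s ->
  cintegrable D (fun y => (g y)%:C%C * cpow y (- s - 1)).
Proof.
move=> mg ig cs; apply: (cintegrable_le measurable_D (cmeasurable_kernel _ mg) ig) => y Dy.
have h0 : 0 <= complex.Re s - c by rewrite subr_ge0.
by have := kernel_exp_le g Dy h0; rewrite mul0r expR0 mul1r.
Qed.

(** With w = z - s, the factor y^(-w) = exp(- w ln y) is expanded in powers of w and integrated term
    by term. For |w| < Re s - c all partial sums are dominated by the one integrable function |g|
    y^(-c-1). *)
Lemma mellin_has_ps (g : R -> R) c s : measurable_fun setT g ->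
  mu.-integrable D (EFin \o (fun y => `|g y| * y `^ (- c - 1))) -> c < complex.Re s ->
  has_ps (mellin g) s
    (fun n => cint D (fun y => ((- ln y) ^+ n / n`!%:R)%:C%C * ((g y)%:C%C * cpow y (- s - 1)))).
Proof.
move=> mg ig cs; set r := complex.Re s - c.
have r0 : 0 < r by rewrite subr_gt0.
pose K y := (g y)%:C%C * cpow y (- s - 1).
have mK : cmeasurable D K by exact: cmeasurable_kernel.
have mln : measurable_fun D (fun y : R => - ln y).
  by apply: measurable_funTS; apply: measurableT_comp => //; exact: measurable_ln.
pose V n y := ((- ln y) ^+ n / n`!%:R)%:C%C * K y.
have iV n : cintegrable D (V n).
  (* From (r ln y)^n / n! <= exp(r ln y), the factor (ln y)^n / n! is at most r^-n y^r. *)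
  pose q := (r / 1) ^- n.
  apply: (@cintegrable_le _ D (V n) (fun y => q * (`|g y| * y `^ (- c - 1)))) => //.
  - apply: cmeasurableM => //; apply: cmeasurable_real.
    by apply: measurable_funM => //; exact: measurable_funX.
  - by apply: integrableMl => //; exact: measurable_D.
  - move=> y Dy; rewrite /V ncM ncR.
    have l0 : 0 <= ln y by rewrite ln_ge0// D_ge1.
    apply: le_trans (ler_wpM2l _ (kernel_exp_le g Dy (lexx r))); last first.
      by rewrite invr_ge0 exprn_ge0// divr1 ltW.
    rewrite mulrA ler_wpM2r ?nc_ge0// normrM normrX normrN (ger0_norm l0) normfV.
    rewrite (ger0_norm (ler0n _ _)) /q divr1 [leRHS]mulrC ler_pdivlMr ?exprn_gt0//.
    have := exp_term_le n (mulr_ge0 (ltW r0) l0).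
    by rewrite exprMn [r ^+ n * _]mulrC mulrAC.
exists r => // z zr; set w := z - s.
pose F_ N y := \sum_(n < N) w ^+ n * V n y.
have iW i : cintegrable D (fun y => w ^+ i * V i y) := cintegrableZ (w ^+ i) measurable_D (iV i).
have E N : cint D (F_ N) = psum (fun n => cint D (V n)) w N.
  rewrite /F_ (@cint_sum _ D _ (index_enum 'I_N) (fun (i : 'I_N) y => w ^+ i * V i y) measurable_D (fun i => iW i)).
  by apply: eq_bigr => i _; rewrite (cintZ (w ^+ i) measurable_D (iV i)) mulrC.
apply: (ccvg_eq (u := fun N => cint D (F_ N)) E).
suff [H1 [H2 H3]] : (forall N, cmeasurable D (F_ N)) /\
    (forall y, D y -> ccvg (F_ ^~ y) ((g y)%:C%C * cpow y (- z - 1))) /\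
    (forall N y, D y -> nc (F_ N y) <= `|g y| * y `^ (- c - 1)).
  exact: (cint_dominated measurable_D H1 H2 ig H3).2.
split; [|split].
- move=> N; apply: cmeasurable_sum => i; apply: cmeasurableM; first exact: cmeasurable_cst.
  apply: cmeasurableM => //; apply: cmeasurable_real.
  by apply: measurable_funM => //; exact: measurable_funX.
- move=> y Dy; have y0 : 0 < y by apply: lt_le_trans (D_ge1 Dy).
  have -> : (g y)%:C%C * cpow y (- z - 1) = K y * cexp (- (ln y)%:C%C * w).
    rewrite /K -mulrA mulNr -mulrN -cpowE// -cpowD//; congr (_ * cpow _ _).
    by rewrite /w; ring.
  apply: ccvg_eq (ccvgMl (K y) (cexp_series _)) => N.
  rewrite /psum mulr_sumr; apply: eq_bigr => i _.
  rewrite expr1n mulr1 /V exprMn rmorphM /= rmorphXn rmorphN fmorphV rmorph_nat.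
  by ring.
- move=> N y Dy; have l0 : 0 <= ln y by rewrite ln_ge0// D_ge1.
  apply: le_trans (kernel_exp_le g Dy (ltW zr : nc w <= _)).
  apply: le_trans (nc_sum _ _ _) _; rewrite -/(K y).
  apply: le_trans (_ : (\sum_(i < N) (nc w * ln y) ^+ i / i`!%:R) * nc (K y) <= _).
    rewrite mulr_suml; apply: ler_sum => i _; rewrite ncM ncX /V ncM ncR mulrA.
    rewrite ler_wpM2r ?nc_ge0// normrM normrX normrN (ger0_norm l0) normfV.
    by rewrite (ger0_norm (ler0n _ _)) exprMn mulrA.
  by rewrite ler_wpM2r ?nc_ge0// exp_partial_le// mulr_ge0 ?nc_ge0.
Qed.

Lemma analytic_mellin (g : R -> R) c s : measurable_fun setT g ->
  mu.-integrable D (EFin \o (fun y => `|g y| * y `^ (- c - 1))) -> c < complex.Re s ->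
  analytic_at (mellin g) s.
Proof. by move=> mg ig cs; apply/analytic_atP; eexists; exact: mellin_has_ps mg ig cs. Qed.

(** Analyticity enters the moment only through continuity along a vertical line, which makes the
    integrands in t integrable; a local Lipschitz bound is enough for that. *)
Lemma line_lip (f : C -> C) (sigma t0 : R) : analytic_at f (sigma +i* t0)%C ->
  exists r L : R, [/\ 0 < r, 0 <= L & forall t, `|t - t0| < r ->
    nc (f (sigma +i* t)%C - f (sigma +i* t0)%C) <= L * `|t - t0|].
Proof.
move=> /analytic_lip[r [L [r0 L0 H]]]; exists r, L; split => // t tr.
have E : nc ((sigma +i* t)%C - (sigma +i* t0)%C) = `|t - t0|.
  by rewrite /= subrr expr0n add0r sqrtr_sqr.
by rewrite -E; apply: H; rewrite E.
Qed.

Lemma lip_continuous (h : R -> R) (t0 r L : R) : 0 < r -> 0 <= L ->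
  (forall t, `|t - t0| < r -> `|h t - h t0| <= L * `|t - t0|) -> {for t0, continuous h}.
Proof.
move=> r0 L0 H; apply/cvgrPdist_lt => e e0; apply/nbhs_ballP.
exists (Num.min r (e / (L + 1))); first by rewrite /= lt_min r0 divr_gt0//; lra.
move=> t; rewrite /ball /= lt_min => /andP[tr te]; rewrite distrC.
apply: le_lt_trans (H t _) _; first by rewrite distrC.
move: te; rewrite ltr_pdivlMr; last lra.
by rewrite distrC; have := normr_ge0 (t - t0); lra.
Qed.

Lemma line_continuous_Re (f : C -> C) (sigma t0 : R) : analytic_at f (sigma +i* t0)%C ->
  {for t0, continuous (fun t => complex.Re (f (sigma +i* t)%C))}.
Proof.
move=> /line_lip[r [L [r0 L0 H]]]; apply: (lip_continuous r0 L0) => t /H.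
by apply: le_trans; rewrite -ReN -ReD; exact: Re_le_nc.
Qed.

Lemma line_continuous_Im (f : C -> C) (sigma t0 : R) : analytic_at f (sigma +i* t0)%C ->
  {for t0, continuous (fun t => complex.Im (f (sigma +i* t)%C))}.
Proof.
move=> /line_lip[r [L [r0 L0 H]]]; apply: (lip_continuous r0 L0) => t /H.
by apply: le_trans; rewrite -ImN -ImD; exact: Im_le_nc.
Qed.

End Mellin.

(** * Residues *)

Section Residues.
Context {R : realType}.
Notation C := R[i].
Notation nc := (@Normc.normc R).

Lemma has_ps_pow (a : C) d : has_ps (fun z => (z - a) ^+ d) a (fun n => (n == d)%:R).
Proof.
exists 1 => // z _; apply/(ccvg_shift d.+1); apply: ccvg_eq (ccvg_cst _) => n.
have dn : (d < n + d.+1)%N by rewrite addnS ltnS leq_addl.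
rewrite /psum (bigD1 (Ordinal dn))//= eqxx mul1r big1 ?addr0// => i.
by rewrite -val_eqE /= => /negbTE ->; rewrite mul0r.
Qed.

Lemma has_ps_punctured (f : C -> C) (a : C) (u : nat -> C) (r : R) : 0 < r ->
  (forall z, z != a -> nc (z - a) < r -> ccvg (psum u (z - a)) (f z)) ->
  has_ps (fun z => if z == a then u 0%N else f z) a u.
Proof.
move=> r0 H; exists r => // z zr; have [->|za] := eqVneq z a; last exact: H.
rewrite subrr; apply/(ccvg_shift 1); apply: ccvg_eq (ccvg_cst (u 0%N)) => n.
rewrite addn1 /psum big_ord_recl expr0 mulr1 big1 ?addr0// => i _.
by rewrite exprS mul0r mulr0.
Qed.

Lemma conv_pow d (u : nat -> C) n : (d <= n)%N -> conv (fun n => (n == d)%:R) u n = u (n - d)%N.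
Proof.
move=> dn; have dn' : (d < n.+1)%N by rewrite ltnS.
rewrite /conv (bigD1 (Ordinal dn'))//= eqxx mul1r big1 ?addr0// => i.
by rewrite -val_eqE /= => /negbTE ->; rewrite mul0r.
Qed.

(** Since [residue] chooses a value, it can be computed only up to this uniqueness. The expansion
    with the smaller pole order is multiplied by the missing power of z - a; the difference of the
    two then vanishes off the centre, hence has zero coefficients. *)
Lemma residue_unique (f : C -> C) (a c c' : C) : is_residue f a c -> is_residue f a c' -> c = c'.
Proof.
have key c1 c2 m m' u u' : u m = c1 -> u' m' = c2 -> (m <= m')%N ->
  (\forall z \near (a : C^o)^', series (fun n => u n * (z - a) ^+ n) @ \oo
        --> ((z - a) ^+ m.+1 * f z : C^o)) ->
  (\forall z \near (a : C^o)^', series (fun n => u' n * (z - a) ^+ n) @ \oo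
        --> ((z - a) ^+ m'.+1 * f z : C^o)) -> c1 = c2.
  move=> <- <- mm /nearC'[r r0 H] /nearC'[r' r'0 H'].
  have H1 : has_ps (fun z => if z == a then u 0%N else (z - a) ^+ m.+1 * f z) a u.
    apply: (has_ps_punctured r0) => z za zr.
    by have /cvgC := H z za zr; rewrite seriesE.
  have H2 : has_ps (fun z => if z == a then u' 0%N else (z - a) ^+ m'.+1 * f z) a u'.
    apply: (has_ps_punctured r'0) => z za zr.
    by have /cvgC := H' z za zr; rewrite seriesE.
  have /has_ps_zero := has_psB (has_psM (has_ps_pow a (m' - m)) H1) H2.
  move=> /(_ _ m'); rewrite conv_pow ?leq_subr// subKn//.
  move=> h; apply/eqP; rewrite -subr_eq0; apply/eqP; apply: h => e e0.
  exists (a + (e / 2)%:C%C); split.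
  - rewrite -subr_eq0 addrAC subrr add0r -nc_eq0 ncR gt_eqF// gtr0_norm; lra.
  - rewrite addrAC subrr add0r ncR gtr0_norm; lra.
  - have -> : (a + (e / 2)%:C%C == a) = false.
      apply/negbTE; rewrite -subr_eq0 addrAC subrr add0r -nc_eq0 ncR gt_eqF// gtr0_norm; lra.
    by rewrite mulrA -exprD addnS subnK// subrr.
move=> [m [u [uc Hu]]] [m' [u' [uc' Hu']]]; case/orP: (leq_total m m') => h.
  exact: (key c c' m m' u u' uc uc' h Hu Hu').
by rewrite (key c' c m' m u' u uc' uc h Hu' Hu).
Qed.

(** Real coefficients ensure that the real part taken in [main_term] loses nothing. *)
Definition real_ps (f : C -> C) (a : C) := exists v : nat -> R, has_ps f a (fun n => (v n)%:C%C).

Lemma real_psM f g a : real_ps f a -> real_ps g a -> real_ps (fun z => f z * g z) a.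
Proof.
move=> [u Hu] [v Hv]; exists (fun n => \sum_(i < n.+1) u i * v (n - i)%N).
have := has_psM Hu Hv; rewrite (_ : conv _ _ = fun n => (\sum_(i < n.+1) u i * v (n - i)%N)%:C%C)//.
by apply/funext => n; rewrite rmorph_sum; apply: eq_bigr => i _; rewrite rmorphM.
Qed.

Lemma real_ps_cst (c : R) a : real_ps (fun=> c%:C%C) a.
Proof.
exists (fun n => if n == 0%N then c else 0); have := has_ps_cst c%:C%C a.
by congr has_ps; apply/funext => -[|n].
Qed.

Lemma real_psX f n a : real_ps f a -> real_ps (fun z => f z ^+ n) a.
Proof.
move=> H; elim: n => [|n IH].
  by have := real_ps_cst 1 a; congr real_ps; apply/funext => z; rewrite expr0.
have := real_psM H IH; congr real_ps; apply/funext => z; by rewrite exprS.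
Qed.

Lemma real_psD f g a : real_ps f a -> real_ps g a -> real_ps (fun z => f z + g z) a.
Proof.
move=> [u Hu] [v Hv]; exists (fun n => u n + v n); have := has_psD Hu Hv.
by congr has_ps; apply/funext => n; rewrite rmorphD.
Qed.

Lemma real_ps_id (a : R) : real_ps id a%:C%C.
Proof.
exists (fun n => if n == 0%N then a else (n == 1%N)%:R); have := has_ps_id a%:C%C.
by congr has_ps; apply/funext => -[|[|n]].
Qed.

Lemma real_ps_inv1 : real_ps (fun z => z^-1) 1.
Proof.
exists (fun n => (-1) ^+ n); have := has_ps_inv (oner_neq0 C).
by congr has_ps; apply/funext => n; rewrite expr1n invr1 mulr1 rmorphXn rmorphN1.
Qed.

Lemma has_ps_cpow1 (x : R) : 0 < x ->
  has_ps (fun z => cpow x z) 1 (fun n => (x * (ln x ^+ n / n`!%:R))%:C%C).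
Proof.
move=> x0; have h : has_ps (fun z => cexp ((ln x)%:C%C * z)) (1 - 1) (fun n => (ln x)%:C%C ^+ n / n`!%:R).
  by rewrite subrr; exact: has_ps_cexp.
have := has_psZ x%:C%C (has_ps_trans h).
rewrite (_ : (fun z => _) = fun z => cpow x z); last first.
  by apply/funext => z; rewrite -cpowE// -cpowx1// -cpowD// addrC subrK.
congr has_ps; apply/funext => n.
by rewrite !rmorphM /= rmorphXn fmorphV rmorph_nat.
Qed.

(** With h(z) = (z - 1) zeta(z), the residue is the coefficient of order k - 1 at z = 1 in the
    product of h(z)^k / z and x^z, and the latter has the coefficients x (ln x)^n / n!. *)
Lemma main_termE (zeta h : C -> C) (r : R) (k : nat) : (0 < k)%N -> 0 < r -> real_ps h 1 ->
  (forall z, z != 1 -> nc (z - 1) < r -> (z - 1) * zeta z = h z) ->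
  exists be : nat -> R, forall x : R, 0 < x ->
    main_term zeta k x = x * \sum_(j < k) be j * (ln x ^+ j / j`!%:R).
Proof.
case: k => // k _ r0 Hh hz; have [b Hb] := real_psM (real_psX k.+1 Hh) real_ps_inv1.
(* After the case analysis [k] is the original exponent minus one, so that the pole has order
   [k.+1]. *)
exists (fun j => b (k - j)%N) => x x0.
have [r' r'0 Hbx] := has_psM Hb (has_ps_cpow1 x0).
set u := conv _ _ in Hbx.
have res : is_residue (fun s => zeta s ^+ k.+1 * cpow x s / s) 1 (u k).
  exists k, u; split => //; apply/nearC'; exists (Num.min r r'); first by rewrite lt_min r0.
  move=> z z1; rewrite lt_min => /andP[zr zr'].
  rewrite seriesE; apply/cvgC; have := Hbx z zr'.
  by rewrite -hz// exprMn; congr ccvg; ring.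
have -> : main_term zeta k.+1 x = complex.Re (u k).
  rewrite /main_term /residue; congr complex.Re.
  by case: xgetP => [c _ /= Hc|/(_ _ res)//]; exact: residue_unique Hc res.
rewrite /u /conv Re_sum mulr_sumr (reindex_inj rev_ord_inj) /=; apply: eq_bigr => i _.
have ik : (i <= k)%N by rewrite -ltnS.
by rewrite subSS subKn//; ring.
Qed.

End Residues.

(** * Mean squares of Dirichlet polynomials *)

Section MeanSquare.
Context {R : realType}.
Notation mu := (@lebesgue_measure R).

Lemma Rintegral_sum (D : set R) I (r : seq I) (F : I -> R -> R) : measurable D ->
  (forall i, mu.-integrable D (EFin \o F i)) ->
  mu.-integrable D (EFin \o (fun y => \sum_(i <- r) F i y)) /\
  \int[mu]_(y in D) (\sum_(i <- r) F i y) = \sum_(i <- r) \int[mu]_(y in D) F i y.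
Proof.
move=> mD H; elim: r => [|i r [IH1 IH2]].
  rewrite (_ : (fun x => _) = fun=> 0); last by apply/funext => x; rewrite big_nil.
  by rewrite big_nil /Rintegral integral0; split => //; exact: integrable0.
rewrite (_ : (fun x => _) = fun x => F i x + \sum_(j <- r) F j x); last first.
  by apply/funext => x; rewrite big_cons.
rewrite big_cons -IH2 RintegralD//; split => //.
have : mu.-integrable D (fun y => (F i y + \sum_(j <- r) F j y)%:E); last by [].
by under eq_fun do rewrite EFinD; apply: integrableD => //; exact: H.
Qed.

Lemma continuous_cosM (l t : R) : {for t, continuous (fun t : R => cos (t * l))}.
Proof.
apply: (der_continuous (a := - sin (t * l) * l)).
by apply: derC; apply: (der_eq (derM (der_id t) (der_cst l t))); rewrite mulr0 add0r mulr1.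
Qed.

Lemma integrable_cosM (l A B : R) : mu.-integrable `[A, B] (EFin \o (fun t : R => cos (t * l))).
Proof. by apply: integrable_continuous => t _; exact: continuous_cosM. Qed.

Lemma lebesgue_itv (A B : R) : A <= B -> fine (mu `[A, B]) = B - A.
Proof.
move=> AB; rewrite lebesgue_measure_itv /= lte_fin; case: ltgtP AB => // -> _.
by rewrite subrr.
Qed.

Lemma int_cos_trivial (l A B : R) : A <= B ->
  `|\int[mu]_(t in `[A, B]) cos (t * l)| <= B - A.
Proof.
move=> AB; apply: le_trans (le_normr_Rintegral _ (integrable_cosM l A B)) _ => //.
rewrite -(lebesgue_itv AB) -[leRHS]mul1r -Rintegral_cst//.
apply: le_Rintegral => //.
- exact: (integrable_norm (integrable_cosM l A B)).
- by apply: integrable_continuous => t _; exact: cst_continuous.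
- by move=> t _; rewrite ler_norml cos_geN1 cos_le1.
Qed.

Lemma der_sinM (l t : R) : is_derive t 1 (fun t : R => sin (t * l)) (l * cos (t * l)).
Proof.
have h : is_derive t 1 (fun t : R => t * l) l.
  by apply: (der_eq (derM (der_id t) (der_cst l t))); rewrite mulr0 add0r mulr1.
by apply: (der_eq (derC (is_derive_sin _) h)); rewrite mulrC.
Qed.

Lemma der_cosM (l t : R) : is_derive t 1 (fun t : R => cos (t * l)) (- l * sin (t * l)).
Proof.
have h : is_derive t 1 (fun t : R => t * l) l.
  by apply: (der_eq (derM (der_id t) (der_cst l t))); rewrite mulr0 add0r mulr1.
by apply: (der_eq (derC (is_derive_cos _) h)); rewrite mulrC mulrN mulNr.
Qed.

Lemma int_cos (l A B : R) : A <= B -> l != 0 ->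
  \int[mu]_(t in `[A, B]) cos (t * l) = (sin (B * l) - sin (A * l)) / l.
Proof.
move=> AB l0; rewrite mulrBl.
apply: (@FTC _ (fun t => sin (t * l) / l) (fun t => cos (t * l)) A B AB).
  move=> t _; apply: (der_eq (derM (der_sinM l t) (der_cst _ t))).
  by rewrite mulr0 add0r mulrA mulVf// mul1r.
by move=> t _; exact: continuous_cosM.
Qed.

Lemma sin_abs_le1 (x : R) : `|sin x| <= 1.
Proof. by rewrite ler_norml sin_geN1 sin_le1. Qed.
Lemma cos_abs_le1 (x : R) : `|cos x| <= 1.
Proof. by rewrite ler_norml cos_geN1 cos_le1. Qed.

Lemma int_cos_le (l A B : R) : A <= B -> l != 0 ->
  `|\int[mu]_(t in `[A, B]) cos (t * l)| <= 2 / `|l|.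
Proof.
move=> AB l0; rewrite int_cos// normrM normfV ler_wpM2r ?invr_ge0//.
apply: le_trans (ler_normB _ _) _; have := sin_abs_le1 (B * l); have := sin_abs_le1 (A * l); lra.
Qed.

Lemma continuous_tsinM (l t : R) : {for t, continuous (fun t : R => t * sin (t * l))}.
Proof. exact: der_continuous (derM (der_id t) (der_sinM l t)). Qed.

(** Integration by parts: the boundary terms give at most (A + B)/l, and bounding the remaining
    cosine integral trivially by B - A avoids a second factor 1/l. *)
Lemma int_tsin_le (l A B : R) : 0 <= A -> A <= B -> 0 < l ->
  `|\int[mu]_(t in `[A, B]) (t * sin (t * l))| <= 2 * B / l.
Proof.
move=> A0 AB l0; have l0' : l != 0 by rewrite gt_eqF.
have E : \int[mu]_(t in `[A, B]) (t * sin (t * l)) =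
    (A * cos (A * l) - B * cos (B * l)) / l + (\int[mu]_(t in `[A, B]) cos (t * l)) / l.
  rewrite int_cos//.
  pose F t := - l^-1 * (t * cos (t * l)) + (l^-1 * l^-1) * sin (t * l).
  transitivity (F B - F A); last by rewrite /F; field.
  apply: (@FTC _ F (fun t => t * sin (t * l)) A B AB).
  - move=> t _; apply: (der_eq (derD (derMl _ (derM (der_id t) (der_cosM l t))) (derMl _ (der_sinM l t)))).
    by field.
  - by move=> t _; exact: continuous_tsinM.
rewrite E -mulrDl normrM normfV (gtr0_norm l0) ler_wpM2r ?invr_ge0 ?(ltW l0)//.
apply: le_trans (ler_normD _ _) _.
have h := int_cos_trivial l AB.
have h1 : `|A * cos (A * l) - B * cos (B * l)| <= A + B.
  apply: le_trans (ler_normB _ _) _; rewrite !normrM (ger0_norm A0) (ger0_norm (le_trans A0 AB)).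
  apply: lerD; rewrite -[leRHS]mulr1 ler_wpM2l// ?cos_abs_le1//.
  exact: le_trans AB.
lra.
Qed.

Lemma ln_gap (x y : R) : 0 < x -> x < y -> (y - x) / y <= ln y - ln x.
Proof.
move=> x0 xy; have y0 : 0 < y by apply: lt_trans xy.
have h : ln (x / y) <= x / y - 1.
  by have := @le_ln1Dx R (x / y - 1); rewrite [1 + _]addrC subrK; apply; have := divr_gt0 x0 y0; lra.
move: h; rewrite ln_div ?posrE// mulrBl divff ?gt_eqF//; lra.
Qed.

Lemma ln_gap_gt0 (x y : R) : 0 < x -> x < y -> 0 < ln y - ln x.
Proof. by move=> x0 xy; rewrite subr_gt0 ltr_ln// posrE// (lt_trans x0). Qed.

(** The bound is y/(y - x), written so that the part without a small denominator is separated from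
    the near-diagonal part. *)
Lemma inv_ln_gap (x y : R) : 0 < x -> x < y -> (ln y - ln x)^-1 <= 1 + x / (y - x).
Proof.
move=> x0 xy; have d0 : 0 < y - x by rewrite subr_gt0.
have y0 : 0 < y by apply: lt_trans xy.
rewrite (_ : 1 + x / (y - x) = ((y - x) / y)^-1); last by field; rewrite !gt_eqF.
by rewrite lef_pV2 ?posrE ?divr_gt0// ?ln_gap_gt0// ln_gap.
Qed.

Definition harm (L : nat) : R := \sum_(l < L) l.+1%:R^-1.

Lemma harm_ge0 L : 0 <= harm L.
Proof. by apply: sumr_ge0 => i _; rewrite invr_ge0. Qed.

Lemma harm_le m n : (m <= n)%N -> harm m <= harm n.
Proof.
move=> mn; rewrite /harm -(subnKC mn) big_split_ord /= lerDl.
by apply: sumr_ge0 => i _; rewrite invr_ge0.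
Qed.

(* The diagonal term contributes 0^-1 = 0. *)
Lemma sum_inv_dist (L l : nat) : (l < L)%N ->
  \sum_(m < L) `|l%:R - m%:R|^-1 <= 2 * harm L :> R.
Proof.
move=> lL; rewrite -(subnKC lL) addSnnS big_split_ord /= -[2]/(1 + 1) mulrDl !mul1r.
apply: lerD.
  apply: le_trans (_ : harm l <= _); last by apply: harm_le; rewrite leq_addr.
  rewrite /harm (reindex_inj rev_ord_inj) /=; apply: ler_sum => i _.
  rewrite natrB ?ltn_ord// opprB addrC subrK ger0_norm//.
apply: le_trans (_ : harm (L - l.+1) <= _); last by apply: harm_le; rewrite addnS ltnW// ltnS leq_addl.
rewrite big_ord_recl addn0 subrr normr0 invr0 add0r; apply: ler_sum => i _.
by rewrite /= natrD opprD addNKr normrN ger0_norm.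
Qed.

Lemma amgm2 (a b p q : R) : 0 < p -> 0 < q -> 2 * (`|a| * `|b|) <= a ^+ 2 * p / q + b ^+ 2 * q / p.
Proof.
move=> p0 q0; rewrite -(real_normK (num_real a)) -(real_normK (num_real b)).
set x := `|a|; set y := `|b|.
have h : 0 <= (x * p - y * q) ^+ 2 / (p * q) by rewrite divr_ge0 ?sqr_ge0// mulr_ge0 ?ltW.
rewrite -subr_ge0 (_ : _ - _ = (x * p - y * q) ^+ 2 / (p * q))//.
by field; rewrite !gt_eqF.
Qed.

(** Cauchy-Schwarz with the weights y0 + l, whose reciprocals sum to at most [harm L] because y0 >=
    1; the double sum is symmetrized by [amgm2]. *)
Lemma sqr_sum_le_harm (L : nat) (y0 : R) (a : nat -> R) : 1 <= y0 ->
  (\sum_(l < L) `|a l|) ^+ 2 <= harm L * \sum_(l < L) a l ^+ 2 * (y0 + l%:R).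
Proof.
move=> y1; have yp (l : nat) : 0 < y0 + l%:R by rewrite ltr_wpDr// (lt_le_trans ltr01).
have yi (l : nat) : (y0 + l%:R)^-1 <= l.+1%:R^-1.
  by rewrite lef_pV2 ?posrE// -natr1 [_ + 1]addrC lerD2r.
rewrite expr2 mulr_suml -(@ler_pM2l _ 2)// mulr_sumr.
apply: le_trans (_ : \sum_(l < L) \sum_(m < L)
   (a l ^+ 2 * (y0 + l%:R) / (y0 + m%:R) + a m ^+ 2 * (y0 + m%:R) / (y0 + l%:R)) <= _).
  apply: ler_sum => l _; rewrite !mulr_sumr; apply: ler_sum => m _; exact: amgm2.
have E : \sum_(l < L) \sum_(m < L) a l ^+ 2 * (y0 + l%:R) / (y0 + m%:R) <=
   harm L * \sum_(l < L) a l ^+ 2 * (y0 + l%:R).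
  rewrite mulr_sumr; apply: ler_sum => l _; rewrite -mulr_sumr mulrC ler_wpM2r//.
    by rewrite mulr_ge0 ?sqr_ge0// ltW.
  by apply: ler_sum => m _.
under eq_bigr do rewrite big_split /=.
rewrite big_split /= -[2]/(1 + 1) mulrDl !mul1r; apply: lerD => //.
by rewrite exchange_big.
Qed.

(** An off-diagonal integral is at most 2/|log gap|, hence at most 2 + 2 (y0 + min(l, m))/|l - m|.
    The summand 2 contributes 2 [harm L] by [sqr_sum_le_harm]; the other is split by 2|uv| <= u^2 +
    v^2 into two sums over 1/|l - m|, each contributing 2 [harm L]. This is the origin of the
    constant 6. *)
Lemma mean_square (L : nat) (y0 T : R) (a : nat -> R) : 1 <= y0 -> 1 <= T ->
  `|\int[mu]_(t in `[1, T]) ((\sum_(l < L) a l * cos (t * ln (y0 + l%:R))) ^+ 2 +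
                             (\sum_(l < L) a l * sin (t * ln (y0 + l%:R))) ^+ 2)
    - (T - 1) * \sum_(l < L) a l ^+ 2|
  <= 6 * harm L * \sum_(l < L) a l ^+ 2 * (y0 + l%:R).
Proof.
move=> y1 T1; have yp (l : nat) : 0 < y0 + l%:R by rewrite ltr_wpDr// (lt_le_trans ltr01).
pose lam (l : nat) := ln (y0 + l%:R).
pose I (l m : nat) := \int[mu]_(t in `[1, T]) cos (t * (lam l - lam m)).
have sqE t : (\sum_(l < L) a l * cos (t * lam l)) ^+ 2 +
             (\sum_(l < L) a l * sin (t * lam l)) ^+ 2 =
    \sum_(l < L) \sum_(m < L) a l * a m * cos (t * (lam l - lam m)).
  rewrite !expr2 !mulr_suml -big_split; apply: eq_bigr => l _ /=.
  rewrite !mulr_sumr -big_split; apply: eq_bigr => m _ /=.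
  by rewrite mulrBr cosB; ring.
have int1 (l m : nat) : mu.-integrable `[1, T] (EFin \o (fun t => a l * a m * cos (t * (lam l - lam m)))).
  exact: (integrableMl (f := fun t => cos (t * (lam l - lam m))) _ _ (integrable_cosM _ _ _)).
have intE : \int[mu]_(t in `[1, T]) ((\sum_(l < L) a l * cos (t * lam l)) ^+ 2 +
                             (\sum_(l < L) a l * sin (t * lam l)) ^+ 2) =
    \sum_(l < L) \sum_(m < L) a l * a m * I l m.
  rewrite (@eq_Rintegral _ _ _ mu _ (fun t => \sum_(l < L) \sum_(m < L) a l * a m * cos (t * (lam l - lam m)))); last first.
    by move=> t _; exact: sqE.
  have h (l : nat) := @Rintegral_sum `[1, T] _ (index_enum 'I_L) (fun (m : 'I_L) t => a l * a m * cos (t * (lam l - lam m))) (measurable_itv _) (fun m => int1 l m).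
  rewrite (@Rintegral_sum `[1, T] _ (index_enum 'I_L) (fun (l : 'I_L) t => \sum_(m < L) a l * a m * cos (t * (lam l - lam m))) (measurable_itv _) (fun l => (h l).1)).2.
  apply: eq_bigr => l _; rewrite (h l).2; apply: eq_bigr => m _.
  by rewrite RintegralZl//; exact: integrable_cosM.
rewrite {}intE mulr_sumr -sumrB.
have Idiag l : I l l = T - 1.
  rewrite /I (@eq_Rintegral _ _ _ mu _ (fun=> 1)); last by move=> t _; rewrite subrr mulr0 cos0.
  by rewrite Rintegral_cst// mul1r lebesgue_itv.
have gap l m : (l < m)%N -> `|I l m| <= 2 * (1 + (y0 + l%:R) / `|l%:R - m%:R|) /\
    `|I m l| <= 2 * (1 + (y0 + l%:R) / `|l%:R - m%:R|).
  move=> lm; have lm' : y0 + l%:R < y0 + m%:R by rewrite ltrD2l ltr_nat.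
  have g := ln_gap_gt0 (yp l) lm'.
  have g2 := inv_ln_gap (yp l) lm'.
  have e : (y0 + m%:R) - (y0 + l%:R) = `|l%:R - m%:R|.
    by rewrite distrC ger0_norm ?subr_ge0 ?ler_nat 1?ltnW//; ring.
  rewrite e in g2.
  have n1 : lam l - lam m != 0 by rewrite subr_eq0 eq_sym -subr_eq0 gt_eqF.
  have n2 : lam m - lam l != 0 by rewrite gt_eqF.
  split; apply: le_trans (int_cos_le T1 _) _ => //; rewrite ler_wpM2l// ?(distrC (lam l))
    (gtr0_norm g)//.
have key (l m : nat) : `|a l * a m * I l m - (if l == m then a l ^+ 2 * (T - 1) else 0)| <=
    2 * (`|a l| * `|a m|) + (a l ^+ 2 * (y0 + l%:R) + a m ^+ 2 * (y0 + m%:R)) * `|l%:R - m%:R|^-1.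
  have [<-|lm] := eqVneq l m.
    rewrite Idiag -expr2 subrr normr0; apply: addr_ge0; first by rewrite !mulr_ge0.
    by rewrite mulr_ge0 ?invr_ge0// addr_ge0// mulr_ge0 ?sqr_ge0// ltW.
  have yl := ltW (yp l); have ym := ltW (yp m).
  have dm : 0 <= `|l%:R - m%:R|^-1 :> R by rewrite invr_ge0.
  (* Here p is attached to the smaller index, the one that the logarithmic gap bound puts in the
     numerator; it may be enlarged to q in front of v^2. *)
  have aux p q : 0 <= p -> p <= q -> forall u v : R, `|u| * `|v| * (2 * (1 + p / `|l%:R - m%:R|)) <=
      2 * (`|u| * `|v|) + (u ^+ 2 * p + v ^+ 2 * q) * `|l%:R - m%:R|^-1.
    move=> p0 pq u v; have h := @amgm2 u v 1 1 ltr01 ltr01.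
    rewrite !divr1 !mulr1 in h.
    have h2 : 2 * (`|u| * `|v|) * p <= u ^+ 2 * p + v ^+ 2 * q.
      apply: le_trans (ler_wpM2r p0 h) _; rewrite mulrDl lerD2l ler_wpM2l ?sqr_ge0//.
    have := ler_wpM2r dm h2; lra.
  rewrite subr0 !normrM.
  case: ltngtP lm => // lm _.
    apply: le_trans (ler_wpM2l _ (gap _ _ lm).1) _; first exact: mulr_ge0.
    by apply: aux => //; rewrite lerD2l ler_nat ltnW.
  apply: le_trans (ler_wpM2l _ (gap _ _ lm).2) _; first exact: mulr_ge0.
  rewrite (distrC m%:R) (mulrC `|a l|) (addrC (a l ^+ 2 * _)).
  by apply: aux => //; rewrite lerD2l ler_nat ltnW.
apply: le_trans (_ : \sum_(l < L) \sum_(m < L) (2 * (`|a l| * `|a m|) +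
    (a l ^+ 2 * (y0 + l%:R) + a m ^+ 2 * (y0 + m%:R)) * `|l%:R - m%:R|^-1) <= _).
  apply: le_trans (ler_norm_sum _ _ _) _; apply: ler_sum => l _.
  have -> : (T - 1) * a l ^+ 2 = \sum_(m < L) (if l == m :> nat then a l ^+ 2 * (T - 1) else 0).
    rewrite (bigD1 l)//= eqxx big1 ?addr0 1?mulrC// => m ml.
    by rewrite eq_sym val_eqE (negbTE ml).
  by rewrite -sumrB; apply: le_trans (ler_norm_sum _ _ _) _; apply: ler_sum => m _; exact: key.
have Ssum : \sum_(l < L) \sum_(m < L) a l ^+ 2 * (y0 + l%:R) * `|l%:R - m%:R|^-1 <=
   2 * harm L * \sum_(l < L) a l ^+ 2 * (y0 + l%:R).
  rewrite mulr_sumr; apply: ler_sum => l _; rewrite -mulr_sumr mulrC ler_wpM2r//.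
    by rewrite mulr_ge0 ?sqr_ge0// ltW.
  by apply: sum_inv_dist.
have -> : 6 * harm L * \sum_(l < L) a l ^+ 2 * (y0 + l%:R) =
   2 * (harm L * \sum_(l < L) a l ^+ 2 * (y0 + l%:R)) +
   (2 * harm L * \sum_(l < L) a l ^+ 2 * (y0 + l%:R) + 2 * harm L * \sum_(l < L) a l ^+ 2 * (y0 + l%:R)) by ring.
under eq_bigr do rewrite big_split /=.
rewrite big_split /=; apply: lerD.
  apply: le_trans (ler_wpM2l _ (sqr_sum_le_harm L a y1)) => //.
  rewrite expr2 mulr_suml mulr_sumr le_eqVlt; apply/orP; left; apply/eqP; apply: eq_bigr => l _.
  by rewrite !mulr_sumr.
under eq_bigr do (under eq_bigr do rewrite mulrDl); under eq_bigr do rewrite big_split /=.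
rewrite big_split /=; apply: lerD => //.
rewrite exchange_big /=; apply: le_trans Ssum; rewrite le_eqVlt; apply/orP; left; apply/eqP.
by apply: eq_bigr => l _; apply: eq_bigr => m _; rewrite distrC.
Qed.

End MeanSquare.

(** * The divisor function *)

Section Arithmetic.
Context {R : realType}.
Notation C := R[i].
Notation nc := (@Normc.normc R).

(** Every divisor is a power p^i, i <= v_p(n), times a divisor of the part of n prime to p. Counting
    these products gives the inequality. *)
Lemma size_divisors_part (p n : nat) : prime p -> (0 < n)%N ->
  (size (divisors n) <= (logn p n).+1 * size (divisors (n %/ p ^ logn p n)))%N.
Proof.
move=> pp n0; set a := logn p n; set m := (n %/ p ^ a)%N.
have nE : n = (p ^ a * m)%N by rewrite /m mulnC divnK// pfactor_dvdnn.
have m0 : (0 < m)%N by move: n0; rewrite {1}nE muln_gt0 => /andP[].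
have -> : ((logn p n).+1 * size (divisors m) = size [seq (p ^ i * e)%N | i <- iota 0 a.+1, e <- divisors m])%N.
  by rewrite size_allpairs size_iota.
apply: uniq_leq_size; first exact: divisors_uniq.
move=> d; rewrite -dvdn_divisors// => dn.
have d0 : (0 < d)%N by apply: dvdn_gt0 dn.
apply/allpairsP; exists (logn p d, (d %/ p ^ logn p d)%N); split => /=.
- by rewrite -[_ :: _]/(iota 0 a.+1) mem_iota add0n /= ltnS; apply: dvdn_leq_log.
- rewrite -dvdn_divisors//.
  have cop : coprime (d %/ p ^ logn p d) (p ^ a).
    rewrite coprime_sym coprimeXl// prime_coprime//.
    apply/negP => h; have : (p ^ (logn p d).+1 %| d)%N.
      by rewrite -[X in (_ %| X)%N](divnK (pfactor_dvdnn p d)) expnS dvdn_pmul2r// expn_gt0 prime_gt0.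
    by rewrite pfactor_dvdn// ltnn.
  rewrite -(Gauss_dvdr _ cop) -nE; apply: dvdn_trans dn.
  by rewrite dvdn_div// pfactor_dvdnn.
- by rewrite mulnC divnK// pfactor_dvdnn.
Qed.

(** The prime powers p^a exactly dividing n are peeled off one prime at a time. If p^e >= 2, the
    factor a + 1 <= 2^a is absorbed by p^(ae); each of the boundedly many smaller primes costs one
    constant A. *)
Lemma divisor_bound (e : R) : 0 < e ->
  exists2 K : R, 0 < K & forall n, (0 < n)%N -> (size (divisors n))%:R <= K * n%:R `^ e.
Proof.
move=> e0; pose c := e * ln 2.
have c0 : 0 < c by rewrite mulr_gt0// ln_gt0// ltr1n.
(* Chosen so that A (1 + a c) >= a + 1, while 2^(ae) = exp(a c) >= 1 + a c. *)
pose A : R := c^-1 + 1.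
have A1 : 1 <= A by rewrite lerDr invr_ge0 ltW.
have pow2 (a : nat) : a.+1%:R <= A * (2 ^+ a) `^ e.
  have -> : (2 ^+ a : R) `^ e = expR (a%:R * c).
    rewrite /powR gt_eqF ?exprn_gt0// lnXn// /c; congr expR; rewrite -mulr_natl; ring.
  have h := expR_ge1Dx (a%:R * c).
  apply: le_trans (ler_wpM2l (le_trans ler01 A1) h).
  rewrite /A mulrDl mul1r mulrDr mulr1 mulrCA mulVf ?gt_eqF// mulr1 -natr1.
  have : 0 <= c^-1 by rewrite invr_ge0 ltW.
  by have : 0 <= a%:R * c by [rewrite mulr_ge0// ltW]; lra.
(* From P0 on, p^e >= 2 and the prime costs nothing. *)
pose P0 := (Num.truncn (2 `^ e^-1 : R)).+1.
have P0P (p : nat) : (P0 <= p)%N -> 2 <= p%:R `^ e.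
  move=> pP; have h : 2 `^ e^-1 <= p%:R :> R.
    by apply: ltW; apply: lt_le_trans (truncnS_gt _) _; rewrite ler_nat.
  have -> : 2 = (2 `^ e^-1) `^ e :> R by rewrite -powRrM mulVf ?gt_eqF// powRr1.
  by apply: ge0_ler_powR; rewrite ?nnegrE ?powR_ge0// ltW.
pose cn n := count (fun p => prime p && (p %| n)%N) (iota 0 P0).
have main n : (0 < n)%N -> (size (divisors n))%:R <= A ^+ cn n * n%:R `^ e.
  elim/ltn_ind: n => n IH n0; have [n1|n1] := leqP n 1.
    have -> : n = 1%N by apply/eqP; rewrite eqn_leq n1.
    rewrite (_ : divisors 1 = [:: 1%N])// powR1 mulr1; exact: exprn_ege1.
  set p := pdiv n; have pp : prime p by exact: pdiv_prime.
  set a := logn p n; set m := (n %/ p ^ a)%N.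
  have nE : n = (p ^ a * m)%N by rewrite /m mulnC divnK// pfactor_dvdnn.
  have m0 : (0 < m)%N by move: n0; rewrite {1}nE muln_gt0 => /andP[].
  have a0 : (0 < a)%N by rewrite logn_gt0 mem_primes pp n0 pdiv_dvd.
  have mn : (m < n)%N by rewrite ltn_Pdiv// -{1}(exp1n a) ltn_exp2r// prime_gt1.
  have pm : ~~ (p %| m)%N.
    apply/negP => h; have : (p ^ a.+1 %| n)%N by rewrite nE expnSr dvdn_pmul2l// expn_gt0 prime_gt0.
    by rewrite pfactor_dvdn// ltnn.
  have h1 : (size (divisors n))%:R <= a.+1%:R * (size (divisors m))%:R :> R.
    by rewrite -natrM ler_nat size_divisors_part.
  apply: le_trans h1 _; have h2 := IH m mn m0.
  have -> : n%:R `^ e = (p%:R ^+ a) `^ e * m%:R `^ e :> R.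
    by rewrite {1}nE natrM natrX powRM ?exprn_ge0.
  have cmn : (cn m + (p < P0) <= cn n)%N.
    have -> : ((p < P0) = count (pred1 p) (iota 0 P0) :> nat)%N.
      by rewrite count_uniq_mem ?iota_uniq// mem_iota.
    rewrite -count_predUI [X in (_ + X)%N](@eq_count _ _ pred0); last first.
      by move=> q /=; apply/negbTE; apply/negP => /andP[/andP[_ qm] /eqP qp]; rewrite qp (negbTE pm) in qm.
    rewrite count_pred0 addn0; apply: sub_count => q /= /orP[/andP[-> qm]|/eqP ->].
      by rewrite nE dvdn_mull.
    by rewrite pp pdiv_dvd.
  have Xm : 0 <= m%:R `^ e :> R by exact: powR_ge0.
  have key : a.+1%:R <= A ^+ (p < P0) * (p%:R ^+ a) `^ e.
    have p2 : (2 ^+ a) `^ e <= (p%:R ^+ a) `^ e :> R.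
      apply: ge0_ler_powR; rewrite ?nnegrE ?exprn_ge0// ?(ltW e0)//.
      by rewrite lerXn2r ?nnegrE// ler_nat prime_gt1.
    case: ltnP => pP /=.
      by rewrite expr1; apply: le_trans (pow2 a) _; rewrite ler_wpM2l// (le_trans ler01).
    rewrite expr0 mul1r.
    have -> : (p%:R ^+ a) `^ e = (p%:R `^ e) ^+ a :> R.
      by rewrite -!powR_mulrn ?powR_ge0// -!powRrM mulrC.
    apply: le_trans (_ : 2 ^+ a <= _); last by rewrite lerXn2r ?nnegrE ?powR_ge0// P0P.
    by rewrite -natrX ler_nat ltn_expl.
  apply: le_trans (ler_pM _ _ key h2) _ => //.
  rewrite mulrACA -exprD ler_wpM2r ?mulr_ge0 ?powR_ge0//.
  by rewrite addnC ler_weXn2l.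
exists (A ^+ P0); first by rewrite exprn_gt0// (lt_le_trans ltr01).
move=> n n0; apply: le_trans (main n n0) _; rewrite ler_wpM2r ?powR_ge0//.
rewrite ler_weXn2l//; apply: leq_trans (count_size _ _) _; by rewrite size_iota.
Qed.

(** All factors in a factorization of n divide n, so the tuples are functions into the divisors of
    n. *)
Lemma divk_le k n : (0 < n)%N -> (divk k n <= size (divisors n) ^ k)%N.
Proof.
move=> n0; rewrite /divk.
apply: leq_trans (_ : #|ffun_on (fun m : 'I_n.+1 => (m : nat) %| n)%N| <= _)%N.
  apply: subset_leq_card; apply/fintype.subsetP => f; rewrite inE => /eqP fn.
  apply/ffun_onP => i; have : (f i %| n)%N by rewrite -[X in (_ %| X)%N]fn (bigD1 i)//= dvdn_mulr.
  by [].
rewrite card_ffun_on card_ord; case: k => // k; rewrite leq_exp2r//.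
rewrite cardE -(size_map (@nat_of_ord n.+1)); apply: uniq_leq_size.
  by rewrite map_inj_uniq ?enum_uniq//; exact: ord_inj.
by apply/allP; rewrite all_map; apply/allP => i; rewrite mem_enum /= -dvdn_divisors.
Qed.

Lemma divk_bound k (e : R) : 0 < e ->
  exists2 K : R, 0 < K & forall n, (0 < n)%N -> (divk k n)%:R <= K * n%:R `^ e.
Proof.
(* The denominator k + 1 instead of k also covers k = 0. *)
move=> e0; have e'0 : 0 < e / k.+1%:R by rewrite divr_gt0.
have [K K0 HK] := divisor_bound e'0; exists (K ^+ k) => [|n n0]; first by rewrite exprn_gt0.
apply: le_trans (_ : (K * n%:R `^ (e / k.+1%:R)) ^+ k <= _).
  apply: le_trans (_ : ((size (divisors n)) ^ k)%:R <= _); first by rewrite ler_nat divk_le.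
  rewrite natrX; apply: lerXn2r; rewrite ?nnegrE//; last exact: HK.
  by rewrite mulr_ge0 ?powR_ge0// ltW.
rewrite exprMn ler_wpM2l ?exprn_ge0 ?(ltW K0)// -powR_mulrn ?powR_ge0// -powRrM.
apply: ler_powR; first by rewrite ler1n.
by rewrite mulrAC ler_pdivrMr// ler_wpM2l ?(ltW e0)// ler_nat.
Qed.

(** * Powers of Dirichlet series *)

Definition fact_count (k N n : nat) : nat :=
  #|[pred f : {ffun 'I_k -> 'I_N.+1} | (\prod_(i < k) f i)%N == n]|.

Lemma fact_count_le k N M n : (N <= M)%N -> (fact_count k N n <= fact_count k M n)%N.
Proof.
move=> NM; have NM' : (N.+1 <= M.+1)%N by [].
pose w (f : {ffun 'I_k -> 'I_N.+1}) : {ffun 'I_k -> 'I_M.+1} := [ffun i => widen_ord NM' (f i)].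
have wi : injective w.
  move=> f g /ffunP fg; apply/ffunP => i; have := fg i; rewrite !ffunE.
  by move=> /(congr1 val) /= ?; apply: val_inj.
rewrite /fact_count -(fintype.card_image wi); apply: subset_leq_card; apply/fintype.subsetP => f.
move=> /fintype.imageP[g]; rewrite inE => /eqP <- ->; rewrite inE; apply/eqP.
by apply: eq_bigr => i _; rewrite ffunE.
Qed.

Lemma fact_count_eq k N M n : (0 < n)%N -> (n <= N)%N -> (N <= M)%N ->
  fact_count k N n = fact_count k M n.
Proof.
move=> n0 nN NM; apply/eqP; rewrite eqn_leq fact_count_le//=.
pose w (f : {ffun 'I_k -> 'I_M.+1}) : {ffun 'I_k -> 'I_N.+1} := [ffun i => inord (f i)].
have small (f : {ffun 'I_k -> 'I_M.+1}) : (\prod_(i < k) f i)%N = n -> forall i, (f i < N.+1)%N.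
  move=> fn i; rewrite ltnS; apply: leq_trans nN; apply: dvdn_leq => //.
  by rewrite -fn (bigD1 i)//= dvdn_mulr.
have wi : {in [pred f : {ffun 'I_k -> 'I_M.+1} | (\prod_(i < k) f i)%N == n] &, injective w}.
  move=> f g; rewrite !inE => /eqP fn /eqP gn /ffunP fg; apply/ffunP => i; have := fg i.
  by rewrite !ffunE => /(congr1 val) /=; rewrite !inordK ?small// => h; apply: val_inj.
rewrite /fact_count -(fintype.card_in_image wi); apply: subset_leq_card; apply/fintype.subsetP => f.
move=> /fintype.imageP[g]; rewrite inE => /eqP gn ->; rewrite inE; apply/eqP; rewrite -[RHS]gn.
by apply: eq_bigr => i _; rewrite ffunE inordK// small.
Qed.

Lemma divkE k n : divk k n = fact_count k n n.
Proof. by []. Qed.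

Lemma fact_count_divk k N n : (0 < n)%N -> (n <= N)%N -> fact_count k N n = divk k n.
Proof. by move=> n0 nN; rewrite divkE (fact_count_eq k n0 (leqnn n) nN). Qed.

Lemma fact_count_le_divk k N n : (0 < n)%N -> (fact_count k N n <= divk k n)%N.
Proof.
move=> n0; have [nN|Nn] := leqP n N; first by rewrite fact_count_divk.
by rewrite divkE fact_count_le// ltnW.
Qed.

Lemma tail_pow (p : R) (N M : nat) : 1 < p -> (0 < N)%N ->
  \sum_(N <= n < M) (n.+1%:R : R) `^ (- p) <= N%:R `^ (1 - p) / (p - 1).
Proof.
move=> p1 N0; have p10 : 0 < p - 1 by rewrite subr_gt0.
have step n : (0 < n)%N -> n.+1%:R `^ (- p) <= (n%:R `^ (1 - p) - n.+1%:R `^ (1 - p)) / (p - 1).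
  move=> n0; have n0' : 0 < n%:R :> R by rewrite ltr0n.
  have nn : n%:R <= n.+1%:R :> R by rewrite ler_nat.
  have cp (y : R) : 0 < y -> {for y, continuous (fun y => y `^ (- p))}.
    by move=> y0; exact: der_continuous (is_derive1_powR (- p) y0).
  have E := @FTC R (fun y => y `^ (1 - p) / (1 - p)) (fun y => y `^ (- p)) n%:R n.+1%:R nn.
  have -> : (n%:R `^ (1 - p) - n.+1%:R `^ (1 - p)) / (p - 1) =
     n.+1%:R `^ (1 - p) / (1 - p) - n%:R `^ (1 - p) / (1 - p) :> R.
    by field; apply/andP; split; apply/eqP; lra.
  have D1 (y : R) : n%:R <= y <= n.+1%:R -> is_derive y 1 (fun y => y `^ (1 - p) / (1 - p)) (y `^ (- p)).
    move=> /andP[y1 _]; have y0 : 0 < y by apply: lt_le_trans y1.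
    apply: (der_eq (derM (is_derive1_powR (1 - p) y0) (der_cst _ y))).
    rewrite mulr0 add0r mulrA mulVf ?mul1r; last by apply/eqP; lra.
    by congr (_ `^ _); ring.
  have D2 (y : R) : n%:R <= y <= n.+1%:R -> {for y, continuous (fun y => y `^ (- p))}.
    by move=> /andP[y1 _]; apply: cp; apply: lt_le_trans y1.
  rewrite -(E D1 D2).
  have -> : n.+1%:R `^ (- p) = \int[lebesgue_measure]_(y in `[n%:R, n.+1%:R]) n.+1%:R `^ (- p) :> R.
    rewrite Rintegral_cst// lebesgue_itv//.
    by rewrite -[n.+1%:R in X in _ * X]natr1 addrAC subrr add0r mulr1.
  apply: le_Rintegral => //.
  - by apply: integrable_continuous => y _; exact: cst_continuous.
  - by apply: integrable_continuous => y /andP[y1 _]; apply: cp; apply: lt_le_trans y1.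
  - move=> y /=; rewrite in_itv /= => /andP[y1 y2].
    have y0 : 0 < y by apply: lt_le_trans y1.
    rewrite !powRN lef_pV2 ?posrE ?powR_gt0//.
    by apply: ge0_ler_powR; rewrite ?nnegrE// ?ltW//; lra.
have [MN|NM] := leqP M N.
  by rewrite big_geq// divr_ge0 ?powR_ge0// ltW.
apply: le_trans (_ : (N%:R `^ (1 - p) - M%:R `^ (1 - p)) / (p - 1) <= _); last first.
  by rewrite ler_wpM2r ?invr_ge0 ?(ltW p10)// lerBlDr lerDl powR_ge0.
elim: M NM => // M IH; rewrite ltnS leq_eqVlt => /predU1P[<-|NM].
  by rewrite big_nat1; exact: step.
rewrite big_nat_recr ?(ltnW NM)//=; apply: le_trans (lerD (IH NM) (step M _)) _.
  by apply: leq_ltn_trans NM.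
by rewrite -mulrDl ler_wpM2r ?invr_ge0 ?(ltW p10)//; lra.
Qed.

(** The k-th power of the partial sum up to N is a finite Dirichlet polynomial with coefficients
    [fact_count k N n]. These agree with d_k(n) for n <= N, and beyond N they are at most d_k(n) <=
    K n; with Re s >= 3 the excess is at most K times the sum of n^-2 over n > N, thus O(1/N). No
    rearrangement of an infinite series occurs. *)
Lemma dirichlet_power (zeta : C -> C) k s :
  series (fun n => cpow n.+1%:R (- s)) @ \oo --> (zeta s : C^o) -> 3 <= complex.Re s ->
  ccvg (fun N => \sum_(1 <= n < N.+1) (divk k n)%:R * cpow n%:R (- s)) (zeta s ^+ k).
Proof.
move=> /cvgC hz s3.
(* The value 0 at m = 0 makes X multiplicative on all of nat, so that the index 0 present in
   ['I_N.+1] is harmless. *)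
pose X (m : nat) : C := if m == 0%N then 0 else cpow m%:R (- s).
have XM m n : X (m * n)%N = X m * X n.
  rewrite /X muln_eq0; case: eqP => [|/eqP m0]; first by rewrite mul0r.
  case: eqP => [|/eqP n0]; first by rewrite mulr0.
  by rewrite natrM cpowMx// ltr0n lt0n.
have X1 : X 1%N = 1 by rewrite /X /= cpow1x.
have Xprod (N : nat) (f : {ffun 'I_k -> 'I_N.+1}) : \prod_(i < k) X (f i) = X (\prod_(i < k) f i)%N.
  by elim/big_rec2: _ => [|i x y _ ->]; rewrite ?X1// XM.
have sumX N : \sum_(m < N.+1) X m = series (fun n => cpow n.+1%:R (- s)) N.
  by rewrite big_ord_recl /= /X /= add0r /series /= big_mkord; apply: eq_bigr => i _.
have powE N : (\sum_(m < N.+1) X m) ^+ k = \sum_(n < (N ^ k).+1) (fact_count k N n)%:R * X n.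
  have -> : (\sum_(m < N.+1) X m) ^+ k = \prod_(i < k) \sum_(m < N.+1) X m.
    by rewrite prodr_const card_ord.
  rewrite bigA_distr_bigA /=.
  have lt (f : {ffun 'I_k -> 'I_N.+1}) : (\prod_(i < k) f i < (N ^ k).+1)%N.
    rewrite ltnS; apply: leq_trans (leq_prod (fun i _ => leq_ord (f i))) _.
    by rewrite prod_nat_const card_ord.
  rewrite (partition_big (fun f => Ordinal (lt f)) xpredT)//=; apply: eq_bigr => n _.
  rewrite (eq_bigl (fun f => f \in [pred f : {ffun 'I_k -> 'I_N.+1} | (\prod_(i < k) f i)%N == n])); last first.
    by move=> f; rewrite inE -val_eqE.
  rewrite (eq_bigr (fun=> X n)); first by rewrite sumr_const mulr_natl.
  by move=> f; rewrite Xprod inE => /eqP ->.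
have [K K0 HK] := @divk_bound k 1 ltr01.
have nX n : (0 < n)%N -> nc (X n) = n%:R `^ (- complex.Re s).
  move=> n0; have -> : X n = cpow n%:R (- s) by rewrite /X gtn_eqF.
  by rewrite nc_cpow ?ltr0n// ReN.
have dX n : (0 < n)%N -> (divk k n)%:R * nc (X n) <= K * n%:R `^ (-2).
  move=> n0; rewrite nX//; apply: le_trans (ler_wpM2r (powR_ge0 _ _) (HK n n0)) _.
  rewrite -mulrA ler_wpM2l ?(ltW K0)// -powRD; last by rewrite pnatr_eq0 -lt0n n0 implybT.
  by apply: ler_powR; rewrite ?ler1n//; lra.
have bound N : (0 < N)%N -> nc (\sum_(1 <= n < N.+1) (divk k n)%:R * cpow n%:R (- s) -
    (\sum_(m < N.+1) X m) ^+ k) <= K * N%:R `^ (-1).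
  move=> N0; rewrite powE ncB.
  (* The range is lengthened by terms with vanishing coefficient so that it can be split at N; for k
     = 0 the number N^k may lie below N. *)
  have [M NM ->] : exists2 M, (N <= M)%N & \sum_(n < (N ^ k).+1) (fact_count k N n)%:R * X n =
      \sum_(n < M.+1) (fact_count k N n)%:R * X n.
    exists (N + N ^ k)%N; first exact: leq_addr.
    rewrite -[RHS](big_mkord xpredT (fun n => (fact_count k N n)%:R * X n)).
    rewrite -[LHS](big_mkord xpredT (fun n => (fact_count k N n)%:R * X n)).
    rewrite (@big_cat_nat _ _ _ (N ^ k).+1 0 (N + N ^ k).+1)//=; last by rewrite ltnS leq_addl.
    rewrite [X in _ + X]big_nat [X in _ + X]big1 ?addr0// => n /andP[nl _].
    suff -> : fact_count k N n = 0%N by rewrite mul0r.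
    apply/eqP; rewrite -leqn0 leqNgt; apply/negP => /card_gt0P[f]; rewrite inE => /eqP fn.
    move: nl; rewrite ltnNge => /negP; apply; rewrite -fn.
    apply: leq_trans (leq_prod (fun i _ => leq_ord (f i))) _.
    by rewrite prod_nat_const card_ord.
  rewrite -(big_mkord xpredT (fun n => (fact_count k N n)%:R * X n)).
  rewrite big_ltn// {1}/X /= mulr0 add0r (@big_cat_nat _ _ _ N.+1 1 M.+1)//=.
  rewrite [X in X + _ - _](_ : _ = \sum_(1 <= n < N.+1) (divk k n)%:R * cpow n%:R (- s)); last first.
    apply: eq_big_nat => n /andP[n0 nN]; rewrite fact_count_divk//.
    by rewrite /X gtn_eqF.
  rewrite addrAC subrr add0r; apply: le_trans (nc_sum _ _ _) _.
  apply: le_trans (_ : \sum_(N.+1 <= n < M.+1) K * n%:R `^ (-2) <= _).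
    rewrite big_nat [leRHS]big_nat; apply: ler_sum => n /andP[n0 _].
    have n1 : (0 < n)%N by apply: leq_ltn_trans n0.
    apply: le_trans (dX n n1); rewrite ncM nc_nat ler_wpM2r ?nc_ge0// ler_nat.
    exact: fact_count_le_divk.
  rewrite -mulr_sumr ler_wpM2l ?(ltW K0)//.
  rewrite big_add1 /=.
  have h21 : 1 < 2 :> R by rewrite ltr1n.
  have := @tail_pow 2 N M h21 N0; rewrite (_ : 1 - 2 = -1 :> R); last by ring.
  by rewrite (_ : 2 - 1 = 1 :> R) ?divr1//; ring.
have h : ccvg (fun N => \sum_(1 <= n < N.+1) (divk k n)%:R * cpow n%:R (- s) -
    (\sum_(m < N.+1) X m) ^+ k) 0.
  apply: (@ccvg_squeeze _ _ _ (fun N => K * N.-1.+1%:R^-1)).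
    near=> N; have N0 : (0 < N)%N by near: N; exact: nbhs_infty_gt.
    by rewrite subr0 prednK//; have := bound N N0; rewrite powR_inv1.
  rewrite -(mulr0 K); apply: cvgM; first exact: cvg_cst.
  by rewrite -(cvg_shiftS (fun n => n.-1.+1%:R^-1 : R)); exact: cvg_harmonic.
have h2 : ccvg (fun N => (\sum_(m < N.+1) X m) ^+ k) (zeta s ^+ k).
  elim: k {XM Xprod powE K K0 HK dX bound h} => [|k IH]; first exact: ccvg_cst.
  rewrite exprS; apply: ccvg_eq (ccvgM hz IH) => N; by rewrite exprS sumX.
have := ccvgD h h2; rewrite add0r; apply: ccvg_eq => N; by rewrite subrK.
Unshelve. all: by end_near. Qed.

End Arithmetic.

(** * Partial summation *)

Section SummatoryMellin.
Context {R : realType}.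
Notation C := R[i].
Notation nc := (@Normc.normc R).
Notation mu := (@lebesgue_measure R).

Definition summatory (d : nat -> R) (y : R) : R := \sum_(1 <= n < (Num.truncn y).+1) d n.

(** The main term y P(ln y). The basis (ln y)^j / j! is the one in which the residue delivers P, and
    it keeps the recursion for the tails free of combinatorial factors. *)
Definition log_poly (be : nat -> R) (J : nat) (y : R) : R :=
  y * \sum_(j < J) be j * (ln y ^+ j / j`!%:R).

Definition error_term (d be : nat -> R) (J : nat) (y : R) : R :=
  summatory d y - log_poly be J y.

(* [log_tail s j y] is the analytic continuation in s of the integral over
   u >= y of u ^ (- s) * (ln u) ^ j / j!. *)
Fixpoint log_tail (s : C) (j : nat) (y : R) : C :=
  match j with
  | 0 => cpow y (1 - s) / (s - 1)
  | i.+1 => (cpow y (1 - s) * (ln y ^+ i.+1 / (i.+1)`!%:R)%:C%C + log_tail s i y) / (s - 1)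
  end.

Definition log_tails (be : nat -> R) (J : nat) (s : C) (y : R) : C :=
  \sum_(j < J) (be j)%:C%C * log_tail s j y.

Definition dpoly (d : nat -> R) (y : R) (s : C) : C :=
  \sum_(1 <= n < (Num.truncn y).+1) (d n)%:C%C * cpow n%:R (- s).

Lemma der_lnX (y : R) j : 0 < y ->
  is_derive y 1 (fun x : R => ln x ^+ j.+1 / (j.+1)`!%:R) (y^-1 * (ln y ^+ j / j`!%:R)).
Proof.
move=> y0; apply: (der_eq (derM (derX j (is_derive1_ln y0)) (der_cst _ y))).
rewrite mulr0 add0r factS natrM; field.
by rewrite pnatr_eq0 -lt0n fact_gt0 gt_eqF// addrC natr1 pnatr_eq0.
Qed.

Lemma log_tail_derive (s : C) j (y : R) : s != 1 -> 0 < y ->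
  cderive y (log_tail s j) (- (cpow y (- s) * (ln y ^+ j / j`!%:R)%:C%C)).
Proof.
move=> s1 y0; have s10 : s - 1 != 0 by rewrite subr_eq0.
have Dp : cderive y (fun x => cpow x (1 - s)) ((1 - s) * cpow y (- s)).
  by apply: (cderive_eq (cderive_cpow (1 - s) y0)); rewrite addrAC subrr add0r.
elim: j => [|j IH].
  apply: (cderive_eq (cderiveM Dp (cderive_cst y (s - 1)^-1))).
  by rewrite mulr0 add0r expr0 fact0 divr1 mulr1; field.
apply: (cderive_eq (cderiveM (cderiveD (cderiveM Dp (cderive_real (der_lnX j y0))) IH) (cderive_cst y (s - 1)^-1))).
rewrite mulr0 add0r.
have -> : cpow y (1 - s) = y%:C%C * cpow y (- s) by rewrite cpowD// cpowx1.
rewrite [(y^-1 * _)%:C%C]rmorphM fmorphV /=.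
have y0' : y%:C%C != 0 :> C by rewrite -nc_eq0 ncR normr_eq0 gt_eqF.
move: y0'; set L := (_ / _)%:C%C; set L' := (_ / _)%:C%C; set p := cpow y _.
set q := y%:C%C => q0; field.
by rewrite !pnatr_eq0 -!lt0n !fact_gt0 s10 andbT; exact: q0.
Qed.

(** At y = 1 the logarithms vanish, and only the polar terms at s = 1 survive. *)
Lemma log_tail1 (s : C) j : log_tail s j 1 = (s - 1) ^- j.+1.
Proof.
elim: j => [|j IH] /=; first by rewrite cpow1x mul1r expr1.
by rewrite IH ln1 exprS !mul0r rmorph0 mulr0 add0r -invfM -exprSr.
Qed.

Lemma cint_log (s : C) j (X Y : R) : s != 1 -> 0 < X -> X <= Y ->
  cintegrable `[X, Y] (fun y => cpow y (- s) * (ln y ^+ j / j`!%:R)%:C%C) /\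
  cint `[X, Y] (fun y => cpow y (- s) * (ln y ^+ j / j`!%:R)%:C%C) = log_tail s j X - log_tail s j Y.
Proof.
move=> s1 X0 XY; pose F y := - log_tail s j y.
have pos y : X <= y <= Y -> 0 < y by move=> /andP[h _]; apply: lt_le_trans h.
have [f' Hf] : exists f' : R -> C, forall y, 0 < y -> cderive y (fun y => cpow y (- s) * (ln y ^+ j / j`!%:R)%:C%C) (f' y).
  case: j {F} => [|j].
    exists (fun y => - s * cpow y (- s - 1)) => y y0.
    rewrite (_ : (fun y => _) = fun y => cpow y (- s)); first exact: cderive_cpow.
    by apply/funext => x; rewrite expr0 fact0 divr1 mulr1.
  eexists => y y0; exact: (cderiveM (cderive_cpow _ y0) (cderive_real (der_lnX j y0))).
have [|h1 h2] := @CFTC _ F (fun y => cpow y (- s) * (ln y ^+ j / j`!%:R)%:C%C) f' X Y XY _ (fun y h => Hf y (pos y h)).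
  move=> y /pos y0; apply: (cderive_eq (cderiveN (log_tail_derive j s1 y0))).
  by rewrite opprK.
by split => //; rewrite h2 /F opprK addrC.
Qed.

Lemma log_poly_kernel be J (s : C) (y : R) : 0 < y ->
  (log_poly be J y)%:C%C * cpow y (- s - 1) =
  \sum_(j < J) (be j)%:C%C * (cpow y (- s) * (ln y ^+ j / j`!%:R)%:C%C).
Proof.
move=> y0; rewrite cpowB1// /log_poly rmorphM rmorph_sum mulrACA -rmorphM divff ?gt_eqF//.
by rewrite rmorph1 mul1r mulr_suml; apply: eq_bigr => j _; rewrite rmorphM /=; ring.
Qed.

Lemma cint_log_poly be J (s : C) (X Y : R) : s != 1 -> 0 < X -> X <= Y ->
  cintegrable `[X, Y] (fun y => (log_poly be J y)%:C%C * cpow y (- s - 1)) /\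
  cint `[X, Y] (fun y => (log_poly be J y)%:C%C * cpow y (- s - 1)) =
  log_tails be J s X - log_tails be J s Y.
Proof.
move=> s1 X0 XY; have mXY : measurable (`[X, Y]%classic : set R) by exact: measurable_itv.
pose f (j : nat) y := (be j)%:C%C * (cpow y (- s) * (ln y ^+ j / j`!%:R)%:C%C).
have fi j : cintegrable `[X, Y] (f j).
  by apply: cintegrableZ => //; case: (cint_log j s1 X0 XY).
have E : {in (`[X, Y]%classic : set R), (fun y => \sum_(j < J) f j y) =1
    (fun y => (log_poly be J y)%:C%C * cpow y (- s - 1))}.
  move=> y; rewrite inE /= in_itv /= => /andP[h _].
  by rewrite log_poly_kernel// (lt_le_trans X0).
split.
  apply: (eq_cintegrable mXY E).
  exact: (@cintegrable_sum _ _ _ (index_enum 'I_J) (fun j : 'I_J => f j) mXY (fun j => fi j)).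
rewrite -(eq_cint E) (@cint_sum _ _ _ (index_enum 'I_J) (fun j : 'I_J => f j) mXY (fun j => fi j)).
rewrite /log_tails -sumrB; apply: eq_bigr => j _.
have [h1 h2] := cint_log j s1 X0 XY.
by rewrite /f cintZ// h2 mulrBr.
Qed.

Lemma cint_cpow (s : C) (X Y : R) : 0 < X -> X <= Y ->
  cintegrable `[X, Y] (fun y => cpow y (- s - 1)) /\
  s * cint `[X, Y] (fun y => cpow y (- s - 1)) = cpow X (- s) - cpow Y (- s).
Proof.
move=> X0 XY; have mXY : measurable (`[X, Y]%classic : set R) by exact: measurable_itv.
have pos y : X <= y <= Y -> 0 < y by move=> /andP[h _]; apply: lt_le_trans h.
have [c1 c2] := @CFTC R (fun y => cpow y (- s)) (fun y => - s * cpow y (- s - 1)) _ X Y XY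
  (fun y h => cderive_cpow (- s) (pos y h)) (fun y h => cderiveZ (- s) (cderive_cpow (- s - 1) (pos y h))).
have ci : cintegrable `[X, Y] (fun y => cpow y (- s - 1)).
  split; apply: integrable_continuous => y /pos y0.
    exact: der_continuous (cderive_cpow (- s - 1) y0).1.
  exact: der_continuous (cderive_cpow (- s - 1) y0).2.
split => //; move: c2; rewrite (cintZ (- s) mXY ci) mulNr => /(congr1 -%R).
by rewrite opprK opprB.
Qed.

(** Partial summation one index at a time: each n contributes the step function of the half line y
    >= n, so a finite sum commutes with the integral and no induction over integer intervals is
    required. *)
Lemma cint_step (s : C) (X Y : R) (n : nat) : 0 < X -> X <= Y -> n%:R <= Y ->
  cintegrable `[X, Y] (fun y => (if n%:R <= y then 1 else 0)%:C%C * cpow y (- s - 1)) /\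
  s * cint `[X, Y] (fun y => (if n%:R <= y then 1 else 0)%:C%C * cpow y (- s - 1)) =
  (if n%:R <= X then cpow X (- s) else cpow n%:R (- s)) - cpow Y (- s).
Proof.
move=> X0 XY nY; pose f (y : R) : C := (if n%:R <= y then 1 else 0)%:C%C * cpow y (- s - 1).
rewrite -[X in cintegrable _ X]/f -[X in cint _ X]/f.
have mXY : measurable (`[X, Y]%classic : set R) by exact: measurable_itv.
have [nX|Xn] := leP n%:R X.
  have [c1 c2] := cint_cpow s X0 XY.
  have E : {in (`[X, Y]%classic : set R), (fun y => cpow y (- s - 1)) =1 f}.
    by move=> y; rewrite inE /= in_itv /= => /andP[h _]; rewrite /f (le_trans nX h) mul1r.
  by split; [exact: eq_cintegrable E c1|rewrite -(eq_cint E)].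
have n0 : 0 < n%:R :> R by apply: lt_trans Xn.
have [c1 c2] := cint_cpow s n0 nY.
have m1 : measurable (`[X, n%:R[%classic : set R) by exact: measurable_itv.
have m2 : measurable (`[n%:R, Y]%classic : set R) by exact: measurable_itv.
have E1 : {in (`[X, n%:R[%classic : set R), (fun=> 0) =1 f}.
  by move=> y; rewrite inE /= in_itv /= => /andP[_ h]; rewrite /f leNgt h mul0r.
have E2 : {in (`[n%:R, Y]%classic : set R), (fun y => cpow y (- s - 1)) =1 f}.
  by move=> y; rewrite inE /= in_itv /= => /andP[h _]; rewrite /f h mul1r.
have U : (`[X, Y]%classic : set R) = `[X, n%:R[%classic `|` `[n%:R, Y]%classic.
  by rewrite -itv_bndbnd_setU// bnd_simp// ltW.
have dis : [disjoint (`[X, n%:R[%classic : set R) & (`[n%:R, Y]%classic : set R)].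
  apply/disj_set2P; rewrite -subset0 => y [] /=; rewrite !in_itv /= => /andP[_ h1] /andP[h2 _].
  by move: (lt_le_trans h1 h2); rewrite ltxx.
have iU : cintegrable `[X, Y] f.
  apply: (@cintegrable_le _ _ f (fun y => y `^ (- complex.Re s - 1)) mXY).
  - apply: cmeasurableM; last exact: cmeasurable_cpow.
    apply: cmeasurable_real; apply: nondecreasing_measurable => // u v uv.
    by case: (leP n%:R u) => [h|_]; [rewrite (le_trans h uv)|case: ifP].
  - apply: integrable_continuous => y /andP[h _].
    exact: der_continuous (is_derive1_powR _ (lt_le_trans X0 h)).
  - move=> y Dy; have /andP[h _] : X <= y <= Y by move: Dy; rewrite /= in_itv.
    rewrite /f ncM ncR nc_cpow ?(lt_le_trans X0)//.
    rewrite ReD !ReN /= -[leRHS]mul1r ler_wpM2r ?powR_ge0//; case: ifP => _; rewrite ?normr1 ?normr0//.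
split => //; move: iU; rewrite U => iU.
by rewrite cint_setU// -(eq_cint E1) -(eq_cint E2) cint0 add0r c2.
Qed.

Lemma summatoryE d (y Y : R) : 0 <= y -> y <= Y -> summatory d y =
  \sum_(1 <= n < (Num.truncn Y).+1) d n * (if n%:R <= y then 1 else 0).
Proof.
move=> y0 yY; have tt : (Num.truncn y <= Num.truncn Y)%N by exact: le_truncn.
rewrite /summatory [RHS](@big_cat_nat _ _ _ (Num.truncn y).+1)//= [X in _ = _ + X]big_nat.
rewrite [X in _ = _ + X]big1 ?addr0; last first.
  move=> n /andP[h _]; rewrite ifF ?mulr0//; apply/negbTE.
  by rewrite -truncn_ge_nat// -ltnNge.
apply: eq_big_nat => n /andP[_ h]; rewrite ifT ?mulr1//.
by rewrite -truncn_ge_nat.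
Qed.

Lemma cint_summatory d (s : C) (X Y : R) : 0 < X -> X <= Y ->
  cintegrable `[X, Y] (fun y => (summatory d y)%:C%C * cpow y (- s - 1)) /\
  s * cint `[X, Y] (fun y => (summatory d y)%:C%C * cpow y (- s - 1)) =
  (dpoly d Y s - (summatory d Y)%:C%C * cpow Y (- s)) -
  (dpoly d X s - (summatory d X)%:C%C * cpow X (- s)).
Proof.
move=> X0 XY; have Y0 : 0 < Y by apply: lt_le_trans XY.
have mXY : measurable (`[X, Y]%classic : set R) by exact: measurable_itv.
pose f (n : nat) (y : R) : C := (d n)%:C%C * ((if n%:R <= y then 1 else 0)%:C%C * cpow y (- s - 1)).
pose r := [seq n <- index_iota 1 (Num.truncn Y).+1 | true].
have rE : r = index_iota 1 (Num.truncn Y).+1 by rewrite /r filter_predT.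
(* Terms beyond Y are replaced by 0, as the summation lemmas ask for integrability at every index
   and [cint_step] requires n <= Y. *)
pose f' (n : nat) := if (n <= Num.truncn Y)%N then f n else fun=> 0.
have nY n : (n <= Num.truncn Y)%N -> n%:R <= Y by rewrite truncn_ge_nat// ltW.
have fi n : cintegrable `[X, Y] (f' n).
  rewrite /f'; case: ifP => [/nY h|_]; last exact: cintegrable0.
  by apply: cintegrableZ => //; case: (cint_step s X0 XY h).
have E : {in (`[X, Y]%classic : set R), (fun y => \sum_(n <- r) f' n y) =1
    (fun y => (summatory d y)%:C%C * cpow y (- s - 1))}.
  move=> y; rewrite inE /= in_itv /= => /andP[Xy yY].
  rewrite (summatoryE d (ltW (lt_le_trans X0 Xy)) yY) rmorph_sum mulr_suml rE.
  by apply: eq_big_nat => n /andP[_]; rewrite ltnS => h; rewrite /f' h /f rmorphM /= mulrA.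
split; first exact: eq_cintegrable mXY E (cintegrable_sum r mXY fi).
rewrite -(eq_cint E) (cint_sum r mXY fi) rE mulr_sumr.
have tt : (Num.truncn X <= Num.truncn Y)%N by exact: le_truncn.
rewrite (@eq_big_nat _ _ _ _ _ _ (fun n => (d n)%:C%C * ((if n%:R <= X then cpow X (- s) else cpow n%:R (- s)) - cpow Y (- s)))); last first.
  move=> n /andP[_]; rewrite ltnS => h; rewrite /f' h /f.
  have [h1 h2] := cint_step s X0 XY (nY n h).
  by rewrite cintZ// mulrCA h2.
under eq_bigr do rewrite mulrBr.
rewrite sumrB -mulr_suml -rmorph_sum -/(summatory d Y) addrAC; congr (_ - _).
rewrite /dpoly [X in _ = X - _](@big_cat_nat _ _ _ (Num.truncn X).+1)//=.
rewrite [LHS](@big_cat_nat _ _ _ (Num.truncn X).+1)//=.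
rewrite [RHS](_ : _ = (summatory d X)%:C%C * cpow X (- s) +
  \sum_((Num.truncn X).+1 <= i < (Num.truncn Y).+1) (d i)%:C%C * cpow i%:R (- s)); last by ring.
congr (_ + _).
  rewrite /summatory rmorph_sum mulr_suml; apply: eq_big_nat => n /andP[_ h]; rewrite ifT//.
  by rewrite -truncn_ge_nat ?(ltW X0).
rewrite big_nat [RHS]big_nat; apply: eq_bigr => n /andP[h _]; rewrite ifF//; apply/negbTE.
by rewrite -truncn_ge_nat ?(ltW X0)// -ltnNge.
Qed.

(** The Dirichlet series cut at X, with the boundary term of partial summation and with the integral
    of the main term over [X, oo) in its continued form. Adding s times the Mellin tail of the error
    term from X makes it independent of X. *)
Definition approx d be J (s : C) (X : R) : C :=
  dpoly d X s - (summatory d X)%:C%C * cpow X (- s) + s * log_tails be J s X.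

Lemma cint_error d be J (s : C) (X Y : R) : s != 1 -> 0 < X -> X <= Y ->
  cintegrable `[X, Y] (fun y => (error_term d be J y)%:C%C * cpow y (- s - 1)) /\
  approx d be J s X + s * cint `[X, Y] (fun y => (error_term d be J y)%:C%C * cpow y (- s - 1)) =
  approx d be J s Y.
Proof.
move=> s1 X0 XY; have mXY : measurable (`[X, Y]%classic : set R) by exact: measurable_itv.
have [i1 e1] := cint_summatory d s X0 XY.
have [i2 e2] := cint_log_poly be J s1 X0 XY.
have E : {in (`[X, Y]%classic : set R), (fun y => (summatory d y)%:C%C * cpow y (- s - 1) +
     (-1) * ((log_poly be J y)%:C%C * cpow y (- s - 1))) =1
     (fun y => (error_term d be J y)%:C%C * cpow y (- s - 1))}.
  by move=> y _; rewrite /error_term rmorphB /= mulrBl mulN1r.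
have i3 := cintegrableZ (-1) mXY i2.
split; first exact: eq_cintegrable mXY E (cintegrableD mXY i1 i3).
rewrite -(eq_cint E) cintD// cintZ// mulrDr e1 e2 /approx mulN1r mulrN mulrBr; ring.
Qed.

(** At X = 1 the term n = 1 and the boundary term cancel, and what remains is visibly analytic away
    from s = 1. *)
Lemma approx1 d be J (s : C) :
  approx d be J s 1 = s * \sum_(j < J) (be j)%:C%C * (s - 1) ^- j.+1.
Proof.
rewrite /approx /dpoly /summatory (_ : Num.truncn (1 : R) = 1%N); last by rewrite -[X in Num.truncn X]/(1%:R) natrK.
rewrite !big_nat1 cpow1x subrr add0r /log_tails; congr (_ * _).
by apply: eq_bigr => j _; rewrite log_tail1.
Qed.

Lemma measurable_summatory d : (forall n, 0 <= d n) -> measurable_fun setT (summatory d).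
Proof.
move=> d0; apply: nondecreasing_measurable => // u v uv; rewrite /summatory.
have tt : (Num.truncn u <= Num.truncn v)%N by exact: le_truncn.
rewrite [leRHS](@big_cat_nat _ _ _ (Num.truncn u).+1)//= lerDl.
by apply: sumr_ge0 => n _.
Qed.

Lemma measurable_sum_ord n (F : nat -> R -> R) : (forall i, measurable_fun setT (F i)) ->
  measurable_fun setT (fun y => \sum_(i < n) F i y).
Proof.
move=> mF; elim: n => [|n IH].
  rewrite (_ : (fun y => _) = cst 0); first exact: measurable_cst.
  by apply/funext => y; rewrite big_ord0.
rewrite (_ : (fun y => _) = (fun y => \sum_(i < n) F i y + F n y)).
  exact: measurable_funD.
by apply/funext => y; rewrite big_ord_recr.
Qed.

Lemma measurable_log_poly be J : measurable_fun setT (log_poly be J).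
Proof.
apply: measurable_funM => //; apply: (@measurable_sum_ord J (fun j y => be j * (ln y ^+ j / j`!%:R))) => j.
apply: measurable_funM => //; apply: measurable_funM => //; apply: measurable_funX.
exact: measurable_ln.
Qed.

Lemma measurable_error d be J : (forall n, 0 <= d n) -> measurable_fun setT (error_term d be J).
Proof.
by move=> d0; apply: measurable_funB; [exact: measurable_summatory|exact: measurable_log_poly].
Qed.

Definition tail_mellin (g : R -> R) (s : C) (X : R) : C :=
  cint `]X, +oo[ (fun y => (g y)%:C%C * cpow y (- s - 1)).

Lemma mellin_split d be J c (s : C) (X : R) : (forall n, 0 <= d n) -> s != 1 -> 1 <= X ->
  c <= complex.Re s ->
  mu.-integrable `[1, +oo[ (EFin \o (fun y => `|error_term d be J y| * y `^ (- c - 1))) ->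
  approx d be J s 1 + s * mellin (error_term d be J) s =
  approx d be J s X + s * tail_mellin (error_term d be J) s X.
Proof.
move=> d0 s1 X1 cs ig; have [_ e] := cint_error d be J s1 ltr01 X1.
have ci := mellin_integrable (measurable_error be J d0) ig cs.
have m1 : measurable (`[1, X]%classic : set R) by exact: measurable_itv.
have m2 : measurable (`]X, +oo[%classic : set R) by exact: measurable_itv.
have U : (`[1, +oo[%classic : set R) = `[1, X]%classic `|` `]X, +oo[%classic.
  by rewrite -itv_bndbnd_setU// bnd_simp.
have dis : [disjoint (`[1, X]%classic : set R) & (`]X, +oo[%classic : set R)].
  apply/disj_set2P; rewrite -subset0 => y [] /=; rewrite !in_itv /= => /andP[_ h1] /andP[h2 _].
  by move: (le_lt_trans h1 h2); rewrite ltxx.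
rewrite /mellin U cint_setU//; last by rewrite -U.
by rewrite mulrDr addrA e.
Qed.

Lemma nc_tail_mellin (g : R -> R) c (s : C) (X : R) : measurable_fun setT g -> 1 <= X ->
  c <= complex.Re s ->
  mu.-integrable `[1, +oo[ (EFin \o (fun y => `|g y| * y `^ (- c - 1))) ->
  nc (tail_mellin g s X) <= 2 * X `^ (c - complex.Re s) *
     \int[mu]_(y in `[1, +oo[) (`|g y| * y `^ (- c - 1)).
Proof.
move=> mg X1 cs ig.
have m2 : measurable (`]X, +oo[%classic : set R) by exact: measurable_itv.
have sub : (`]X, +oo[%classic : set R) `<=` `[1, +oo[%classic.
  by move=> y /=; rewrite !in_itv /= !andbT => h; rewrite (le_trans X1)// ltW.
have ig2 : mu.-integrable `]X, +oo[ (EFin \o (fun y : R => `|g y| * y `^ (- c - 1))).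
  by apply: integrableS ig.
have ci := mellin_integrable mg ig cs.
have ci2 : cintegrable `]X, +oo[ (fun y => (g y)%:C%C * cpow y (- s - 1)).
  by split; [apply: integrableS ci.1|apply: integrableS ci.2].
have ig3 := integrableMl (X `^ (c - complex.Re s)) m2 ig2.
apply: le_trans (nc_cint_le m2 ci2 ig3 _) _.
  move=> y Xy; have Xy' : X <= y by move: Xy; rewrite /= in_itv /= andbT => /ltW.
  rewrite nc_kernel; last exact: sub.
  have y0 : 0 < y by apply: lt_le_trans Xy'; apply: lt_le_trans X1.
  rewrite mulrCA ler_wpM2l// (_ : - complex.Re s - 1 = (c - complex.Re s) + (- c - 1)); last by ring.
  rewrite powRD; last by rewrite (gt_eqF y0) implybT.
  rewrite ler_wpM2r ?powR_ge0// -(opprB (complex.Re s)) !powRN lef_pV2 ?posrE ?powR_gt0//; last exact: lt_le_trans X1.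
  by apply: ge0_ler_powR; rewrite ?nnegrE ?subr_ge0 ?(ltW y0)// (le_trans ler01).
rewrite RintegralZl// -mulrA ler_wpM2l// ler_wpM2l ?powR_ge0//.
rewrite /Rintegral; apply: fine_le.
- exact: integrable_fin_num.
- exact: integrable_fin_num.
- apply: ge0_subset_integral => //.
  + by case/integrableP: ig.
  + by move=> y _; rewrite lee_fin mulr_ge0 ?powR_ge0.
Qed.

End SummatoryMellin.

(** * Averages over unit shifts *)

Section RectangleFubini.
Context {R : realType}.
Notation mu := (@lebesgue_measure R).

Lemma integrable_bounded (f : R -> R) (a b B : R) : measurable_fun (`[a, b]%classic : set R) f ->
  (forall x, a <= x <= b -> `|f x| <= B) -> mu.-integrable `[a, b] (EFin \o f).
Proof.
move=> mf fB; apply: (@le_integrable _ _ _ mu _ _ _ (EFin \o cst B)) => //.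
- exact/measurable_EFinP.
- move=> x /=; rewrite in_itv /= => /fB; rewrite lee_fin => /le_trans; apply; exact: ler_norm.
- by apply: integrable_continuous => y _; exact: cst_continuous.
Qed.

(** Nonnegativity of the variance on an interval of length 1. *)
Lemma jensen_unit (f : R -> R) (B : R) : measurable_fun (`[0, 1]%classic : set R) f ->
  (forall x, 0 <= x <= 1 -> `|f x| <= B) ->
  (\int[mu]_(x in `[0, 1]) f x) ^+ 2 <= \int[mu]_(x in `[0, 1]) (f x ^+ 2).
Proof.
move=> mf fB; set m := \int[mu]_(x in `[0, 1]) f x.
have if1 := integrable_bounded mf fB.
have B0 : 0 <= B by apply: le_trans (fB 0 _); rewrite ?lexx ?ler01.
have if2 : mu.-integrable `[0, 1] (EFin \o (fun x => f x ^+ 2)).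
  apply: (@integrable_bounded _ _ _ (B ^+ 2)); first exact: measurable_funX.
  by move=> x /fB h; rewrite normrX lerXn2r ?nnegrE.
have h : 0 <= \int[mu]_(x in `[0, 1]) ((f x ^+ 2 + (- (2 * m)) * f x) + m ^+ 2).
  apply: Rintegral_ge0 => x _.
  by rewrite (_ : _ + _ = (f x - m) ^+ 2) ?sqr_ge0//; ring.
have i3 := integrableMl (- (2 * m)) (measurable_itv _) if1.
have i4 : mu.-integrable `[0, 1] (EFin \o (fun x => f x ^+ 2 + (- (2 * m)) * f x)).
  exact: integrableDr.
move: h; rewrite RintegralD//; last first.
  by apply: integrable_continuous => y _; exact: cst_continuous.
rewrite RintegralD// RintegralZl// Rintegral_cst// lebesgue_itv// -/m.
by rewrite -subr_ge0; congr (0 <= _); ring.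
Qed.

Notation MR := (measurableTypeR R).

(** Multiplying by the indicators of the two sides gives a function on the plane, integrable because
    f is bounded on the rectangle; its sections are the restricted integrals. *)
Let rect_fubini_left (f : MR -> MR -> R) (a b c d B : R) :
  measurable_fun setT (fun p : MR * MR => f p.1 p.2) ->
  (forall x y, a <= x <= b -> c <= y <= d -> `|f x y| <= B) ->
  mu.-integrable `[a, b] (EFin \o (fun x => \int[mu]_(y in `[c, d]) f x y)) /\
  \int[mu]_(x in `[a, b]) (\int[mu]_(y in `[c, d]) f x y) =
  \int[mu]_(y in `[c, d]) (\int[mu]_(x in `[a, b]) f x y).
Proof.
move=> mf fB.
pose I1 (x : MR) : R := \1_(`[a, b]%classic : set R) x.
pose I2 (x : MR) : R := \1_(`[c, d]%classic : set R) x.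
pose g (p : MR * MR) : R := f p.1 p.2 * (I1 p.1 * I2 p.2).
have mI1 : measurable_fun setT I1 by apply: measurable_indic; exact: measurable_itv.
have mI2 : measurable_fun setT I2 by apply: measurable_indic; exact: measurable_itv.
have mg : measurable_fun setT g.
  apply: measurable_funM => //; apply: measurable_funM.
    exact: measurableT_comp mI1 measurable_fst.
  exact: measurableT_comp mI2 measurable_snd.
pose G (p : MR * MR) := (g p)%:E.
have mG : measurable_fun setT G by apply/measurable_EFinP.
have I1E (x : R) : I1 x = if a <= x <= b then 1 else 0.
  by rewrite /I1 indicE mem_setE in_itv /=; case: ifP.
have I2E (x : R) : I2 x = if c <= x <= d then 1 else 0.
  by rewrite /I2 indicE mem_setE in_itv /=; case: ifP.
have I1p x : 0 <= I1 x by rewrite I1E; case: ifP.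
have I2p x : 0 <= I2 x by rewrite I2E; case: ifP.
have B' : 0 <= Num.max B 0 by rewrite le_max lexx orbT.
have gle (x y : R) : `|g (x, y)| <= Num.max B 0 * (I1 x * I2 y).
  rewrite /g /= I1E I2E; case: (boolP (a <= x <= b)) => h1; last by rewrite mul0r !mulr0 normr0.
  case: (boolP (c <= y <= d)) => h2; last by rewrite !mulr0 normr0.
  by rewrite !mulr1 le_max fB.
have fin1 (u v : R) : (\int[mu]_x (\1_(`[u, v]%classic : set R) x)%:E < +oo)%E.
  rewrite integral_indic ?setIT//.
  by rewrite /= lebesgue_measure_itv /=; case: ifP => _; rewrite ?ltry// -EFinB ltry.
have iG : (mu \x mu)%E.-integrable setT G.
  apply/(integrable12ltyP mu mu mG).
  apply: (@le_lt_trans _ _ (\int[mu]_x \int[mu]_y ((Num.max B 0 * I1 x)%:E * (I2 y)%:E))%E).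
    apply: ge0_le_integral => //.
    - by move=> x _; apply: integral_ge0.
    - have m := measurable_fun_fubini_tonelli_F (m2 := mu) (abse \o G).
      by apply: m => //=; exact: measurableT_comp.
    - have m := measurable_fun_fubini_tonelli_F (m2 := mu) (fun p : MR * MR => ((Num.max B 0 * I1 p.1)%:E * (I2 p.2)%:E)%E).
      apply: m => /=.
        under eq_fun do rewrite -EFinM; apply/measurable_EFinP.
        apply: measurable_funM; last exact: measurableT_comp mI2 measurable_snd.
        by apply: measurable_funM => //; exact: measurableT_comp mI1 measurable_fst.
      by move=> p; rewrite -EFinM lee_fin !mulr_ge0.
    - move=> x _; apply: ge0_le_integral => //.
      + by apply: measurableT_comp => //; exact: measurable_fun_pair2.
      + by apply: measurable_funeM; apply/measurable_EFinP.
      + by move=> y _; rewrite -EFinM lee_fin -mulrA; exact: gle.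
  have [r r0 rE] : exists2 r : R, 0 <= r & (\int[mu]_y (I2 y)%:E)%E = r%:E.
    have h := fin1 c d; exists (fine (\int[mu]_y (I2 y)%:E)).
      by rewrite fine_ge0// integral_ge0// => y _; rewrite lee_fin.
    by rewrite fineK// ge0_fin_numE// integral_ge0// => y _; rewrite lee_fin.
  rewrite (@eq_integral _ _ _ mu setT (fun x => ((Num.max B 0 * r)%:E * (I1 x)%:E)%E)); last first.
    move=> x _; rewrite ge0_integralZl//; try exact/measurable_EFinP; try (by move=> y _; rewrite lee_fin); try (by rewrite lee_fin mulr_ge0).
    by rewrite rE -!EFinM; congr EFin; ring.
  rewrite ge0_integralZl//; try exact/measurable_EFinP; try (by move=> y _; rewrite lee_fin); try (by rewrite lee_fin mulr_ge0).
  have [r' r'0 ->] : exists2 r : R, 0 <= r & (\int[mu]_y (I1 y)%:E)%E = r%:E.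
    have h := fin1 a b; exists (fine (\int[mu]_y (I1 y)%:E)).
      by rewrite fine_ge0// integral_ge0// => y _; rewrite lee_fin.
    by rewrite fineK// ge0_fin_numE// integral_ge0// => y _; rewrite lee_fin.
  by rewrite -EFinM ltry.
have sec1 (x : R) : a <= x <= b -> (\int[mu]_y G (x, y) = (\int[mu]_(y in `[c, d]) f x y)%:E)%E.
  move=> hx; have if1 : mu.-integrable `[c, d] (EFin \o f x).
    apply: (@integrable_bounded _ c d B).
      by have m := measurable_fun_pair2 x mf; exact: (@measurable_funTS _ _ _ _ _ (f x) m).
    by move=> y; exact: fB.
  rewrite /Rintegral fineK; last exact: integrable_fin_num.
  rewrite [RHS]integral_mkcond; apply: eq_integral => y _.
  rewrite /G /g /= I1E hx /= mul1r I2E /patch mem_setE in_itv /=.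
  by case: ifP => _; rewrite ?mulr1 ?mulr0.
have sec2 (y : R) : c <= y <= d -> (\int[mu]_x G (x, y) = (\int[mu]_(x in `[a, b]) f x y)%:E)%E.
  move=> hy; have if1 : mu.-integrable `[a, b] (EFin \o (f ^~ y)).
    apply: (@integrable_bounded _ a b B).
      by have m := measurable_fun_pair1 y mf; exact: (@measurable_funTS _ _ _ _ _ (f ^~ y) m).
    by move=> x hx; exact: fB.
  rewrite /Rintegral fineK; last exact: integrable_fin_num.
  rewrite [RHS]integral_mkcond; apply: eq_integral => x _.
  rewrite /G /g /= I2E hy /= mulr1 I1E /patch mem_setE in_itv /=.
  by case: ifP => _; rewrite ?mulr1 ?mulr0.
have F1 := integrable_fubini_F iG.
have E1 (x : R) : fubini_F mu G x = ((fun x => (\int[mu]_(y in `[c, d]) f x y)%:E) \_ `[a, b]) x.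
  rewrite /fubini_F /patch mem_setE in_itv /=; case: (boolP (a <= x <= b)) => hx; first exact: sec1.
  by rewrite integral0_eq// => y _; rewrite /G /g /= I1E (negbTE hx) mul0r mulr0.
have E2 (y : R) : fubini_G mu G y = ((fun y => (\int[mu]_(x in `[a, b]) f x y)%:E) \_ `[c, d]) y.
  rewrite /fubini_G /patch mem_setE in_itv /=; case: (boolP (c <= y <= d)) => hy; first exact: sec2.
  by rewrite integral0_eq// => x _; rewrite /G /g /= I2E (negbTE hy) !mulr0.
split.
- apply/integrable_mkcond => //; apply: eq_integrable F1 => // x _; exact: E1.
- rewrite /Rintegral; congr fine.
  have L : (\int[mu]_x \int[mu]_y G (x, y))%E = (\int[mu]_(x in `[a, b]) (\int[mu]_(y in `[c, d]) f x y)%R%:E)%E.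
    by rewrite [RHS]integral_mkcond; apply: eq_integral => x _; exact: E1.
  have L' : (\int[mu]_y \int[mu]_x G (x, y))%E = (\int[mu]_(y in `[c, d]) (\int[mu]_(x in `[a, b]) f x y)%R%:E)%E.
    by rewrite [RHS]integral_mkcond; apply: eq_integral => y _; exact: E2.
  by have := Fubini iG; rewrite L L'.
Qed.

Lemma rect_fubini (f : MR -> MR -> R) (a b c d B : R) :
  measurable_fun setT (fun p : MR * MR => f p.1 p.2) ->
  (forall x y, a <= x <= b -> c <= y <= d -> `|f x y| <= B) ->
  [/\ mu.-integrable `[a, b] (EFin \o (fun x => \int[mu]_(y in `[c, d]) f x y)),
      mu.-integrable `[c, d] (EFin \o (fun y => \int[mu]_(x in `[a, b]) f x y)) &
      \int[mu]_(x in `[a, b]) (\int[mu]_(y in `[c, d]) f x y) =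
      \int[mu]_(y in `[c, d]) (\int[mu]_(x in `[a, b]) f x y)].
Proof.
move=> mf fB; have [i1 e] := rect_fubini_left mf fB.
have ms : measurable_fun setT (fun p : MR * MR => (p.2, p.1)).
  by apply: measurable_fun_pair; [exact: measurable_snd|exact: measurable_fst].
have [i2 _] := @rect_fubini_left (fun y x => f x y) c d a b B (measurableT_comp mf ms)
  (fun y x hy hx => fB x y hx hy).
by split.
Qed.

(** Translation invariance, by uniqueness of the measure with given values on half-open
    intervals. *)
Lemma pushforward_shift (c : R) (A : set MR) : measurable A ->
  pushforward mu (fun x : MR => (x + c : MR)) A = mu A.
Proof.
have mc : measurable_fun setT (fun x : MR => (x + c : MR)) by apply: measurable_funD.
move=> mA; apply/esym/lebesgue_measure_unique => //= _ [[u v]] _ <-.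
rewrite /pushforward.
have -> : (fun x : MR => (x + c : MR)) @^-1` `]u, v] = `]u - c, v - c]%classic.
  by apply/seteqP; split => x /=; rewrite !in_itv /= ltrBlDr lerBrDr.
rewrite !lebesgue_measure_itv /= !lte_fin ltrD2r; case: ifP => // _.
by rewrite -!EFinB; congr EFin; ring.
Qed.

Lemma Rintegral_shift (f : R -> R) (a b c B : R) : measurable_fun setT f ->
  (forall x, a + c <= x <= b + c -> `|f x| <= B) ->
  \int[mu]_(x in `[a + c, b + c]) f x = \int[mu]_(x in `[a, b]) f (x + c).
Proof.
move=> mf fB; rewrite /Rintegral; congr fine.
have mc : measurable_fun setT (fun x : MR => (x + c : MR)) by apply: measurable_funD.
have pre : (fun x : MR => (x + c : MR)) @^-1` `[a + c, b + c] = `[a, b]%classic.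
  by apply/seteqP; split => x /=; rewrite !in_itv /= !lerD2r.
rewrite -pre -(integral_pushforward mc (f := fun x => (f x)%:E))//.
- by apply: eq_measure_integral => //= A mA _; exact/esym/pushforward_shift.
- exact/measurable_EFinP.
- rewrite pre; apply: (@integrable_bounded (fun x => f (x + c)) a b B).
    by apply: measurable_funTS; exact: measurableT_comp mf mc.
  by move=> x hx; apply: fB; rewrite !lerD2r.
Qed.

(* Jensen's inequality in x and Fubini's theorem. *)
Lemma mean_square_average (f : MR -> MR -> R) (c d B : R) (h : R -> R) :
  measurable_fun setT (fun p : MR * MR => f p.1 p.2) ->
  (forall x y, 0 <= x <= 1 -> c <= y <= d -> `|f x y| <= B) ->
  mu.-integrable `[0, 1] (EFin \o h) ->
  (forall x, 0 <= x <= 1 -> \int[mu]_(y in `[c, d]) (f x y ^+ 2) <= h x) ->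
  mu.-integrable `[c, d] (EFin \o (fun y => (\int[mu]_(x in `[0, 1]) f x y) ^+ 2)) /\
  \int[mu]_(y in `[c, d]) ((\int[mu]_(x in `[0, 1]) f x y) ^+ 2) <= \int[mu]_(x in `[0, 1]) h x.
Proof.
move=> mf fB ih fh.
have mf2 : measurable_fun setT (fun p : MR * MR => f p.1 p.2 ^+ 2) by exact: measurable_funX.
have fB2 x y : 0 <= x <= 1 -> c <= y <= d -> `|f x y ^+ 2| <= B ^+ 2.
  move=> hx hy; have h0 := fB x y hx hy.
  by rewrite normrX lerXn2r ?nnegrE// (le_trans _ h0).
have [i1 i2 E] := rect_fubini mf2 fB2.
have [j1 j2 _] := rect_fubini mf fB.
have jen (y : R) : c <= y <= d ->
   (\int[mu]_(x in `[0, 1]) f x y) ^+ 2 <= \int[mu]_(x in `[0, 1]) (f x y ^+ 2).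
  move=> hy; apply: (@jensen_unit _ B); last by move=> x hx; exact: fB.
  by have m := measurable_fun_pair1 y mf; exact: (@measurable_funTS _ _ _ _ _ (f ^~ y) m).
have i3 : mu.-integrable `[c, d] (EFin \o (fun y => (\int[mu]_(x in `[0, 1]) f x y) ^+ 2)).
  apply: (@le_integrable _ _ _ mu _ (measurable_itv _) _ _ _ _ i2).
  - apply/measurable_EFinP; apply: measurable_funX; apply/measurable_EFinP.
    exact: (measurable_int mu j2).
  - move=> y /=; rewrite in_itv /= => hy; rewrite lee_fin ger0_norm ?sqr_ge0//.
    by apply: le_trans (jen y hy) _; exact: ler_norm.
split => //; apply: (@le_trans _ _ (\int[mu]_(y in `[c, d]) (\int[mu]_(x in `[0, 1]) (f x y ^+ 2)))).
  by apply: le_Rintegral => // y; rewrite /= in_itv /=; exact: jen.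
by rewrite -E; apply: le_Rintegral => // x; rewrite /= in_itv /=; exact: fh.
Qed.

End RectangleFubini.

(** * Tail integrals *)

Section TailIntegrals.
Context {R : realType}.
Notation mu := (@lebesgue_measure R).

Lemma pow2_eventually (X y : R) : 0 < X -> exists n : nat, y < 2 ^+ n * X.
Proof.
move=> X0; have [n h] : exists n : nat, `|y / X| < n%:R.
  by exists (Num.truncn `|y / X|).+1; exact: truncnS_gt.
exists n; rewrite -ltr_pdivrMr//; apply: le_lt_trans (ler_norm _) _; apply: lt_le_trans h _.
by rewrite -natrX ler_nat ltnW// ltn_expl.
Qed.

(** Dyadic decomposition: on [P, 2P[ the weight is at most P^-a and the integral of W at most C
    (2P)^kap, so successive blocks decrease by the ratio 2^(kap - a) < 1. *)
Lemma tail_integral (W : R -> R) (C kap a : R) : measurable_fun setT W ->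
  (forall y, 0 <= W y) -> 0 <= C -> 0 <= kap -> kap < a ->
  (forall x : R, 1 <= x -> (\int[mu]_(y in `[1%R, x]) (W y)%:E <= (C * x `^ kap)%:E)%E) ->
  forall X, 1 <= X ->
  mu.-integrable `[X, +oo[ (EFin \o (fun y => W y * y `^ (- a))) /\
  \int[mu]_(y in `[X, +oo[) (W y * y `^ (- a)) <= C * 2 `^ kap / (1 - 2 `^ (kap - a)) * X `^ (kap - a).
Proof.
move=> mW W0 C0 k0 ka HW X X1.
have X0 : 0 < X by apply: lt_le_trans X1.
pose q : R := 2 `^ (kap - a); have q0 : 0 < q by exact: powR_gt0.
have q1 : q < 1.
  have l2 : 0 < ln 2 :> R by rewrite ln_gt0// ltr1n.
  by rewrite /q /powR pnatr_eq0 /= -[ltRHS]expR0 ltr_expR pmulr_llt0// subr_lt0.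
pose g y := W y * y `^ (- a).
have g0 y : 0 <= g y by rewrite mulr_ge0 ?powR_ge0.
have mg : measurable_fun setT g by apply: measurable_funM => //; exact: measurable_powR.
pose F n : set R := `[X, 2 ^+ n * X[%classic.
have mF n : measurable (F n) by exact: measurable_itv.
pose K := C * 2 `^ kap / (1 - q) * X `^ (kap - a).
have K0 : 0 <= C * 2 `^ kap * X `^ (kap - a) by rewrite !mulr_ge0 ?powR_ge0.
have step n : (\int[mu]_(y in `[(2 ^+ n * X)%R, (2 ^+ n.+1 * X)%R[) (g y)%:E <=
    (C * 2 `^ kap * X `^ (kap - a) * q ^+ n)%:E)%E.
  have P1 : 1 <= 2 ^+ n * X.
    by rewrite -[leLHS]mulr1 ler_pM// exprn_ege1// ler1n.
  have P0 : 0 < 2 ^+ n * X by apply: lt_le_trans P1.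
  move: P1 P0; have [P PE] : exists P : R, P = 2 ^+ n * X by exists (2 ^+ n * X).
  rewrite -PE => P1 P0; have -> : 2 ^+ n.+1 * X = 2 * P by rewrite exprS -mulrA PE.
  apply: (@le_trans _ _ (\int[mu]_(y in `[P, (2 * P)%R[) ((P `^ (- a))%:E * (W y)%:E))%E).
    apply: ge0_le_integral => //.
    - by move=> y _; rewrite lee_fin.
    - by apply: measurable_funTS; apply/measurable_EFinP.
    - by apply: measurable_funTS; apply: measurable_funeM; apply/measurable_EFinP.
    - move=> y /=; rewrite in_itv /= => /andP[Py _]; rewrite -EFinM lee_fin /g mulrC ler_wpM2r//.
      rewrite !powRN lef_pV2 ?posrE ?powR_gt0// ?(lt_le_trans P0)//.
      by apply: ge0_ler_powR; rewrite ?nnegrE ?(ltW P0) ?(le_trans (ltW P0) Py) ?(le_trans k0 (ltW ka)).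
  rewrite ge0_integralZl ?lee_fin ?powR_ge0//; last 2 first.
  - by apply: measurable_funTS; apply/measurable_EFinP.
  - by move=> y _; rewrite lee_fin.
  apply: (@le_trans _ _ ((P `^ (- a))%:E * (C * (2 * P) `^ kap)%:E)%E).
    apply: lee_wpmul2l; first by rewrite lee_fin powR_ge0.
    have P2 : 1 <= 2 * P by lra.
    apply: le_trans (HW _ P2).
    apply: ge0_subset_integral => //.
    - by apply: measurable_funTS; apply/measurable_EFinP.
    - by move=> y _; rewrite lee_fin.
    - by move=> y /=; rewrite !in_itv /= => /andP[h1 /ltW h2]; rewrite h2 (le_trans P1).
  rewrite -EFinM lee_fin powRM ?(ltW P0)//.
  have -> : P `^ (- a) * (C * (2 `^ kap * P `^ kap)) = C * 2 `^ kap * P `^ (kap - a).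
    by rewrite [kap - a]addrC [in RHS]powRD; [ring|rewrite (gt_eqF P0) implybT].
  rewrite PE powRM ?exprn_ge0 ?(ltW X0)//.
  have -> : (2 ^+ n) `^ (kap - a) = q ^+ n :> R.
    by rewrite /q -!powR_mulrn ?powR_ge0// -!powRrM mulrC.
  by rewrite mulrA le_eqVlt; apply/orP; left; apply/eqP; ring.
(* The factor 1 - q^n is the closed form of the geometric partial sum; it lets the induction pass
   while remaining below K. *)
have bnd n : (\int[mu]_(y in F n) (g y)%:E <= (K * (1 - q ^+ n))%:E)%E.
  elim: n => [|n IH].
    by rewrite /F expr0 mul1r subrr mulr0 set_itvco0 integral_set0.
  have -> : F n.+1 = F n `|` `[2 ^+ n * X, 2 ^+ n.+1 * X[.
    have h1 : X <= 2 ^+ n * X by rewrite -[leLHS]mul1r ler_wpM2r ?(ltW X0)// exprn_ege1// ler1n.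
    have h2 : 2 ^+ n * X <= 2 ^+ n.+1 * X.
      by rewrite ler_wpM2r ?(ltW X0)// exprS -[leLHS]mul1r ler_wpM2r ?exprn_ge0// ler1n.
    by rewrite /F -itv_bndbnd_setU// bnd_simp.
  have dis : [disjoint F n & (`[2 ^+ n * X, 2 ^+ n.+1 * X[%classic : set R)].
    apply/disj_set2P; rewrite -subset0 => y [] /=; rewrite !in_itv /= => /andP[_ h1] /andP[h2 _].
    by move: (lt_le_trans h1 h2); rewrite ltxx.
  have mU : measurable_fun (F n `|` `[2 ^+ n * X, 2 ^+ n.+1 * X[) (fun y => (g y)%:E).
    by apply: measurable_funTS; apply/measurable_EFinP.
  have gU y : (F n `|` `[2 ^+ n * X, 2 ^+ n.+1 * X[) y -> (0 <= (g y)%:E)%E by rewrite lee_fin.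
  rewrite [leLHS](ge0_integral_setU mu (mF n) (measurable_itv _) mU gU dis).
  apply: le_trans (leeD IH (step n)) _.
  rewrite -EFinD lee_fin /K exprS le_eqVlt; apply/orP; left; apply/eqP.
  by field; apply/eqP; lra.
have Kb : (\int[mu]_(y in `[X, +oo[) (g y)%:E <= K%:E)%E.
  have FU : \bigcup_n F n = `[X, +oo[%classic.
    apply/seteqP; split => y /=.
      by move=> [m _]; rewrite /F /= !in_itv /= andbT => /andP[].
    rewrite in_itv /= andbT => Xy; have [n yn] := pow2_eventually y X0.
    by exists n => //; rewrite /F /= in_itv /= Xy yn.
  rewrite -FU.
  have ndF : {homo F : n m / (n <= m)%N >-> (n <= m)%O}.
    move=> n m nm; rewrite subsetEset /F => y /=; rewrite !in_itv /= => /andP[-> h] /=.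
    by apply: lt_le_trans h _; rewrite ler_wpM2r ?(ltW X0)// ler_weXn2l// ler1n.
  have mg' n : measurable_fun (F n) (fun y => (g y)%:E).
    by apply: measurable_funTS; apply/measurable_EFinP.
  have gp n y : F n y -> (0%R <= (g y)%:E)%E by rewrite lee_fin.
  have cv : (\int[mu]_(y in F i) (g y)%:E)%E @[i --> \oo] --> (\int[mu]_(y in \bigcup_i F i) (g y)%:E)%E.
    exact: ge0_nondecreasing_set_cvg_integral.
  rewrite -(cvg_lim _ cv)//; apply: lime_le; first by apply/cvg_ex; eexists; exact: cv.
  apply: nearW => n; apply: le_trans (bnd n) _; rewrite lee_fin -[leRHS]mulr1 ler_wpM2l//.
    by rewrite /K mulrAC divr_ge0// subr_ge0 ltW.
  by rewrite gerBl exprn_ge0// ltW.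
have ig : mu.-integrable `[X, +oo[ (EFin \o g).
  apply/integrableP; split; first by apply: measurable_funTS; apply/measurable_EFinP.
  under eq_integral do rewrite gee0_abs ?lee_fin//.
  by apply: le_lt_trans Kb _; rewrite ltry.
split => //; rewrite -/K -lee_fin; apply: le_trans Kb.
by rewrite /Rintegral fineK//; exact: integrable_fin_num.
Qed.

End TailIntegrals.

(** * The representation of Dirichlet series by the error term *)

Section Representation.
Context {R : realType}.
Notation C := R[i].
Notation nc := (@Normc.normc R).
Notation mu := (@lebesgue_measure R).
Notation D := (`[1, +oo[%classic : set R).

Lemma nc_sub_le (x y : C) : nc (x - y) <= nc x + nc y.
Proof. by apply: le_trans (ncD _ _) _; rewrite ncN. Qed.

(** Of the nested divisions by s - 1 only the outermost is kept; the inner ones do not increase the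
    norm because |s - 1| >= 1. *)
Lemma nc_log_tail (s : C) j (y : R) : 1 <= nc (s - 1) -> 1 <= y ->
  nc (log_tail s j y) <= j.+1%:R * (y `^ (1 - complex.Re s) * (1 + ln y) ^+ j) / nc (s - 1).
Proof.
move=> s1 y1; have y0 : 0 < y by apply: lt_le_trans y1.
have s0 : 0 < nc (s - 1) by apply: lt_le_trans s1.
have l0 : 0 <= ln y by rewrite ln_ge0.
have e : nc (cpow y (1 - s)) = y `^ (1 - complex.Re s) by rewrite nc_cpow// ReD ReN.
elim: j => [|j IH]; first by rewrite [log_tail _ _ _]/(_ / _) ncM ncV e expr0 mulr1 mul1r.
rewrite (_ : log_tail s j.+1 y = (cpow y (1 - s) * (ln y ^+ j.+1 / (j.+1)`!%:R)%:C%C + log_tail s j y) / (s - 1)) //.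
rewrite ncM ncV ler_wpM2r ?invr_ge0 ?nc_ge0//.
apply: le_trans (ncD _ _) _.
rewrite (_ : j.+2%:R = 1 + j.+1%:R :> R); last by rewrite -[j.+2]add1n natrD.
rewrite [leRHS]mulrDl mul1r; apply: lerD.
  rewrite ncM e ncR ler_wpM2l ?powR_ge0// ger0_norm ?divr_ge0 ?exprn_ge0//.
  apply: le_trans (_ : ln y ^+ j.+1 <= _); last by apply: lerXn2r; rewrite ?nnegrE; lra.
  by rewrite ler_pdivrMr ?ltr0n ?fact_gt0// ler_peMr ?exprn_ge0// ler1n fact_gt0.
apply: le_trans IH _; rewrite ler_pdivrMr//.
set B := y `^ _ * _; set B' := y `^ _ * _.
have B0 : 0 <= B by rewrite mulr_ge0 ?powR_ge0 ?exprn_ge0//; lra.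
have BB : B <= B'.
  by rewrite /B /B' ler_wpM2l ?powR_ge0// exprS ler_peMl ?exprn_ge0//; lra.
by rewrite -mulrA ler_wpM2l//; apply: (le_trans BB); rewrite ler_peMr// (le_trans B0).
Qed.

(** The factor s alone would destroy the decay in t. Writing s = (s - 1) + 1, the part with s - 1
    reproduces the boundary contribution of the main term, which cancels, and only tails of size
    1/|s - 1| remain. *)
Lemma nc_log_polar be J (s : C) (X : R) : 1 <= nc (s - 1) -> 1 <= X ->
  nc (s * log_tails be J s X - (log_poly be J X)%:C%C * cpow X (- s)) <=
  2 * (\sum_(j < J) `|be j| * j.+1%:R) * X `^ (1 - complex.Re s) * (1 + ln X) ^+ J / nc (s - 1).
Proof.
move=> s1 X1; have X0 : 0 < X by apply: lt_le_trans X1.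
have s0 : 0 < nc (s - 1) by apply: lt_le_trans s1.
have sn : s - 1 != 0 by rewrite -nc_eq0 gt_eqF.
have l0 : 0 <= ln X by rewrite ln_ge0.
(* The tail of index j - 1, and 0 for j = 0, so that both clauses of [log_tail] take the same
   form. *)
pose lower j := if j is i.+1 then log_tail s i X else 0.
have -> : s * log_tails be J s X - (log_poly be J X)%:C%C * cpow X (- s) =
    \sum_(j < J) (be j)%:C%C * (log_tail s j X + lower j).
  rewrite /log_tails /log_poly rmorphM rmorph_sum /= mulrAC mulr_sumr mulr_sumr -sumrB.
  apply: eq_bigr => j _; rewrite rmorphM /=.
  have -> : log_tail s j X = (cpow X (1 - s) * (ln X ^+ j / j`!%:R)%:C%C + lower j) / (s - 1).
    by case: (nat_of_ord j) => [|i] //=; rewrite expr0 fact0 divr1 mulr1 addr0.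
  rewrite (_ : X%:C%C * cpow X (- s) = cpow X (1 - s)); last by rewrite cpowD// cpowx1.
  by move: (lower j) (_%:C%C) => u v; field.
apply: le_trans (nc_sum _ _ _) _.
pose B := X `^ (1 - complex.Re s) * (1 + ln X) ^+ J / nc (s - 1).
rewrite (_ : _ / nc (s - 1) = (\sum_(j < J) `|be j| * j.+1%:R) * (2 * B)); last by rewrite /B; ring.
rewrite mulr_suml; apply: ler_sum => j _.
rewrite ncM ncR -[leRHS]mulrA ler_wpM2l//.
have B0 : 0 <= B by rewrite /B divr_ge0 ?nc_ge0// mulr_ge0 ?powR_ge0// exprn_ge0//; lra.
have le1 i : (i < J)%N -> nc (log_tail s i X) <= i.+1%:R * B.
  move=> iJ; apply: le_trans (nc_log_tail i s1 X1) _; rewrite -mulrA ler_wpM2l// /B.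
  rewrite ler_wpM2r ?invr_ge0 ?nc_ge0// ler_wpM2l ?powR_ge0//.
  by apply: ler_weXn2l; [lra|exact: ltnW].
have le2 i : (i < J)%N -> nc (lower i) <= i.+1%:R * B.
  case: i => [|i] iJ; first by rewrite /lower nc0 mulr_ge0.
  apply: le_trans (le1 i (ltnW iJ)) _; rewrite ler_wpM2r// ler_nat//.
apply: le_trans (ncD _ _) _.
apply: le_trans (lerD (le1 j (ltn_ord j)) (le2 j (ltn_ord j))) _.
by rewrite le_eqVlt; apply/orP; left; apply/eqP; ring.
Qed.

Lemma truncn_natr (N : nat) : Num.truncn (N%:R : R) = N.
Proof. exact: natrK. Qed.

Section Identity.
Variables (d : nat -> R) (be : nat -> R) (J : nat) (c Cd W : R) (Z : C -> C).
Hypothesis d0 : forall n, 0 <= d n.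
Hypothesis ig : mu.-integrable D (EFin \o (fun y => `|error_term d be J y| * y `^ (- c - 1))).
Hypothesis dN : forall N : nat, summatory d N%:R <= Cd * N%:R ^+ 2.
Hypothesis HZ : forall s, W <= complex.Re s -> ccvg (fun N : nat => dpoly d N%:R s) (Z s).

Lemma summatory_ge0 y : 0 <= summatory d y.
Proof. by apply: sumr_ge0. Qed.

(** Far to the right, the difference of the partial sum and the right-hand side is O(1/N): Re s >= 3
    beats the summatory function O(N^2), the extra J beats the logarithms through 1 + ln N <= N, and
    Re s >= c + 1 beats the Mellin tail. *)
Lemma approx_limit (s : C) : W <= complex.Re s -> 3 + J%:R <= complex.Re s -> c + 1 <= complex.Re s ->
  Z s = approx d be J s 1 + s * mellin (error_term d be J) s.
Proof.
move=> sW sJ sc; set Phi := RHS.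
have J0 : 0 <= J%:R :> R by exact: ler0n.
have s1 : s != 1 by apply: contraTneq sJ => ->; rewrite -ltNge /=; lra.
have ns1 : 1 <= nc (s - 1).
  apply: le_trans (Re_le_nc _); apply: le_trans (ler_norm _); rewrite ReD ReN /=; lra.
set sr := complex.Re s in sW sJ sc *.
set I := \int[mu]_(y in D) (`|error_term d be J y| * y `^ (- c - 1)).
pose B := Cd + nc s * (\sum_(j < J) `|be j| * J%:R) + nc s * (2 * I).
have I0 : 0 <= I by apply: Rintegral_ge0 => y _; rewrite mulr_ge0 ?powR_ge0.
have bd (n : nat) : nc (dpoly d n.+1%:R s - Phi) <= B * harmonic n.
  set N : R := n.+1%:R.
  have N1 : 1 <= N by rewrite ler1n.
  have N0 : 0 < N by apply: lt_le_trans N1.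
  have csr : c <= complex.Re s by rewrite -/sr; lra.
  rewrite /Phi (mellin_split d0 s1 N1 csr ig).
  rewrite /approx (_ : _ - _ = (summatory d N)%:C%C * cpow N (- s) - s * log_tails be J s N
     - s * tail_mellin (error_term d be J) s N); last by ring.
  rewrite /B [leRHS]mulrDl; apply: le_trans (nc_sub_le _ _) _.
  have pN (a : R) : a <= -1 -> N `^ a <= N^-1.
    by move=> a1; rewrite -powR_inv1 ?(ltW N0)// ler_powR.
  apply: lerD.
    rewrite mulrDl; apply: le_trans (nc_sub_le _ _) _; apply: lerD.
      rewrite ncM ncR nc_cpow// ReN ger0_norm ?summatory_ge0//.
      apply: le_trans (ler_wpM2r (powR_ge0 _ _) (dN n.+1)) _.
      have Cd0 : 0 <= Cd by have := dN 1; have := summatory_ge0 1; rewrite expr1n mulr1 => /le_trans; apply.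
      rewrite -mulrA ler_wpM2l// -/N -powR_mulrn ?(ltW N0)// -powRD ?(gt_eqF N0) ?implybT//.
      by apply: pN; rewrite -/sr; lra.
    rewrite ncM -mulrA ler_wpM2l ?nc_ge0// /log_tails.
    apply: le_trans (nc_sum _ _ _) _; rewrite mulr_suml; apply: ler_sum => j _.
    rewrite ncM ncR -mulrA ler_wpM2l//.
    apply: le_trans (nc_log_tail j ns1 N1) _.
    rewrite ler_pdivrMr; last by apply: lt_le_trans ns1.
    apply: le_trans (_ : J%:R * harmonic n <= _); last first.
      by rewrite ler_peMr// mulr_ge0// invr_ge0.
    apply: ler_pM => //.
    - by rewrite mulr_ge0 ?powR_ge0// exprn_ge0// addr_ge0// ln_ge0.
    - by rewrite ler_nat.
    - apply: le_trans (_ : N `^ (1 - sr) * N `^ J%:R <= _).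
        rewrite ler_wpM2l ?powR_ge0// powR_mulrn ?(ltW N0)//.
        apply: le_trans (_ : (1 + ln N) ^+ J <= _).
          by apply: ler_weXn2l; [rewrite lerDl ln_ge0|exact: ltnW].
        apply: lerXn2r; rewrite ?nnegrE ?(ltW N0) ?addr_ge0 ?ln_ge0//.
        have := @le_ln1Dx R (N - 1); rewrite (_ : 1 + (N - 1) = N); last by ring.
        by move=> h; rewrite -lerBrDl; apply: h; lra.
      rewrite -powRD ?(gt_eqF N0) ?implybT//.
      by apply: pN; lra.
  rewrite ncM -mulrA ler_wpM2l ?nc_ge0//.
  apply: le_trans (nc_tail_mellin (measurable_error be J d0) N1 csr ig) _; rewrite -/I -/sr.
  rewrite -[leLHS]mulrA [N `^ _ * _]mulrC [leLHS]mulrA ler_wpM2l ?mulr_ge0//.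
  by apply: pN; lra.
have h1 : ccvg (fun n => dpoly d (n + 1)%:R s) Phi.
  apply: (@ccvg_squeeze _ _ _ (fun n => B * harmonic n)).
    by apply: nearW => n; rewrite addn1; exact: bd.
  by rewrite -[0](mulr0 B); apply: cvgMr; exact: cvg_harmonic.
have h2 := (ccvg_shift 1 (fun N => dpoly d N%:R s) Phi).1 h1.
exact: ccvg_uniq (HZ sW) h2.
Qed.

(** Both sides are analytic for Re s > c off the point 1 and agree far to the right; a segment
    avoiding 1 carries the equality to s0. *)
Lemma mellin_identity (s0 : C) : (forall s, s != 1 -> analytic_at Z s) -> s0 != 1 ->
  c < complex.Re s0 ->
  Z s0 = approx d be J s0 1 + s0 * mellin (error_term d be J) s0.
Proof.
move=> Zan s01 cs0; set s0r := complex.Re s0; set s0i := complex.Im s0.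
pose f s := Z s - (s * (\sum_(j < J) (be j)%:C%C * (s - 1)^-1 ^+ j.+1) + s * mellin (error_term d be J) s).
have fE s : f s = Z s - (approx d be J s 1 + s * mellin (error_term d be J) s).
  by rewrite /f approx1; congr (_ - (_ * _ + _)); apply: eq_bigr => j _; rewrite exprVn.
have fan s : s != 1 -> c < complex.Re s -> analytic_at f s.
  move=> h1 h2; apply: analyticB; first exact: Zan.
  apply: analyticD.
    apply: (analyticM (analytic_id s)); apply: analytic_sum => j.
    exact: (analyticM (analytic_cst _ s) (analyticX j.+1 (analytic_inv_sub h1))).
  exact: (analyticM (analytic_id s) (analytic_mellin (measurable_error be J d0) ig h2)).
have f0 s : W <= complex.Re s -> 3 + J%:R <= complex.Re s -> c + 1 <= complex.Re s -> f s = 0.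
  by move=> h1 h2 h3; rewrite fE -(approx_limit h1 h2 h3) subrr.
suff : f s0 = 0 by rewrite fE => /eqP; rewrite subr_eq0 => /eqP.
pose V := `|W| + (3 + J%:R) + `|c| + 1 + `|s0r|.
have J0 : 0 <= J%:R :> R by exact: ler0n.
have [n1 n2 n3] : [/\ W <= `|W|, c <= `|c| & s0r <= `|s0r|] by split; exact: ler_norm.
have [p1 p2 p3] : [/\ 0 <= `|W|, 0 <= `|c| & 0 <= `|s0r|] by split; exact: normr_ge0.
(* Height of the starting point: the segment is horizontal off the real axis when Im s0 is nonzero,
   and otherwise meets the real axis only at its end s0, which differs from 1. *)
pose y1 := if s0i == 0 then 1 else s0i.
pose a : C := ((V + 1) +i* y1)%C.
pose v : C := s0 - a.
have vr : 0 < V + 1 - s0r by rewrite /V; lra.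
have s0E : s0 = (s0r +i* s0i)%C by rewrite /s0r /s0i; case: (s0).
have ReE t : complex.Re (a + t%:C%C * v) = (V + 1) - t * (V + 1 - s0r).
  by rewrite ReD ReRM /v ReD ReN /=; rewrite -/s0r; ring.
have ImE t : complex.Im (a + t%:C%C * v) = y1 + t * (s0i - y1).
  by rewrite ImD ImRM /v ImD ImN.
have -> : s0 = a + v by rewrite /v addrC subrK.
(* The real part falls from V + 1 at the rate V + 1 - s0r, so for t below the inverse of this rate
   it stays above V, where [approx_limit] applies. *)
apply: (@identity_segment _ f a v (V + 1 - s0r)^-1).
- apply/eqP => v0; have := congr1 (fun z : C => complex.Re z) (v0 : v = 0 :> C); rewrite /v ReD ReN /= -/s0r => e.
  by move: vr; lra.
- by rewrite invr_gt0.
- move=> t /andP[t0 t1]; apply: fan; last first.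
    rewrite ReE; apply: (@lt_le_trans _ _ (V + 1 - (V + 1 - s0r))); first by rewrite opprB addrC subrK.
    by rewrite lerD2l lerN2 ler_piMl// ltW.
  apply/eqP => e; have := congr1 (fun z : C => complex.Im z) (e : _ = 1 :> C); rewrite ImE /y1 /=.
  case: (eqVneq s0i 0) => [z0|z0] h; last by move/eqP: z0; apply; move: h; rewrite subrr mulr0 addr0.
  have t1' : t = 1 by move: h; rewrite z0; lra.
  move: e; rewrite t1' mul1r /v addrC subrK => e.
  by move: s01; rewrite e eqxx.
- move=> t /andP[t0 td].
  have h : t * (V + 1 - s0r) < 1 by rewrite -ltr_pdivlMr// div1r.
  by apply: f0; rewrite ReE; move: h; rewrite /V; lra.
Qed.

End Identity.

(** At s = 1 the kernel is the real function y^-2, so every coefficient is the integral of a real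
    function. *)
Lemma real_ps_mellin (g : R -> R) c : measurable_fun setT g ->
  mu.-integrable D (EFin \o (fun y => `|g y| * y `^ (- c - 1))) -> c < 1 ->
  real_ps (mellin g) 1.
Proof.
move=> mg ig c1; have H := mellin_has_ps mg ig (c1 : c < complex.Re (1 : C)).
pose U n y := ((- ln y) ^+ n / n`!%:R)%:C%C * ((g y)%:C%C * cpow y (- (1 : C) - 1)).
exists (fun n => complex.Re (cint D (U n))); move: H; congr has_ps; apply/funext => n.
rewrite -/(U n) /cint; congr (_ +i* _)%C.
transitivity (\int[mu]_(y in D) (0 : R)); last by rewrite /Rintegral integral0.
apply: eq_Rintegral => y _; rewrite /U ImRM ImRM Im_cpow.
by rewrite ImD ImN /= subr0 oppr0 mul0r sin0 !mulr0.
Qed.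

End Representation.

(** * Moments of the error term and the case of zeta *)

Section ErrorMoments.
Context {R : realType}.
Notation mu := (@lebesgue_measure R).

Lemma ln_le_self (y : R) : 1 <= y -> ln y <= y.
Proof.
move=> y1; have := @le_ln1Dx R (y - 1); rewrite (_ : 1 + (y - 1) = y); last by ring.
by move=> h; apply: le_trans (h _) _; lra.
Qed.

Lemma integral_cst_itv (c x : R) : 1 <= x ->
  (\int[mu]_(y in `[1%R, x]) c%:E = (c * (x - 1))%:E)%E.
Proof.
move=> x1; rewrite integral_cst//= lebesgue_measure_itv /= lte_fin.
have [x1'|x1'] := ltP 1 x; first by rewrite -EFinD -EFinM.
by rewrite (_ : x = 1) ?subrr ?mule0 ?mulr0//; apply/eqP; rewrite eq_le x1 x1'.
Qed.

Variables (d be : nat -> R) (J : nat).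
Hypothesis d0 : forall n, 0 <= d n.
Notation De := (error_term d be J).

Lemma error_term_bounded (x : R) : exists B : R, forall y, 1 <= y <= x -> `|De y| <= B.
Proof.
exists (summatory d x + x * \sum_(j < J) `|be j| * (ln x ^+ j)) => y /andP[y1 yx].
have l0 : 0 <= ln y by exact: ln_ge0.
have lx : ln y <= ln x by rewrite ler_ln ?posrE//; apply: lt_le_trans ltr01 _ => //; exact: le_trans yx.
apply: le_trans (ler_normB _ _) _; apply: lerD.
  rewrite ger0_norm ?summatory_ge0// /summatory.
  rewrite [leRHS](@big_cat_nat _ _ _ (Num.truncn y).+1)//= ?lerDl; first by apply: sumr_ge0.
  by rewrite ltnS le_truncn.
rewrite normrM ger0_norm; last lra.
apply: ler_pM => //; first lra.
apply: le_trans (ler_norm_sum _ _ _) _; apply: ler_sum => j _.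
rewrite normrM ler_wpM2l// ger0_norm ?divr_ge0 ?exprn_ge0//.
apply: le_trans (_ : ln y ^+ j <= _); last by apply: lerXn2r => //; rewrite nnegrE; lra.
by rewrite ler_pdivrMr ?ltr0n ?fact_gt0// ler_peMr ?exprn_ge0// ler1n fact_gt0.
Qed.

Lemma integrable_error_sqr (x : R) : mu.-integrable `[1, x] (EFin \o (fun y => De y ^+ 2)).
Proof.
have [B HB] := error_term_bounded x; apply: (@integrable_bounded _ _ _ _ (B ^+ 2)).
  by apply: measurable_funTS; apply: measurable_funX; exact: measurable_error.
by move=> y /HB h; rewrite normrX; apply: lerXn2r => //; rewrite nnegrE// (le_trans _ h).
Qed.

(** The asymptotic bound holds beyond some M only. The integral is nondecreasing in x, so its value
    at |M| + 1 serves as an additional constant below that point. *)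
Lemma error_sqr_bound (b : R) : 0 <= b ->
  vinogradov (fun x => \int[mu]_(y in `[1, x]) De y ^+ 2) (fun x => x `^ (1 + 2 * b)) ->
  exists2 C : R, 0 <= C & forall x : R, 1 <= x ->
    (\int[mu]_(y in `[1%R, x]) (De y ^+ 2)%:E <= (C * x `^ (1 + 2 * b))%:E)%E.
Proof.
move=> b0 [C [M [_ HM]]].
pose I x := \int[mu]_(y in `[1, x]) (De y ^+ 2).
have IE x : (\int[mu]_(y in `[1%R, x]) (De y ^+ 2)%:E = (I x)%:E)%E.
  by rewrite /I /Rintegral fineK//; exact: integrable_fin_num (integrable_error_sqr x).
have I0 x : 0 <= I x by apply: Rintegral_ge0 => y _; exact: sqr_ge0.
exists (`|C| + I (`|M| + 1)) => [|x x1]; first by rewrite addr_ge0.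
rewrite IE lee_fin.
have xp : 1 <= x `^ (1 + 2 * b).
  by rewrite -[leLHS](powRr0 x); apply: ler_powR => //; rewrite addr_ge0// mulr_ge0.
case: (lerP x (`|M| + 1)) => xM.
  apply: le_trans (_ : I (`|M| + 1) <= _).
    rewrite -lee_fin -!IE; apply: ge0_subset_integral => //.
    - by apply: measurable_funTS; apply/measurable_EFinP; apply: measurable_funX; exact: measurable_error.
    - by move=> y _; rewrite lee_fin sqr_ge0.
    - by move=> y /=; rewrite !in_itv /= => /andP[-> h]; rewrite (le_trans h).
  rewrite -[leLHS]mulr1; apply: ler_pM => //; rewrite ?lerDr//.
have Mx : M < x by have := ler_norm M; lra.
have := HM x Mx; rewrite /= -/(I x) ger0_norm// => /le_trans; apply.
rewrite ger0_norm ?powR_ge0// ler_wpM2r ?powR_ge0//.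
by apply: le_trans (ler_norm C) _; rewrite lerDl.
Qed.

(** Makes the set under the infimum in [beta] inhabited. Crude estimates give |De(y)| <= S y^m with
    m = J + 2, and b = m is then admissible. *)
Lemma error_beta_nonempty (K : R) : (forall n, (0 < n)%N -> d n <= K * n%:R) ->
  exists2 b : R, 0 <= b &
  vinogradov (fun x => \int[mu]_(y in `[1, x]) De y ^+ 2) (fun x => x `^ (1 + 2 * b)).
Proof.
move=> dK; have K0 : 0 <= K by have := dK 1%N isT; rewrite mulr1; exact: le_trans.
have [m mE] : exists m, m = J.+2 by exists J.+2.
pose S := K + \sum_(j < J) `|be j|.
have S0 : 0 <= S by rewrite addr_ge0// sumr_ge0.
have bd y : 1 <= y -> `|De y| <= S * y ^+ m.
  move=> y1; have y0 : 0 <= y by lra.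
  apply: le_trans (ler_normB _ _) _; rewrite /S mulrDl; apply: lerD.
    rewrite ger0_norm ?summatory_ge0//.
    have ty : (Num.truncn y)%:R <= y by rewrite truncn_le.
    apply: le_trans (_ : (Num.truncn y)%:R * (K * (Num.truncn y)%:R) <= _).
      rewrite /summatory mulr_natl -[X in _ *+ X](subn1 (Num.truncn y).+1) -sumr_const_nat.
      rewrite big_nat [leRHS]big_nat; apply: ler_sum => n /andP[n1 n2].
      by apply: le_trans (dK n n1) _; rewrite ler_wpM2l// ler_nat.
    rewrite mulrCA ler_wpM2l//; apply: le_trans (_ : y ^+ 2 <= _); last by apply: ler_weXn2l; rewrite ?mE.
    by rewrite expr2 ler_pM.
  rewrite normrM (ger0_norm y0) mE exprS mulrCA ler_wpM2l//.
  apply: le_trans (ler_norm_sum _ _ _) _; rewrite mulr_suml; apply: ler_sum => j _.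
  rewrite normrM ler_wpM2l//.
  have l0 : 0 <= ln y by exact: ln_ge0.
  rewrite ger0_norm ?divr_ge0 ?exprn_ge0//.
  apply: le_trans (_ : ln y ^+ j <= _).
    by rewrite ler_pdivrMr ?ltr0n ?fact_gt0// ler_peMr ?exprn_ge0// ler1n fact_gt0.
  apply: le_trans (_ : y ^+ j <= _); last by apply: ler_weXn2l => //; rewrite ltnW// ltnS ltnW.
  by apply: lerXn2r; rewrite ?nnegrE// ln_le_self.
exists m%:R => //; exists (S ^+ 2); exists 1; split; first exact: num_real.
move=> x x1 /=; have x0 : 0 < x by lra.
rewrite [leRHS]mulrC (ger0_norm (powR_ge0 _ _)) ger0_norm; last by apply: Rintegral_ge0 => y _; exact: sqr_ge0.
apply: le_trans (_ : \int[mu]_(y in `[1, x]) (cst (S ^+ 2 * x ^+ (2 * m)) y) <= _).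
  apply: le_Rintegral => //.
  - exact: integrable_error_sqr.
  - by apply: integrable_continuous => t _; exact: cst_continuous.
  - move=> y; rewrite /= in_itv /= => /andP[y1 yx].
    rewrite -real_normK ?num_real// mulnC exprM -exprMn.
    have Sx : 0 <= S * x ^+ m by rewrite mulr_ge0 ?exprn_ge0 ?(ltW x0).
    rewrite lerXn2r ?nnegrE// (le_trans (bd y y1))// ler_wpM2l// lerXn2r ?nnegrE ?(ltW x0)//.
    exact: le_trans ler01 y1.
rewrite Rintegral_cst// lebesgue_itv ?(ltW x1)//.
rewrite powRD ?(gt_eqF x0) ?implybT// powRr1 ?(ltW x0)// -natrM powR_mulrn ?(ltW x0)//.
set v := x ^+ (2 * m); have v0 : 0 <= v by rewrite exprn_ge0// ltW.
rewrite [leRHS](_ : _ = S ^+ 2 * v * x); last by ring.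
by rewrite ler_wpM2l ?mulr_ge0 ?exprn_ge0//; lra.
Qed.

Section Bounds.
Variables (b C : R).
Hypothesis b0 : 0 <= b.
Hypothesis C0 : 0 <= C.
Hypothesis HC : forall x : R, 1 <= x ->
    (\int[mu]_(y in `[1%R, x]) (De y ^+ 2)%:E <= (C * x `^ (1 + 2 * b))%:E)%E.

(* AM-GM: 2 |De| <= x^b + x^-b De^2 *)
Lemma error_abs_bound (x : R) : 1 <= x ->
  (\int[mu]_(y in `[1%R, x]) (`|De y|)%:E <= ((1 + C) * x `^ (1 + b))%:E)%E.
Proof.
move=> x1; have x0 : 0 < x by apply: lt_le_trans x1.
have xb0 : 0 < x `^ b by exact: powR_gt0.
have mD : measurable_fun (`[1, x]%classic : set R) (fun y => (De y ^+ 2)%:E).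
  by apply: measurable_funTS; apply/measurable_EFinP; apply: measurable_funX; exact: measurable_error.
apply: (@le_trans _ _ (\int[mu]_(y in `[1%R, x]) ((x `^ b)%:E + (x `^ (- b))%:E * (De y ^+ 2)%:E))%E).
  apply: ge0_le_integral => //.
  - by apply: measurable_funTS; apply/measurable_EFinP; apply: measurableT_comp => //; exact: measurable_error.
  - by apply: emeasurable_funD => //; apply: measurable_funeM.
  - move=> y _; rewrite -EFinM -EFinD lee_fin powRN.
    have h := @amgm2 R (x `^ b) (`|De y|) 1.
    have : 0 <= (x `^ b)^-1 * (x `^ b - `|De y|) ^+ 2 by rewrite mulr_ge0 ?sqr_ge0// invr_ge0 ltW.
    rewrite (_ : _ * _ = x `^ b - 2 * `|De y| + (x `^ b)^-1 * `|De y| ^+ 2); last by field; rewrite gt_eqF.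
    by rewrite real_normK ?num_real//; have := normr_ge0 (De y); lra.
rewrite ge0_integralD//; last 3 first.
- by move=> y _; rewrite lee_fin ltW.
- by move=> y _; rewrite -EFinM lee_fin mulr_ge0 ?powR_ge0 ?sqr_ge0.
- by apply: measurable_funeM.
rewrite ge0_integralZl ?lee_fin ?powR_ge0//; last by move=> y _; rewrite lee_fin sqr_ge0.
apply: (@le_trans _ _ ((x `^ b)%:E * (x - 1)%:E + (x `^ (- b))%:E * (C * x `^ (1 + 2 * b))%:E)%E).
  apply: leeD; last by apply: lee_wpmul2l; rewrite ?lee_fin ?powR_ge0//; exact: HC.
  by rewrite integral_cst_itv.
rewrite -2!EFinM -EFinD lee_fin (_ : (1 + C) * _ = x `^ (1 + b) + C * x `^ (1 + b)); last by ring.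
apply: lerD.
  by rewrite powRD ?(gt_eqF x0) ?implybT// powRr1 ?(ltW x0)// mulrC ler_wpM2r ?powR_ge0//; lra.
rewrite mulrCA -powRD ?(gt_eqF x0) ?implybT//.
by rewrite (_ : - b + (1 + 2 * b) = 1 + b)//; ring.
Qed.

Lemma error_abs_tail c (X : R) : b < c -> 1 <= X ->
  mu.-integrable `[X, +oo[ (EFin \o (fun y => `|De y| * y `^ (- c - 1))) /\
  \int[mu]_(y in `[X, +oo[) (`|De y| * y `^ (- c - 1)) <=
    (1 + C) * 2 `^ (1 + b) / (1 - 2 `^ (b - c)) * X `^ (b - c).
Proof.
move=> bc X1; have -> : b - c = (1 + b) - (1 + c) by ring.
have -> : - c - 1 = - (1 + c) by ring.
apply: tail_integral => //.
- by apply: measurableT_comp => //; exact: measurable_error.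
- by rewrite addr_ge0.
- by rewrite addr_ge0.
- by rewrite ltrD2l.
- by move=> x x1; apply: le_trans (error_abs_bound x1) _.
Qed.

Lemma error_sqr_tail c (X : R) : b < c -> 1 <= X ->
  mu.-integrable `[X, +oo[ (EFin \o (fun y => De y ^+ 2 * y `^ (- (1 + 2 * c)))) /\
  \int[mu]_(y in `[X, +oo[) (De y ^+ 2 * y `^ (- (1 + 2 * c))) <=
    C * 2 `^ (1 + 2 * b) / (1 - 2 `^ (2 * b - 2 * c)) * X `^ (2 * b - 2 * c).
Proof.
move=> bc X1; have -> : 2 * b - 2 * c = (1 + 2 * b) - (1 + 2 * c) by ring.
apply: tail_integral => //.
- by apply: measurable_funX; exact: measurable_error.
- by move=> y; exact: sqr_ge0.
- by rewrite addr_ge0// mulr_ge0.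
- by rewrite ltrD2l ltr_pM2l.
Qed.

End Bounds.
End ErrorMoments.

(** * Continuation of zeta and of its powers *)

Section Zeta.
Context {R : realType}.
Notation C := R[i].
Notation nc := (@Normc.normc R).
Notation mu := (@lebesgue_measure R).
Variable zeta : C -> C.
Hypothesis hz : is_riemann_zeta zeta.
Notation one := (fun=> 1 : R).

Lemma summatory_one (y : R) : summatory one y = (Num.truncn y)%:R.
Proof. by rewrite /summatory sumr_const_nat subn1. Qed.

Lemma error_one (y : R) : 1 <= y -> `|error_term one one 1 y| <= 1.
Proof.
move=> y1; have y0 : 0 <= y by lra.
rewrite /error_term /log_poly summatory_one big_ord1 expr0 fact0 divr1 !mulr1.
have h1 : (Num.truncn y)%:R <= y by rewrite truncn_le.
have h2 : y < (Num.truncn y).+1%:R by exact: truncnS_gt.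
move: h2; rewrite -natr1 => h2; rewrite ler_norml; apply/andP; split; lra.
Qed.

Lemma integrable_error_one (c : R) : 0 < c ->
  mu.-integrable `[1, +oo[ (EFin \o (fun y => `|error_term one one 1 y| * y `^ (- c - 1))).
Proof.
move=> c0; have -> : - c - 1 = - (1 + c) by ring.
have m1 : measurable_fun setT (fun y : R => `|error_term one one 1 y|).
  by apply: measurableT_comp => //; apply: measurable_error.
suff [] : mu.-integrable `[1, +oo[ (EFin \o (fun y => `|error_term one one 1 y| * y `^ (- (1 + c)))) /\
  \int[mu]_(y in `[1, +oo[) (`|error_term one one 1 y| * y `^ (- (1 + c))) <=
    1 * 2 `^ 1 / (1 - 2 `^ (1 - (1 + c))) * 1 `^ (1 - (1 + c)) by [].
apply: tail_integral => //; first lra.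
move=> x x1; apply: (@le_trans _ _ (\int[mu]_(y in `[1%R, x]) 1%:E)%E).
  apply: ge0_le_integral => //.
  - by apply: measurable_funTS; apply/measurable_EFinP.
  - by move=> y /=; rewrite in_itv /= => /andP[h _]; rewrite lee_fin error_one.
by rewrite integral_cst_itv// lee_fin powRr1; lra.
Qed.

Lemma dpoly_nat (d : nat -> R) (N : nat) (s : C) :
  dpoly d N%:R s = \sum_(1 <= n < N.+1) (d n)%:C%C * cpow n%:R (- s).
Proof. by rewrite /dpoly truncn_natr. Qed.

(** The case d = 1 with main term y, whose error is bounded by 1. The abscissa 1/2 leaves a disc of
    radius 1/2 around the pole, enough to compute the residue. *)
Lemma zeta_mellin (s : C) : s != 1 -> 2^-1 < complex.Re s ->
  zeta s = s / (s - 1) + s * mellin (error_term one one 1) s.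
Proof.
move=> s1 hs.
have -> : s / (s - 1) = approx one one 1 s 1.
  by rewrite approx1 big_ord1 mul1r expr1.
have h0 : (0 : R) < 2^-1 by rewrite invr_gt0.
apply: (@mellin_identity _ one one 1 2^-1 1 3 zeta (fun=> ler01) (integrable_error_one h0) _ _ s hz.2 s1 hs).
- by move=> N; rewrite summatory_one truncn_natr mul1r -natrX ler_nat; case: N => // n; rewrite -mulnn leq_pmulr.
- move=> z z3; have z1 : 1 < complex.Re z by lra.
  have /cvgC := hz.1 z z1; apply: ccvg_eq => N.
  rewrite dpoly_nat /series /= big_add1 /=; apply: eq_bigr => n _.
  by rewrite mul1r.
Qed.

Lemma main_term_log_poly k : (0 < k)%N ->
  exists be : nat -> R, forall x : R, 0 < x -> main_term zeta k x = log_poly be k x.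
Proof.
move=> k0; have h0 : (0 : R) < 2^-1 by rewrite invr_gt0.
have h1 : 2^-1 < 1 :> R by rewrite invf_lt1// ltr1n.
have me : measurable_fun setT (error_term one one 1 : R -> R) by apply: measurable_error.
(* This is (z - 1) zeta(z) with the pole cancelled; it is written so that its coefficients at 1 are
   visibly real. *)
pose h (z : C) := z + (z + (-1)%:C%C) * (z * mellin (error_term one one 1) z).
have rh : real_ps h 1.
  apply: real_psD; first exact: (real_ps_id 1).
  apply: real_psM; first by apply: real_psD; [exact: (real_ps_id 1)|exact: real_ps_cst].
  by apply: real_psM; [exact: (real_ps_id 1)|exact: real_ps_mellin me (integrable_error_one h0) h1].
have [|be Hbe] := main_termE k0 h0 rh (zeta := zeta); last by exists be.
move=> z z1 zr; rewrite zeta_mellin//; last first.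
  have := le_lt_trans (Re_le_nc (z - 1)) zr; rewrite ReD ReN /= => /ltr_normlP[]; lra.
rewrite /h (_ : (-1)%:C%C = -1 :> C); last by rewrite rmorphN rmorph1.
by field; rewrite subr_eq0.
Qed.

Lemma zeta_power_split k (be : nat -> R) c (s : C) (X : R) :
  mu.-integrable `[1, +oo[ (EFin \o (fun y =>
    `|error_term (fun n => (divk k n)%:R) be k y| * y `^ (- c - 1))) ->
  s != 1 -> c < complex.Re s -> 1 <= X ->
  zeta s ^+ k = approx (fun n => (divk k n)%:R) be k s X +
    s * tail_mellin (error_term (fun n => (divk k n)%:R) be k) s X.
Proof.
set d := (fun n => (divk k n)%:R) => ig s1 cs X1.
have d0 n : 0 <= d n :> R by [].
rewrite -(mellin_split d0 s1 X1 (ltW cs) ig).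
have [K K0 dK] := @divk_bound R k 1 ltr01.
apply: (@mellin_identity _ d be k c K 3 (fun s => zeta s ^+ k) d0 ig _ _ s _ s1 cs).
- move=> N; rewrite /summatory truncn_natr expr2 mulrCA.
  rewrite mulr_natl -[X in _ *+ X](subn1 N.+1) -sumr_const_nat big_nat [leRHS]big_nat.
  apply: ler_sum => n /andP[n1 n2]; apply: le_trans (dK n n1) _.
  by rewrite powRr1// ler_wpM2l ?(ltW K0)// ler_nat.
- move=> z z3; have z1 : 1 < complex.Re z by lra.
  apply: ccvg_eq (dirichlet_power k (hz.1 z z1) z3) => N.
  by rewrite dpoly_nat; apply: eq_bigr => n _; rewrite rmorph_nat.
- by move=> z z1; exact: analyticX (hz.2 z z1).
Qed.

End Zeta.

(** * Unit intervals *)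

Section UnitShifts.
Context {R : realType}.
Notation mu := (@lebesgue_measure R).
Local Notation MR := (measurableTypeR R).

Lemma measurable_comp_fun d (U : measurableType d) (f : R -> R) (g : U -> R) :
  measurable_fun setT f -> measurable_fun setT g -> measurable_fun setT (fun x => f (g x)).
Proof. by move=> mf mg; exact: (measurableT_comp mf mg). Qed.

Lemma measurable_shift (X c : R) : measurable_fun setT (fun x : R => X + x + c).
Proof. by apply: measurable_funD => //; apply: measurable_funD. Qed.

(** Translating each unit interval to [0, 1] turns an integral into an average of sums over points
    at distance 1, the form in which [mean_square] applies. *)
Lemma Rintegral_unit_sum (f : R -> R) (X B : R) (L : nat) : measurable_fun setT f ->
  (forall y, X <= y <= X + L%:R -> `|f y| <= B) ->
  \int[mu]_(y in `[X, X + L%:R]) f y = \int[mu]_(x in `[0, 1]) (\sum_(l < L) f (X + x + l%:R)).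
Proof.
move=> mf; elim: L => [|L IH] fB.
  rewrite addr0 set_itv1 Rintegral_set1 (@eq_Rintegral _ _ _ mu _ (fun=> 0)); last first.
    by move=> x _; rewrite big_ord0.
  by rewrite /Rintegral integral0.
have LL : X + L%:R <= X + L.+1%:R by rewrite lerD2l ler_nat.
have XL : X <= X + L%:R by rewrite lerDl.
have fB' y : X <= y <= X + L%:R -> `|f y| <= B.
  by move=> /andP[h1 h2]; apply: fB; rewrite h1 (le_trans h2).
have mfx c : measurable_fun setT (fun x : R => f (X + x + c)).
  exact: measurable_comp_fun mf (measurable_shift X c).
have if1 l : (l < L.+1)%N -> mu.-integrable `[0, 1] (EFin \o (fun x => f (X + x + l%:R))).
  move=> lL; apply: (@integrable_bounded _ _ _ _ B); first exact: measurable_funTS.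
  move=> x /andP[x0 x1]; apply: fB; have h0 : 0 <= l%:R :> R by [].
  have h1 : l.+1%:R <= L.+1%:R :> R by rewrite ler_nat.
  by move: h1; rewrite -[l.+1]addn1 natrD => h1; apply/andP; split; lra.
have iX : mu.-integrable `[X, X + L.+1%:R] (EFin \o f).
  by apply: (@integrable_bounded _ _ _ _ B) => //; exact: measurable_funTS.
have E := @Rintegral_itvB R f (BLeft X) (BRight (X + L.+1%:R)) (X + L%:R) iX.
have -> : \int[mu]_(y in `[X, X + L.+1%:R]) f y =
    \int[mu]_(y in `[X, X + L%:R]) f y + \int[mu]_(y in `[X + L%:R, X + L.+1%:R]) f y.
  rewrite -(@Rintegral_itv_obnd_cbnd _ (X + L%:R) (BRight (X + L.+1%:R))).
    by rewrite -E ?bnd_simp//; ring.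
  apply: integrableS iX => // y /=; rewrite !in_itv /= => /andP[h1 ->]; rewrite andbT ltW//.
  exact: le_lt_trans h1.
have -> : `[X + L%:R, X + L.+1%:R]%classic = `[0 + (X + L%:R), 1 + (X + L%:R)]%classic :> set R.
  by rewrite add0r -natr1 addrA [X + L%:R + 1]addrC.
rewrite (@Rintegral_shift _ f 0 1 (X + L%:R) B)//; last first.
  move=> x; rewrite add0r => /andP[h1 h2]; apply: fB; rewrite (le_trans XL h1)/=.
  by rewrite (le_trans h2)// -natr1; lra.
rewrite IH// -RintegralD//.
- apply: eq_Rintegral => x _; rewrite big_ord_recr /=; congr (_ + f _); ring.
- have [] // := @Rintegral_sum R `[0, 1] _ (index_enum 'I_L) (fun (l : 'I_L) x => f (X + x + l%:R)) _ _.
  by move=> l; apply: if1; rewrite ltnS ltnW.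
- rewrite (_ : (fun x => _) = fun x => f (X + x + L%:R)); first exact: if1.
  by apply/funext => x; congr f; ring.
Qed.

Lemma mid_subset : (`[4^-1, 3 / 4]%classic : set R) `<=` `[0, 1]%classic.
Proof. by move=> y /=; rewrite !in_itv /= => /andP[h1 h2]; apply/andP; split; lra. Qed.

Lemma mid_length : fine (mu `[4^-1, 3 / 4]) = 2^-1.
Proof. by rewrite lebesgue_itv; lra. Qed.

(** If W were large on the middle halves of all K unit intervals of [K, 2K], a set of measure K/2,
    its integral would be at least 2 (C + 1) (2K)^(1 + 2b), against the bound C (2K)^(1 + 2b). This
    fixes the constant (C + 1) 2^(3 + 2b); the middle halves keep X at distance at least 1/4 from
    the integers. *)
Lemma good_point (W : R -> R) (b C : R) : measurable_fun setT W -> (forall y, 0 <= W y) ->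
  (forall x, exists B, forall y, 1 <= y <= x -> `|W y| <= B) -> 0 <= b -> 0 <= C ->
  (forall x : R, 1 <= x -> (\int[mu]_(y in `[1%R, x]) (W y)%:E <= (C * x `^ (1 + 2 * b))%:E)%E) ->
  forall K : nat, (0 < K)%N -> exists (m : nat) (X : R),
    [/\ (K <= m)%N, (m < 2 * K)%N, m%:R + 4^-1 <= X, X <= m%:R + 3 / 4 &
        W X <= (C + 1) * 2 `^ (3 + 2 * b) * X `^ (2 * b)].
Proof.
move=> mW W0 Wb b0 C0 HC K K0; apply: contrapT => no.
set M := (C + 1) * 2 `^ (3 + 2 * b).
have M0 : 0 < M by rewrite mulr_gt0 ?powR_gt0//; lra.
have K1 : 1 <= K%:R :> R by rewrite ler1n.
have Kp : 0 < K%:R :> R by rewrite ltr0n.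
have big (l : nat) x : (l < K)%N -> 4^-1 <= x -> x <= 3 / 4 -> M * K%:R `^ (2 * b) <= W (K%:R + x + l%:R).
  move=> lK x1 x2; rewrite leNgt; apply/negP => h; apply: no.
  exists (K + l)%N, (K%:R + x + l%:R); rewrite natrD; split.
  - by rewrite leq_addr.
  - by rewrite mul2n -addnn ltn_add2l.
  - lra.
  - lra.
  - apply: (le_trans (ltW h)); rewrite -/M ler_wpM2l ?(ltW M0)//.
    have l0 : 0 <= l%:R :> R by [].
    by apply: ge0_ler_powR; rewrite ?nnegrE ?mulr_ge0//; lra.
have [B HB] := Wb (K%:R + K%:R).
have HB' y : K%:R <= y <= K%:R + K%:R -> `|W y| <= B.
  by move=> /andP[h1 h2]; apply: HB; rewrite h2 (le_trans K1).
have E := Rintegral_unit_sum mW HB'.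
have up : \int[mu]_(y in `[K%:R, K%:R + K%:R]) W y <= C * (2 * K%:R) `^ (1 + 2 * b).
  have iW : mu.-integrable `[K%:R, K%:R + K%:R] (EFin \o W).
    by apply: (@integrable_bounded _ _ _ _ B) => //; exact: measurable_funTS.
  rewrite -lee_fin /Rintegral fineK; last exact: (integrable_fin_num _ iW).
  have K2 : 1 <= 2 * K%:R :> R by lra.
  apply: le_trans (HC _ K2); apply: ge0_subset_integral => //.
  - by apply: measurable_funTS; apply/measurable_EFinP.
  - by move=> y _; rewrite lee_fin.
  - move=> y /=; rewrite !in_itv /= => /andP[h1 h2]; apply/andP; split; first exact: le_trans h1.
    by apply: (le_trans h2); lra.
pose h x := \sum_(l < K) W (K%:R + x + l%:R).
have h0 x : 0 <= h x by apply: sumr_ge0.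
have mh : measurable_fun setT h.
  by apply: measurable_sum => l; exact: measurable_comp_fun mW (measurable_shift _ _).
have ih : mu.-integrable `[0, 1] (EFin \o h).
  apply: (@integrable_bounded _ _ _ _ (\sum_(l < K) B)); first exact: measurable_funTS.
  move=> x /andP[x0 x1]; apply: le_trans (ler_norm_sum _ _ _) _; apply: ler_sum => l _.
  have l0 : 0 <= l%:R :> R by [].
  have l1 : l.+1%:R <= K%:R :> R by rewrite ler_nat.
  move: l1; rewrite -[l.+1]addn1 natrD => l1; apply: HB'.
  by clear -x0 x1 l0 l1; apply/andP; split; lra.
have lo : K%:R * (M * K%:R `^ (2 * b)) / 2 <= \int[mu]_(x in `[0, 1]) h x.
  have sub := mid_subset.
  have ih2 : mu.-integrable `[4^-1, 3 / 4] (EFin \o h) by apply: integrableS ih.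
  apply: (@le_trans _ _ (\int[mu]_(x in `[4^-1, 3 / 4]) h x)).
    apply: (@le_trans _ _ (\int[mu]_(x in `[4^-1, 3 / 4]) (cst (K%:R * (M * K%:R `^ (2 * b))) x))).
      by rewrite Rintegral_cst// mid_length.
    apply: le_Rintegral => //.
      by apply: integrable_continuous => y _; exact: cst_continuous.
    move=> x /=; rewrite in_itv /= => /andP[x1 x2].
    rewrite mulr_natl -[X in _ *+ X]card_ord -sumr_const; apply: ler_sum => l _.
    exact: big.
  rewrite /Rintegral; apply: fine_le.
  - exact: integrable_fin_num.
  - exact: integrable_fin_num.
  - apply: ge0_subset_integral => //.
    + by apply: measurable_funTS; apply/measurable_EFinP.
    + by move=> x _; rewrite lee_fin.
have := le_trans lo (le_trans (eq_ind _ (fun z => z <= _) up _ E) (lexx _)).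
rewrite powRM// (_ : K%:R * (M * _) / 2 = (C + 1) * 2 `^ (1 + 2 * b) * 2 * (K%:R `^ (1 + 2 * b))); last first.
  rewrite /M (_ : 3 + 2 * b = 2 + (1 + 2 * b)); last by ring.
  rewrite (@powRD _ K%:R) ?(gt_eqF Kp) ?implybT// powRr1 ?(ltW Kp)//.
  by rewrite (@powRD _ 2 2) ?pnatr_eq0 ?implybT// (powR_mulrn 2)//; field.
set u := 2 `^ _; set v := K%:R `^ _ => h1.
have u0 : 0 < u by exact: powR_gt0.
have v0 : 0 < v by exact: powR_gt0.
have uv : 0 < u * v by rewrite mulr_gt0.
move: h1; rewrite -subr_ge0 (_ : _ - _ = (- (C + 2)) * (u * v)); last by ring.
by rewrite pmulr_lge0//; clear -C0; lra.
Qed.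

Lemma diag_le (T X y H e G : R) : T <= X -> 1 <= X -> X <= y -> e <= H -> 1 <= H -> 0 <= G ->
  (T - 1) * G + 6 * e * (G * y) <= 7 * H * (G * y).
Proof.
move=> TX X1 Xy eH H1 G0; have Gy : 0 <= G * y by rewrite mulr_ge0//; lra.
have a1 : (T - 1) * G <= H * (G * y).
  apply: (@le_trans _ _ (G * y)); first by rewrite mulrC ler_wpM2l//; lra.
  by rewrite ler_peMl.
have a2 : e * (G * y) <= H * (G * y) by rewrite ler_wpM2r.
by rewrite -!mulrA; lra.
Qed.

Section TailMeanSquare.
Variables (g : R -> R) (X B T H : R) (L : nat).
Hypothesis mg : measurable_fun setT g.
Hypothesis gB : forall y, X <= y <= X + L%:R -> `|g y| <= B.
Hypothesis X1 : 1 <= X.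
Hypothesis TX : T <= X.
Hypothesis HL : harm L <= H.
Hypothesis H1 : 1 <= H.

(** Here [tr] is cos or sin, so one argument serves both components. Since T <= X <= y, the diagonal
    (T - 1) g(y)^2 is of no larger order than the off-diagonal bound, whence 7 = 6 + 1. *)
Lemma tail_mean_square (tr : R -> R) : (forall x, `|tr x| <= 1) -> continuous tr ->
  (forall y0 : R, 1 <= y0 -> forall a : nat -> R,
    \int[mu]_(t in `[1, T]) ((\sum_(l < L) a l * tr (t * ln (y0 + l%:R))) ^+ 2) <=
    (T - 1) * \sum_(l < L) a l ^+ 2 + 6 * harm L * \sum_(l < L) a l ^+ 2 * (y0 + l%:R)) ->
  mu.-integrable `[1, T] (EFin \o (fun t => (\int[mu]_(y in `[X, X + L%:R]) (g y * tr (t * ln y))) ^+ 2)) /\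
  \int[mu]_(t in `[1, T]) ((\int[mu]_(y in `[X, X + L%:R]) (g y * tr (t * ln y))) ^+ 2) <=
  7 * H * \int[mu]_(y in `[X, X + L%:R]) (g y ^+ 2 * y).
Proof.
move=> tr1 ctr ms.
have H70 : 0 <= 7 * H by rewrite mulr_ge0// (le_trans ler01).
have mtr : measurable_fun setT tr by exact: continuous_measurable_fun.
pose f (x t : MR) : R := \sum_(l < L) g (X + x + l%:R) * tr (t * ln (X + x + l%:R)).
have B0 : 0 <= B.
  by apply: (le_trans (normr_ge0 (g X))); apply: gB; rewrite lexx /= lerDl.
have inr x (l : 'I_L) : 0 <= x -> x <= 1 -> X <= X + x + l%:R <= X + L%:R.
  move=> x0 x1; have l0 : 0 <= l%:R :> R by [].
  have l1 : l.+1%:R <= L%:R :> R by rewrite ler_nat.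
  by move: l1; rewrite -[l.+1]addn1 natrD => l1; apply/andP; split; lra.
have E t : \int[mu]_(y in `[X, X + L%:R]) (g y * tr (t * ln y)) = \int[mu]_(x in `[0, 1]) f x t.
  apply: (@Rintegral_unit_sum (fun y => g y * tr (t * ln y)) X B L).
    apply: measurable_funM => //; apply: (measurable_comp_fun mtr).
    by apply: measurable_funM => //; exact: measurable_ln.
  by move=> y /gB h; rewrite normrM -[leRHS]mulr1 ler_pM.
pose W y := g y ^+ 2 * y.
pose h x := \sum_(l < L) (7 * H * W (X + x + l%:R)).
have mW : measurable_fun setT W by apply: measurable_funM => //; exact: measurable_funX.
have WB y : X <= y <= X + L%:R -> `|7 * H * W y| <= 7 * H * (B ^+ 2 * (X + L%:R)).
  move=> hy; have /andP[y1 y2] := hy; have y0 : 0 <= y by exact: le_trans (le_trans ler01 X1) y1.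
  rewrite normrM (ger0_norm H70) ler_wpM2l//.
  rewrite /W normrM normrX (ger0_norm y0) ler_pM ?exprn_ge0//.
  by rewrite lerXn2r ?nnegrE// gB.
have mHW : measurable_fun setT (fun y => 7 * H * W y) by apply: measurable_funM.
have hE : \int[mu]_(x in `[0, 1]) h x = 7 * H * \int[mu]_(y in `[X, X + L%:R]) W y.
  rewrite -(Rintegral_unit_sum mHW WB) RintegralZl//.
  apply: (@integrable_bounded _ _ _ _ (B ^+ 2 * (X + L%:R))); first exact: measurable_funTS.
  move=> y hy; have /andP[y1 y2] := hy; have y0 : 0 <= y by exact: le_trans (le_trans ler01 X1) y1.
  rewrite /W normrM normrX (ger0_norm y0) ler_pM ?exprn_ge0//.
  by rewrite lerXn2r ?nnegrE// gB.
have mh : measurable_fun setT h.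
  by apply: measurable_sum => l; exact: (measurable_comp_fun mHW (measurable_shift _ _)).
have ih : mu.-integrable `[0, 1] (EFin \o h).
  apply: (@integrable_bounded _ _ _ _ (\sum_(l < L) (7 * H * (B ^+ 2 * (X + L%:R))))).
    exact: measurable_funTS.
  move=> x /andP[x0 x1]; apply: le_trans (ler_norm_sum _ _ _) _; apply: ler_sum => l _.
  by apply: WB; exact: inr.
have mf : measurable_fun setT (fun p : MR * MR => f p.1 p.2).
  apply: measurable_sum => l.
  have ms1 : measurable_fun setT (fun p : MR * MR => (X + p.1 + l%:R : R)).
    by apply: measurable_funD => //; apply: measurable_funD.
  apply: measurable_funM; first exact: measurable_comp_fun mg ms1.
  apply: measurable_comp_fun mtr _; apply: measurable_funM => //.
  exact: measurable_comp_fun (@measurable_ln R) ms1.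
have [||i1 i2] := @mean_square_average R f 1 T (\sum_(l < L) B) h mf _ ih.
- move=> x t /andP[x0 x1] _; apply: le_trans (ler_norm_sum _ _ _) _; apply: ler_sum => l _.
  by rewrite normrM -[leRHS]mulr1 ler_pM// gB// inr.
- move=> x /andP[x0 x1]; have Xx : 1 <= X + x by rewrite (le_trans X1)// lerDl.
  apply: le_trans (ms (X + x) Xx (fun l => g (X + x + l%:R))) _.
  rewrite mulr_sumr mulr_sumr -big_split /=; apply: ler_sum => l _.
  have /andP[y1 y2] := inr x l x0 x1; set y := X + x + l%:R in y1 y2 *.
  rewrite /W; apply: (@diag_le T X) => //; exact: sqr_ge0.
have E' : (fun t => (\int[mu]_(y in `[X, X + L%:R]) (g y * tr (t * ln y))) ^+ 2) =
    (fun t => (\int[mu]_(x in `[0, 1]) f x t) ^+ 2) by apply/funext => t; rewrite E.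
by rewrite E' -hE.
Qed.

End TailMeanSquare.
End UnitShifts.

(** * The second moment of the decomposition *)

Section SecondMoment.
Context {R : realType}.
Notation mu := (@lebesgue_measure R).
Local Notation MR := (measurableTypeR R).

Lemma split_le (p q r s : R) : 0 <= p -> 0 <= q -> p + q - r <= s -> p <= r + s /\ q <= r + s.
Proof. by move=> *; split; lra. Qed.

(** The pointwise bound for |B + E + q|^2, with E = (sg + i t)(fc - i fs), |sg + i t|^2 <= 2 T^2 and
    q = x + i y. As t >= 1, the square of Q/t is at most Q^2/t, which integrates to a logarithm. *)
Lemma sqr_sum3_le (sg t T c0 Q C D fc fs x y : R) : 0 <= sg -> sg <= 1 -> 1 <= t -> t <= T ->
  C ^+ 2 + D ^+ 2 = 1 -> `|x| <= Q / t -> `|y| <= Q / t ->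
  (c0 * C + (sg * fc + t * fs) + x) ^+ 2 + (- (c0 * D) + (t * fc - sg * fs) + y) ^+ 2 <=
  3 * (c0 ^+ 2 * 1) + (3 * (2 * T ^+ 2) * (fc ^+ 2 + fs ^+ 2) + 3 * (2 * Q ^+ 2) * t^-1).
Proof.
move=> sg0 sg1 t1 tT cd q1 q2; have tp : 0 < t by lra.
have Qt : 0 <= Q / t by apply: le_trans q1.
have Qsq : (Q / t) ^+ 2 <= Q ^+ 2 * t^-1.
  rewrite exprMn ler_wpM2l ?sqr_ge0// expr2 ler_piMl ?invr_ge0 ?(ltW tp)//.
  by rewrite invf_le1.
have sx (z : R) : `|z| <= Q / t -> z ^+ 2 <= Q ^+ 2 * t^-1.
  move=> hz; apply: le_trans Qsq; rewrite -real_normK ?num_real//.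
  by apply: lerXn2r; rewrite ?nnegrE.
have s1 := sx _ q1; have s2 := sx _ q2.
have sq3 (a b c : R) : (a + b + c) ^+ 2 <= 3 * (a ^+ 2 + b ^+ 2 + c ^+ 2).
  rewrite -subr_ge0 (_ : _ - _ = (a - b) ^+ 2 + (b - c) ^+ 2 + (a - c) ^+ 2); last by ring.
  by rewrite !addr_ge0 ?sqr_ge0.
have r1 := sq3 (c0 * C) (sg * fc + t * fs) x.
have r2 := sq3 (- (c0 * D)) (t * fc - sg * fs) y.
have r3 : (c0 * C) ^+ 2 + (- (c0 * D)) ^+ 2 = c0 ^+ 2 * 1 by rewrite -cd; ring.
have r4 : (sg * fc + t * fs) ^+ 2 + (t * fc - sg * fs) ^+ 2 = (sg ^+ 2 + t ^+ 2) * (fc ^+ 2 + fs ^+ 2) by ring.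
have r5 : (sg ^+ 2 + t ^+ 2) * (fc ^+ 2 + fs ^+ 2) <= 2 * T ^+ 2 * (fc ^+ 2 + fs ^+ 2).
  rewrite ler_wpM2r ?addr_ge0 ?sqr_ge0//.
  have e1 : sg ^+ 2 <= T ^+ 2 by rewrite lerXn2r ?nnegrE//; lra.
  have e2 : t ^+ 2 <= T ^+ 2 by rewrite lerXn2r ?nnegrE//; lra.
  lra.
apply: le_trans (lerD r1 r2) _; rewrite -mulrDr.
rewrite [leRHS](_ : _ = 3 * (c0 ^+ 2 * 1 + 2 * T ^+ 2 * (fc ^+ 2 + fs ^+ 2) + (Q ^+ 2 * t^-1 + Q ^+ 2 * t^-1))); last by ring.
rewrite ler_wpM2l//.
rewrite [leLHS](_ : _ = ((c0 * C) ^+ 2 + (- (c0 * D)) ^+ 2) +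
  ((sg * fc + t * fs) ^+ 2 + (t * fc - sg * fs) ^+ 2) + (x ^+ 2 + y ^+ 2)); last by ring.
by rewrite r3 r4; apply: lerD (lerD s1 s2); rewrite lerD2l.
Qed.

Lemma quad_total (c0 T H G2 Q l x y : R) : x <= 7 * H * G2 -> y <= 7 * H * G2 ->
  3 * (c0 ^+ 2 * 1) * (T - 1) + (3 * (2 * T ^+ 2) * (x + y) + 3 * (2 * Q ^+ 2) * l) <=
  3 * (c0 ^+ 2 * T + 28 * H * T ^+ 2 * G2 + 2 * Q ^+ 2 * l).
Proof.
move=> hx hy; have T20 : 0 <= 6 * T ^+ 2 by rewrite mulr_ge0 ?sqr_ge0.
have h1 := ler_wpM2l T20 (lerD hx hy); have h2 : 0 <= c0 ^+ 2 by exact: sqr_ge0.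
rewrite -subr_ge0 (_ : _ - _ = 3 * c0 ^+ 2 + (6 * T ^+ 2 * (7 * H * G2 + 7 * H * G2) - 6 * T ^+ 2 * (x + y))); last by ring.
by apply: addr_ge0; [rewrite mulr_ge0|rewrite subr_ge0].
Qed.

(** By [inv_ln_gap] a term is at most 1/(l+1) + 1/(y - l - 1), and y >= M + 1/4 gives y - l - 1 >=
    (M - l)/4, also for the last index l = M - 1. The two sums are [harm M] and 4 [harm M]. *)
Lemma inv_gap_sum (M : nat) (y : R) : M%:R + 4^-1 <= y ->
  \sum_(l < M) l.+1%:R^-1 * (ln y - ln (1 + l%:R))^-1 <= 5 * harm M.
Proof.
move=> My; rewrite (_ : 5 * harm M = harm M + 4 * harm M); last by ring.
have E : harm M = \sum_(l < M) (M%:R - l%:R)^-1 :> R.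
  rewrite /harm (reindex_inj rev_ord_inj); apply: eq_bigr => l _ /=.
  by rewrite -natr1 natrB// -natr1; congr _^-1; ring.
rewrite {2}E {1}/harm mulr_sumr -big_split /=.
apply: ler_sum => l _; rewrite -[l.+1%:R]natr1 [l%:R + 1]addrC.
have l0 : 0 <= l%:R :> R by [].
have lM : l.+1%:R <= M%:R :> R by rewrite ler_nat.
move: lM; rewrite -[l.+1]addn1 natrD => lM.
have x0 : 0 < 1 + l%:R :> R by lra.
have d0 : 0 < y - (1 + l%:R) by lra.
have h := inv_ln_gap x0 (_ : 1 + l%:R < y).
apply: le_trans (ler_wpM2l _ (h _)) _; [by rewrite invr_ge0 ltW|lra|].
rewrite mulrDr mulr1 lerD2l mulrA mulVf ?gt_eqF// mul1r.
rewrite (_ : 4 * _ = ((M%:R - l%:R) / 4)^-1); last by field; rewrite gt_eqF//; lra.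
by rewrite lef_pV2 ?posrE//; lra.
Qed.

Lemma continuous_sum_ord n (F : nat -> R -> R) (t : R) :
  (forall i, {for t, continuous (F i)}) -> {for t, continuous (fun x => \sum_(i < n) F i x)}.
Proof.
move=> cF; elim: n => [|n IH].
  by rewrite (_ : (fun x => _) = cst 0); [exact: cst_continuous|apply/funext => x; rewrite big_ord0].
rewrite (_ : (fun x => _) = (fun x => \sum_(i < n) F i x) + F n).
  by apply: continuousD; [exact: IH|exact: cF].
by apply/funext => x; rewrite big_ord_recr.
Qed.

Lemma int_inv (T : R) : 1 <= T -> mu.-integrable `[1, T] (EFin \o (fun t : R => t^-1)) /\
  \int[mu]_(t in `[1, T]) t^-1 = ln T.
Proof.
move=> T1.
have c y : 1 <= y <= T -> {for y, continuous (fun t : R => t^-1)}.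
  by move=> /andP[y1 _]; apply: inv_continuous; rewrite gt_eqF//; lra.
split; first exact: integrable_continuous.
have d y : 1 <= y <= T -> is_derive y 1 (@ln R) y^-1.
  by move=> /andP[y1 _]; apply: is_derive1_ln; lra.
by rewrite (@FTC _ (@ln R) (fun t => t^-1) 1 T T1 d c) ln1 subr0.
Qed.

(** Together with [ssum], the components of a Dirichlet polynomial: [csum - i ssum] is the sum of
    a_l (l+1)^(-it). *)
Definition csum (a : nat -> R) M t := \sum_(l < M) a l * cos (t * ln (1 + l%:R)).
Definition ssum (a : nat -> R) M t := \sum_(l < M) a l * sin (t * ln (1 + l%:R)).

Lemma continuous_csum a M t : {for t, continuous (csum a M)}.
Proof.
apply: (@continuous_sum_ord M (fun l t => a l * cos (t * ln (1 + l%:R)))) => l.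
by apply: continuousM; [exact: cst_continuous|exact: continuous_cosM].
Qed.

Lemma continuous_ssum a M t : {for t, continuous (ssum a M)}.
Proof.
apply: (@continuous_sum_ord M (fun l t => a l * sin (t * ln (1 + l%:R)))) => l.
by apply: continuousM; [exact: cst_continuous|exact: der_continuous (der_sinM _ _)].
Qed.

Lemma csum_shift (a : nat -> R) M (t v : R) : \sum_(l < M) a l * cos (t * (v - ln (1 + l%:R))) =
  cos (t * v) * csum a M t + sin (t * v) * ssum a M t.
Proof.
rewrite !mulr_sumr -big_split /=; apply: eq_bigr => l _.
by rewrite mulrBr cosB; ring.
Qed.

Lemma ssum_shift (a : nat -> R) M (t v : R) : \sum_(l < M) a l * sin (t * (v - ln (1 + l%:R))) =
  sin (t * v) * csum a M t - cos (t * v) * ssum a M t.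
Proof.
rewrite !mulr_sumr -sumrB; apply: eq_bigr => l _.
by rewrite mulrBr sinB; ring.
Qed.

Variables (a : nat -> R) (M : nat) (X T S sg : R).
Hypothesis a0 : forall l, 0 <= a l.
Hypothesis MX : M%:R < X.
Hypothesis X1 : 1 <= X.
Hypothesis T1 : 1 <= T.
Hypothesis sg0 : 0 <= sg.
Hypothesis sg1 : sg <= 1.
Hypothesis HS : forall y : R, X <= y -> \sum_(l < M) a l * (ln y - ln (1 + l%:R))^-1 <= S.

Lemma gap_gt0 (y : R) (l : 'I_M) : X <= y -> 0 < ln y - ln (1 + l%:R).
Proof.
move=> Xy; have l0 : 0 <= l%:R :> R by [].
have lM : l.+1%:R <= M%:R :> R by rewrite ler_nat.
move: lM; rewrite -[l.+1]addn1 natrD => lM.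
have p1 : 0 < 1 + l%:R :> R by lra.
have p2 : 0 < y by exact: lt_le_trans (lt_le_trans ltr01 X1) Xy.
have MX' := MX.
by rewrite subr_gt0 ltr_ln ?posrE//; lra.
Qed.

Lemma cross_point (y : R) : X <= y ->
  `|\int[mu]_(t in `[1, T]) (\sum_(l < M) a l * cos (t * (ln y - ln (1 + l%:R))))| <= 2 * S.
Proof.
move=> Xy.
have i1 (l : 'I_M) : mu.-integrable `[1, T] (EFin \o (fun t => a l * cos (t * (ln y - ln (1 + l%:R))))).
  by apply: integrableMl => //; exact: integrable_cosM.
have -> : \int[mu]_(t in `[1, T]) (\sum_(l < M) a l * cos (t * (ln y - ln (1 + l%:R)))) =
    \sum_(l < M) \int[mu]_(t in `[1, T]) (a l * cos (t * (ln y - ln (1 + l%:R)))).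
  by rewrite (@Rintegral_sum R `[1, T] _ (index_enum 'I_M) (fun (l : 'I_M) t => a l * cos (t * (ln y - ln (1 + l%:R)))) (measurable_itv _) i1).2.
apply: le_trans (ler_norm_sum _ _ _) _; apply: le_trans (ler_wpM2l _ (HS Xy)) => //.
rewrite mulr_sumr; apply: ler_sum => l _.
rewrite RintegralZl//; last exact: integrable_cosM.
have g0 := gap_gt0 l Xy.
rewrite normrM ger0_norm// mulrCA ler_wpM2l//.
by rewrite -{2}(gtr0_norm g0); apply: int_cos_le => //; rewrite gt_eqF.
Qed.

(** With lambda = ln y - ln(1 + l), sg cos(t lambda) + t sin(t lambda) is the real part of (sg + i
    t) exp(-i t lambda). Integrating over t costs 2/lambda for the first part and 2T/lambda for the
    second, a factor T instead of the trivial T^2. *)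
Lemma cross_kernel (y : R) : X <= y ->
  `|\int[mu]_(t in `[1, T]) (\sum_(l < M) a l *
     (sg * cos (t * (ln y - ln (1 + l%:R))) + t * sin (t * (ln y - ln (1 + l%:R)))))| <= 4 * T * S.
Proof.
move=> Xy; pose lam (l : nat) := ln y - ln (1 + l%:R).
pose u l t := sg * cos (t * lam l) + t * sin (t * lam l).
have ic l : mu.-integrable `[1, T] (EFin \o (fun t => sg * cos (t * lam l))).
  by apply: integrableMl => //; exact: integrable_cosM.
have isn l : mu.-integrable `[1, T] (EFin \o (fun t => t * sin (t * lam l))).
  by apply: integrable_continuous => t _; exact: continuous_tsinM.
have iu l : mu.-integrable `[1, T] (EFin \o u l) by exact: integrableDr.
have i1 (l : 'I_M) : mu.-integrable `[1, T] (EFin \o (fun t => a l * u l t)) by exact: integrableMl.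
rewrite -/(lam _); have -> : \int[mu]_(t in `[1, T]) (\sum_(l < M) a l * u l t) =
    \sum_(l < M) \int[mu]_(t in `[1, T]) (a l * u l t).
  by rewrite (@Rintegral_sum R `[1, T] _ (index_enum 'I_M) (fun (l : 'I_M) t => a l * u l t) (measurable_itv _) i1).2.
have T40 : 0 <= 4 * T by rewrite mulr_ge0// (le_trans ler01).
apply: le_trans (ler_norm_sum _ _ _) _; apply: le_trans (ler_wpM2l T40 (HS Xy)).
rewrite mulr_sumr; apply: ler_sum => l _.
rewrite RintegralZl// normrM ger0_norm// mulrCA ler_wpM2l//.
have g0 : 0 < lam l := gap_gt0 l Xy.
rewrite /u RintegralD// RintegralZl//; last exact: integrable_cosM.
apply: le_trans (ler_normD _ _) _.
have h1 := int_cos_le T1 (lt0r_neq0 g0); have h2 := int_tsin_le ler01 T1 g0.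
rewrite (gtr0_norm g0) in h1; rewrite normrM (ger0_norm sg0) -/(lam l).
have h3 : sg * `|\int[mu]_(t in `[1, T]) cos (t * lam l)| <= 2 / lam l.
  by rewrite -[leRHS]mul1r ler_pM.
have h4 : 2 / lam l <= 2 * T / lam l by rewrite ler_wpM2r ?invr_ge0 ?(ltW g0)// ler_peMr.
have -> : 4 * T * (lam l)^-1 = 2 * T / lam l + 2 * T / lam l by ring.
lra.
Qed.

Variables (g : R -> R) (B : R) (L : nat).
Hypothesis mg : measurable_fun setT g.
Hypothesis gB : forall y : R, X <= y <= X + L%:R -> `|g y| <= B.
Notation I := (`[X, X + L%:R]%classic : set R).
Notation Fc t := (\int[mu]_(y in I) (g y * cos (t * ln y))).
Notation Fs t := (\int[mu]_(y in I) (g y * sin (t * ln y))).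

(** The real part of A times the conjugate of E, for A = csum - i ssum and E = (sg + i t)(Fc - i
    Fs). *)
Definition cross_E t := csum a M t * (sg * Fc t + t * Fs t) - ssum a M t * (t * Fc t - sg * Fs t).

Lemma integrable_gtr (tr : R -> R) (t : R) : continuous tr -> (forall x, `|tr x| <= 1) ->
  mu.-integrable I (EFin \o (fun y => g y * tr (t * ln y))).
Proof.
move=> ctr tr1; have mtr : measurable_fun setT tr by exact: continuous_measurable_fun.
apply: (@integrable_bounded _ _ _ _ B).
  apply: measurable_funTS; apply: measurable_funM => //; apply: (measurable_comp_fun mtr).
  by apply: measurable_funM => //; exact: measurable_ln.
by move=> y /gB h; rewrite normrM -[leRHS]mulr1 ler_pM.
Qed.

(** Fubini makes t the inner variable, where [cross_kernel] applies uniformly in y >= X; only the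
    L^1 norm of g remains. *)
Lemma cross_tail : mu.-integrable `[1, T] (EFin \o cross_E) /\
  `|\int[mu]_(t in `[1, T]) cross_E t| <= 4 * T * S * \int[mu]_(y in I) `|g y|.
Proof.
pose u (t y : R) := \sum_(l < M) a l *
     (sg * cos (t * (ln y - ln (1 + l%:R))) + t * sin (t * (ln y - ln (1 + l%:R)))).
pose f (t y : MR) : R := g y * u t y.
have B0 : 0 <= B by apply: (le_trans (normr_ge0 (g X))); apply: gB; rewrite lexx /= lerDl.
have uE t y : u t y = cos (t * ln y) * (sg * csum a M t - t * ssum a M t) +
    sin (t * ln y) * (sg * ssum a M t + t * csum a M t).
  rewrite /u; under eq_bigr do rewrite mulrDr ![a _ * (_ * _)]mulrCA.
  by rewrite big_split /= -!mulr_sumr csum_shift ssum_shift; ring.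
have EE t : \int[mu]_(y in I) f t y = cross_E t.
  have ic := @integrable_gtr (@cos R) t (@continuous_cos R) (@cos_abs_le1 R).
  have isn := @integrable_gtr (@sin R) t (@continuous_sin R) (@sin_abs_le1 R).
  set p := sg * csum a M t - t * ssum a M t; set q := sg * ssum a M t + t * csum a M t.
  rewrite (@eq_Rintegral _ _ _ mu _ (fun y => p * (g y * cos (t * ln y)) + q * (g y * sin (t * ln y)))); last first.
    by move=> y _; rewrite /f uE -/p -/q; ring.
  rewrite RintegralD ?RintegralZl//; try exact: integrableMl.
  by rewrite /cross_E /p /q; ring.
have mf : measurable_fun setT (fun p : MR * MR => f p.1 p.2).
  apply: measurable_funM; first exact: measurable_comp_fun mg (measurable_snd).
  apply: measurable_sum => l; apply: measurable_funM => //.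
  have ml : measurable_fun setT (fun p : MR * MR => (p.1 * (ln p.2 - ln (1 + l%:R)) : R)).
    apply: measurable_funM => //; apply: measurable_funB => //.
    exact: measurable_comp_fun (@measurable_ln R) (measurable_snd).
  have mc : measurable_fun setT (@cos R) by apply: continuous_measurable_fun; exact: continuous_cos.
  have ms : measurable_fun setT (@sin R) by apply: continuous_measurable_fun; exact: continuous_sin.
  apply: measurable_funD; apply: measurable_funM => //; [exact: measurable_comp_fun mc ml|exact: measurable_comp_fun ms ml].
pose A := \sum_(l < M) a l * (1 + T).
have fB t y : 1 <= t <= T -> X <= y <= X + L%:R -> `|f t y| <= B * A.
  move=> /andP[t1 tT] hy; rewrite normrM ler_pM ?gB//.
  apply: le_trans (ler_norm_sum _ _ _) _; apply: ler_sum => l _.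
  rewrite normrM ger0_norm// ler_wpM2l//; apply: le_trans (ler_normD _ _) _.
  rewrite !normrM (ger0_norm sg0) (ger0_norm (le_trans ler01 t1)).
  apply: lerD; first by rewrite -[leRHS]mul1r ler_pM// cos_abs_le1.
  by rewrite -[leRHS]mulr1 ler_pM// ?sin_abs_le1//; lra.
have [i1 i2 E] := rect_fubini mf fB.
have XL : X <= X + L%:R by rewrite lerDl.
have igB : mu.-integrable I (EFin \o (fun y => `|g y|)).
  apply: (@integrable_bounded _ _ _ _ B); first by apply: measurable_funTS; apply: measurableT_comp.
  by move=> y /gB; rewrite normr_id.
have e1 : (fun t => \int[mu]_(y in I) f t y) = cross_E by apply/funext => t; exact: EE.
move: i1 E; rewrite e1 => i1 E; split => //; rewrite E.
apply: le_trans (le_normr_Rintegral _ i2) _ => //.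
rewrite -RintegralZl//; apply: le_Rintegral => //.
- exact: (integrable_norm i2).
- exact: integrableMl.
- move=> y; rewrite /= in_itv /= => /andP[y1 y2]; rewrite /f.
  rewrite RintegralZl//; last first.
    apply: integrable_continuous => t _.
    apply: (@continuous_sum_ord M (fun l t => a l * (sg * cos (t * (ln y - ln (1 + l%:R))) + t * sin (t * (ln y - ln (1 + l%:R)))))) => l.
    apply: continuousM; first exact: cst_continuous.
    apply: continuousD; last exact: continuous_tsinM.
    by apply: continuousM; [exact: cst_continuous|exact: continuous_cosM].
  by rewrite normrM mulrC ler_wpM2r// cross_kernel.
Qed.

Variables (H SA c0 Q : R) (zr zi qr qi : R -> R).
Hypothesis TX : T <= X.
Hypothesis HL : harm L <= H.
Hypothesis H1 : 1 <= H.
Hypothesis HSA : \sum_(l < M) a l <= SA.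
Hypothesis czr : forall t, 1 <= t <= T -> {for t, continuous zr}.
Hypothesis czi : forall t, 1 <= t <= T -> {for t, continuous zi}.
Hypothesis zrE : forall t, 1 <= t <= T ->
  zr t = csum a M t + c0 * cos (t * ln X) + (sg * Fc t + t * Fs t) + qr t.
Hypothesis ziE : forall t, 1 <= t <= T ->
  zi t = - ssum a M t - c0 * sin (t * ln X) + (t * Fc t - sg * Fs t) + qi t.
Hypothesis qrB : forall t, 1 <= t <= T -> `|qr t| <= Q / t.
Hypothesis qiB : forall t, 1 <= t <= T -> `|qi t| <= Q / t.

Lemma tail_squares : let G2 := \int[mu]_(y in I) (g y ^+ 2 * y) in
  [/\ mu.-integrable `[1, T] (EFin \o (fun t => Fc t ^+ 2)),
      mu.-integrable `[1, T] (EFin \o (fun t => Fs t ^+ 2)),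
      \int[mu]_(t in `[1, T]) (Fc t ^+ 2) <= 7 * H * G2 &
      \int[mu]_(t in `[1, T]) (Fs t ^+ 2) <= 7 * H * G2].
Proof.
move=> G2.
have ms (y0 : R) (v : nat -> R) : 1 <= y0 ->
  \int[mu]_(t in `[1, T]) ((\sum_(l < L) v l * cos (t * ln (y0 + l%:R))) ^+ 2) <=
    (T - 1) * \sum_(l < L) v l ^+ 2 + 6 * harm L * \sum_(l < L) v l ^+ 2 * (y0 + l%:R) /\
  \int[mu]_(t in `[1, T]) ((\sum_(l < L) v l * sin (t * ln (y0 + l%:R))) ^+ 2) <=
    (T - 1) * \sum_(l < L) v l ^+ 2 + 6 * harm L * \sum_(l < L) v l ^+ 2 * (y0 + l%:R).
  move=> y01; have := mean_square L v y01 T1.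
  set U := (fun t => \sum_(l < L) v l * cos (t * ln (y0 + l%:R))).
  set V := (fun t => \sum_(l < L) v l * sin (t * ln (y0 + l%:R))).
  have cU t : {for t, continuous U}.
    apply: (@continuous_sum_ord L (fun l t => v l * cos (t * ln (y0 + l%:R)))) => l.
    by apply: continuousM; [exact: cst_continuous|exact: continuous_cosM].
  have cV t : {for t, continuous V}.
    apply: (@continuous_sum_ord L (fun l t => v l * sin (t * ln (y0 + l%:R)))) => l.
    by apply: continuousM; [exact: cst_continuous|exact: der_continuous (der_sinM _ _)].
  have iU : mu.-integrable `[1, T] (EFin \o (fun t => U t ^+ 2)).
    by apply: integrable_continuous => t _; apply: continuousM.
  have iV : mu.-integrable `[1, T] (EFin \o (fun t => V t ^+ 2)).
    by apply: integrable_continuous => t _; apply: continuousM.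
  rewrite RintegralD// => /(le_trans (ler_norm _)).
  have p1 : 0 <= \int[mu]_(t in `[1, T]) (U t ^+ 2) by apply: Rintegral_ge0 => t _; exact: sqr_ge0.
  have p2 : 0 <= \int[mu]_(t in `[1, T]) (V t ^+ 2) by apply: Rintegral_ge0 => t _; exact: sqr_ge0.
  exact: split_le p1 p2.
have [i1 b1] := tail_mean_square mg gB X1 TX HL H1 (@cos_abs_le1 R) (@continuous_cos R)
  (fun y0 h v => (ms y0 v h).1).
have [i2 b2] := tail_mean_square mg gB X1 TX HL H1 (@sin_abs_le1 R) (@continuous_sin R)
  (fun y0 h v => (ms y0 v h).2).
by split.
Qed.

(** Expand |A + P|^2 with P = B + E + q. The mean square of A supplies the diagonal, P^2 is bounded
    by three separate squares, and in the mixed term B and E use the oscillation in t while q is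
    already O(1/t). *)
Lemma second_moment :
  `|\int[mu]_(t in `[1, T]) (zr t ^+ 2 + zi t ^+ 2) - (T - 1) * \sum_(l < M) a l ^+ 2| <=
  6 * harm M * \sum_(l < M) a l ^+ 2 * (1 + l%:R) +
  2 * (`|c0| * (2 * S) + 4 * T * S * \int[mu]_(y in I) `|g y| + 2 * SA * Q * ln T) +
  3 * (c0 ^+ 2 * T + 28 * H * T ^+ 2 * \int[mu]_(y in I) (g y ^+ 2 * y) + 2 * Q ^+ 2 * ln T).
Proof.
set G1 := \int[mu]_(y in I) `|g y|; set G2 := \int[mu]_(y in I) (g y ^+ 2 * y).
pose U t := csum a M t; pose W t := ssum a M t.
have cU t : {for t, continuous U} by exact: continuous_csum.
have cW t : {for t, continuous W} by exact: continuous_ssum.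
(* P is taken as the difference z - A, so that it inherits continuity from z. *)
pose pr t := zr t - U t; pose pi t := zi t + W t.
have cpr t : 1 <= t <= T -> {for t, continuous pr}.
  by move=> h; apply: continuousB; [exact: czr|exact: cU].
have cpi t : 1 <= t <= T -> {for t, continuous pi}.
  by move=> h; apply: continuousD; [exact: czi|exact: cW].
pose V t := U t * pr t - W t * pi t; pose P t := pr t ^+ 2 + pi t ^+ 2.
pose A2 t := U t ^+ 2 + W t ^+ 2.
have iA : mu.-integrable `[1, T] (EFin \o A2).
  by apply: integrable_continuous => t _; apply: continuousD; apply: continuousM.
have iV : mu.-integrable `[1, T] (EFin \o V).
  apply: integrable_continuous => t ht; apply: continuousB; apply: continuousM => //.
    exact: cpr. exact: cpi.
have iP : mu.-integrable `[1, T] (EFin \o P).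
  apply: integrable_continuous => t ht; apply: continuousD; apply: continuousM => //; [exact: cpr|exact: cpr|exact: cpi|exact: cpi].
have iV2 : mu.-integrable `[1, T] (EFin \o (fun t => 2 * V t)) by exact: integrableMl.
have -> : \int[mu]_(t in `[1, T]) (zr t ^+ 2 + zi t ^+ 2) =
   \int[mu]_(t in `[1, T]) A2 t + 2 * \int[mu]_(t in `[1, T]) V t + \int[mu]_(t in `[1, T]) P t.
  rewrite -RintegralZl// -RintegralD// -RintegralD//; last exact: integrableDr.
  by apply: eq_Rintegral => t _; rewrite /A2 /V /P /pr /pi; ring.
have [iE bE] := cross_tail.
pose u1 t := c0 * \sum_(l < M) a l * cos (t * (ln X - ln (1 + l%:R))).
have iu0 : mu.-integrable `[1, T] (EFin \o (fun t => \sum_(l < M) a l * cos (t * (ln X - ln (1 + l%:R))))).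
  apply: integrable_continuous => t _.
  apply: (@continuous_sum_ord M (fun l t => a l * cos (t * (ln X - ln (1 + l%:R))))) => l.
  by apply: continuousM; [exact: cst_continuous|exact: continuous_cosM].
have iu1 : mu.-integrable `[1, T] (EFin \o u1) by exact: integrableMl.
(* The contribution of q, again introduced as a difference: nothing is assumed about the
   measurability of [qr] and [qi], whereas every term here is integrable. *)
pose u3 t := V t + (-1) * (u1 t + cross_E t).
have iu1E : mu.-integrable `[1, T] (EFin \o (fun t => u1 t + cross_E t)) by exact: integrableDr.
have iu3 : mu.-integrable `[1, T] (EFin \o u3) by apply: integrableDr => //; exact: integrableMl.
have VE : \int[mu]_(t in `[1, T]) V t =
    \int[mu]_(t in `[1, T]) u1 t + \int[mu]_(t in `[1, T]) cross_E t + \int[mu]_(t in `[1, T]) u3 t.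
  rewrite -RintegralD// -RintegralD//.
  by apply: eq_Rintegral => t _; rewrite /u3; ring.
have [iI eI] := int_inv T1.
have UB t : `|U t| <= SA.
  apply: le_trans HSA; apply: le_trans (ler_norm_sum _ _ _) _; apply: ler_sum => l _.
  by rewrite normrM ger0_norm// ler_piMr// cos_abs_le1.
have WB t : `|W t| <= SA.
  apply: le_trans HSA; apply: le_trans (ler_norm_sum _ _ _) _; apply: ler_sum => l _.
  by rewrite normrM ger0_norm// ler_piMr// sin_abs_le1.
have SA0 : 0 <= SA by apply: le_trans (UB 1).
have b3 : `|\int[mu]_(t in `[1, T]) u3 t| <= 2 * SA * Q * ln T.
  apply: le_trans (le_normr_Rintegral _ iu3) _ => //.
  rewrite -eI -RintegralZl//; apply: le_Rintegral => //.
  - exact: (integrable_norm iu3).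
  - exact: integrableMl.
  - move=> t; rewrite /= in_itv /= => ht; have /andP[t1 tT] := ht.
    have -> : u3 t = U t * qr t - W t * qi t.
      rewrite /u3 /V /pr /pi zrE// ziE// /u1 csum_shift /cross_E -/(U t) -/(W t); ring.
    apply: le_trans (ler_normB _ _) _; rewrite !normrM.
    have h1 : `|U t| * `|qr t| <= SA * (Q / t) by rewrite ler_pM// qrB.
    have h2 : `|W t| * `|qi t| <= SA * (Q / t) by rewrite ler_pM// qiB.
    rewrite (_ : 2 * SA * Q * t^-1 = SA * (Q / t) + SA * (Q / t)); last by ring.
    exact: lerD h1 h2.
have b1 : `|\int[mu]_(t in `[1, T]) u1 t| <= `|c0| * (2 * S).
  by rewrite /u1 RintegralZl// normrM ler_wpM2l// cross_point.
have [iFc iFs bFc bFs] := tail_squares.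
have bP : \int[mu]_(t in `[1, T]) P t <= 3 * (c0 ^+ 2 * T + 28 * H * T ^+ 2 * G2 + 2 * Q ^+ 2 * ln T).
  pose q t := 3 * (c0 ^+ 2 * 1) + (3 * (2 * T ^+ 2) * (Fc t ^+ 2 + Fs t ^+ 2) + 3 * (2 * Q ^+ 2) * t^-1).
  have icst : mu.-integrable `[1, T] (EFin \o (fun t : R => 3 * (c0 ^+ 2 * 1))).
    by apply: integrable_continuous => t _; exact: cst_continuous.
  have iFF : mu.-integrable `[1, T] (EFin \o (fun t => Fc t ^+ 2 + Fs t ^+ 2)) by exact: integrableDr.
  have iFF' : mu.-integrable `[1, T] (EFin \o (fun t => 3 * (2 * T ^+ 2) * (Fc t ^+ 2 + Fs t ^+ 2))).
    exact: integrableMl.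
  have iI' : mu.-integrable `[1, T] (EFin \o (fun t : R => 3 * (2 * Q ^+ 2) * t^-1)) by exact: integrableMl.
  have iq2 : mu.-integrable `[1, T] (EFin \o (fun t => 3 * (2 * T ^+ 2) * (Fc t ^+ 2 + Fs t ^+ 2) + 3 * (2 * Q ^+ 2) * t^-1)).
    exact: integrableDr.
  have iq : mu.-integrable `[1, T] (EFin \o q) by exact: integrableDr.
  apply: (@le_trans _ _ (\int[mu]_(t in `[1, T]) q t)).
    apply: le_Rintegral => // t; rewrite /= in_itv /= => ht; have /andP[t1 tT] := ht.
    rewrite /P /pr /pi zrE// ziE// -/(U t) -/(W t) /q.
    rewrite (_ : U t + _ + _ + _ - U t = c0 * cos (t * ln X) + (sg * Fc t + t * Fs t) + qr t); last by ring.
    rewrite (_ : - W t - _ + _ + _ + W t = - (c0 * sin (t * ln X)) + (t * Fc t - sg * Fs t) + qi t); last by ring.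
    by apply: sqr_sum3_le => //; rewrite ?cos2Dsin2// ?qrB ?qiB.
  have mI : measurable (`[1, T]%classic : set R) by exact: measurable_itv.
  pose q1 t := 3 * (2 * T ^+ 2) * (Fc t ^+ 2 + Fs t ^+ 2); pose q2 (t : R) := 3 * (2 * Q ^+ 2) * t^-1.
  have e1 : \int[mu]_(t in `[1, T]) q t = \int[mu]_(t in `[1, T]) (cst (3 * (c0 ^+ 2 * 1)) t) +
    \int[mu]_(t in `[1, T]) (q1 t + q2 t) by exact: RintegralD.
  have e2 : \int[mu]_(t in `[1, T]) (q1 t + q2 t) = \int[mu]_(t in `[1, T]) q1 t + \int[mu]_(t in `[1, T]) q2 t.
    exact: RintegralD.
  have e3 : \int[mu]_(t in `[1, T]) q1 t = 3 * (2 * T ^+ 2) *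
     \int[mu]_(t in `[1, T]) (Fc t ^+ 2 + Fs t ^+ 2) by exact: RintegralZl.
  have e4 : \int[mu]_(t in `[1, T]) (Fc t ^+ 2 + Fs t ^+ 2) =
    \int[mu]_(t in `[1, T]) (Fc t ^+ 2) + \int[mu]_(t in `[1, T]) (Fs t ^+ 2) by exact: RintegralD.
  have e5 : \int[mu]_(t in `[1, T]) q2 t = 3 * (2 * Q ^+ 2) * ln T by rewrite -eI; exact: RintegralZl.
  rewrite e1 e2 e3 e4 e5 Rintegral_cst// lebesgue_itv//.
  exact: quad_total.
have P0 : 0 <= \int[mu]_(t in `[1, T]) P t by apply: Rintegral_ge0 => t _; rewrite addr_ge0 ?sqr_ge0.
have bA := mean_square M a (lexx 1) T1; rewrite -/(A2) in bA.
rewrite (_ : _ + _ + _ - _ = (\int[mu]_(t in `[1, T]) A2 t - (T - 1) * \sum_(l < M) a l ^+ 2) +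
   2 * \int[mu]_(t in `[1, T]) V t + \int[mu]_(t in `[1, T]) P t); last by ring.
apply: le_trans (ler_normD _ _) _; apply: lerD; last by rewrite ger0_norm.
apply: le_trans (ler_normD _ _) _; apply: lerD => //.
rewrite normrM (ger0_norm (ler0n _ 2)) ler_wpM2l// VE.
apply: le_trans (ler_normD _ _) _; apply: lerD => //.
by apply: le_trans (ler_normD _ _) _; exact: lerD.
Qed.

End SecondMoment.

(** * Estimates at a fixed length *)

Section FixedLength.
Context {R : realType}.
Notation C := R[i].
Notation nc := (@Normc.normc R).
Notation mu := (@lebesgue_measure R).

(** With Y = X^(1 - sigma) and Zb = X^(b - sigma), the relation T Zb <= Y is the balance T X^b <= X.
    Each term is then at most H^4 Y^2 times its coefficient, and 6 + 20 + 40 + 8 + 3 + 84 + 24 =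
    185. *)
Lemma moment_total (H Y Zb T hM A2 c0 S G1 G2 SA Q l : R) :
  1 <= H -> 0 <= Y -> 0 <= T -> 0 <= hM -> 0 <= A2 -> 0 <= c0 -> 0 <= G1 -> 0 <= G2 -> 0 <= l -> 0 <= Zb ->
  hM <= H -> A2 <= H ^+ 3 * Y ^+ 2 -> c0 <= H * Zb -> S = 5 * H ^+ 2 * Y -> G1 <= H * Zb ->
  G2 <= H * Zb ^+ 2 -> SA = H ^+ 2 * Y -> Q = 2 * H * Y -> l <= H -> T * Zb <= Y -> Zb <= Y ->
  6 * hM * A2 + 2 * (c0 * (2 * S) + 4 * T * S * G1 + 2 * SA * Q * l) +
  3 * (c0 ^+ 2 * T + 28 * H * T ^+ 2 * G2 + 2 * Q ^+ 2 * l) <= 185 * (H ^+ 4 * Y ^+ 2).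
Proof.
move=> H1 Y0 T0 hM0 A20 c00 G10 G20 l0 Z0 hMH hA hc -> hG1 hG2 -> -> lH TZ ZY.
have H0 : 0 <= H by lra.
set P := H ^+ 4 * Y ^+ 2.
have Y2 : 0 <= Y ^+ 2 by exact: sqr_ge0.
have e3 : H ^+ 3 * Y ^+ 2 <= P by rewrite ler_wpM2r// ler_weXn2l.
have e2 : H ^+ 2 * Y ^+ 2 <= P by rewrite ler_wpM2r// ler_weXn2l.
have P0 : 0 <= P by rewrite mulr_ge0// exprn_ge0.
have cY : c0 <= H * Y by apply: (le_trans hc); rewrite ler_wpM2l.
have cT : T * c0 <= H * Y.
  by apply: (le_trans (ler_wpM2l T0 hc)); rewrite mulrCA ler_wpM2l.
have GT : T * G1 <= H * Y.
  by apply: (le_trans (ler_wpM2l T0 hG1)); rewrite mulrCA ler_wpM2l.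
have t1 : hM * A2 <= P.
  by rewrite /P exprS -mulrA; apply: ler_pM.
have t2 : c0 * (H ^+ 2 * Y) <= P.
  apply: le_trans e3; rewrite (_ : H ^+ 3 * Y ^+ 2 = H * Y * (H ^+ 2 * Y)); last by ring.
  by rewrite ler_wpM2r// mulr_ge0// exprn_ge0.
have t3 : (T * G1) * (H ^+ 2 * Y) <= P.
  apply: le_trans e3; rewrite (_ : H ^+ 3 * Y ^+ 2 = H * Y * (H ^+ 2 * Y)); last by ring.
  by rewrite ler_wpM2r// mulr_ge0// exprn_ge0.
have t4 : H ^+ 3 * Y ^+ 2 * l <= P.
  rewrite /P (_ : H ^+ 4 * Y ^+ 2 = H ^+ 3 * Y ^+ 2 * H); last by ring.
  by rewrite ler_wpM2l// mulr_ge0// exprn_ge0.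
have t5 : c0 * (T * c0) <= P.
  apply: le_trans e2; rewrite (_ : H ^+ 2 * Y ^+ 2 = H * Y * (H * Y)); last by ring.
  by apply: ler_pM => //; rewrite mulr_ge0.
have t6 : H * (T ^+ 2 * G2) <= P.
  apply: le_trans e2; rewrite (_ : H ^+ 2 * Y ^+ 2 = H * (H * Y ^+ 2)); last by ring.
  rewrite ler_wpM2l//.
  apply: (le_trans (ler_wpM2l _ hG2)); first exact: sqr_ge0.
  rewrite (_ : T ^+ 2 * (H * Zb ^+ 2) = H * (T * Zb) ^+ 2); last by ring.
  by rewrite ler_wpM2l// lerXn2r ?nnegrE// mulr_ge0.
have t7 : H ^+ 2 * Y ^+ 2 * l <= P.
  apply: le_trans t4; rewrite ler_wpM2r// ler_wpM2r// ler_weXn2l//.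
rewrite [leLHS](_ : _ = 6 * (hM * A2) + 20 * (c0 * (H ^+ 2 * Y)) + 40 * ((T * G1) * (H ^+ 2 * Y)) +
  8 * (H ^+ 3 * Y ^+ 2 * l) + 3 * (c0 * (T * c0)) + 84 * (H * (T ^+ 2 * G2)) + 24 * (H ^+ 2 * Y ^+ 2 * l)); last by ring.
lra.
Qed.

Variables (d be : nat -> R) (J : nat) (b c sg : R).
Hypothesis d0 : forall n, 0 <= d n.
Hypothesis sg0 : 0 < sg.
Hypothesis sg1 : sg < 1.
Hypothesis b0 : 0 <= b.
Hypothesis b1 : b <= 1.
Hypothesis csg : c < sg.
Notation De := (error_term d be J).
Hypothesis ig : mu.-integrable `[1, +oo[ (EFin \o (fun y => `|De y| * y `^ (- c - 1))).

(** The index l stands for the integer n = l + 1, matching the frequencies ln(1 + l). *)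
Definition coef (l : nat) : R := d l.+1 * l.+1%:R `^ (- sg).
Definition gker (y : R) : R := De y * y `^ (- sg - 1).

Lemma measurable_gker : measurable_fun setT gker.
Proof. by apply: measurable_funM; [exact: measurable_error|exact: measurable_powR]. Qed.

Lemma gker_bounded (x : R) : exists B : R, forall y, 1 <= y <= x -> `|gker y| <= B.
Proof.
have [B HB] := error_term_bounded be J d0 x; exists B => y hy; have /andP[y1 _] := hy.
rewrite /gker normrM (ger0_norm (powR_ge0 _ _)) -[leRHS]mulr1 ler_pM ?powR_ge0 ?HB//.
have y0 : 0 < y by apply: lt_le_trans y1.
rewrite -[leRHS](powRr0 y); apply: ler_powR => //; have := sg0; lra.
Qed.

Lemma dpoly_ReIm (X t : R) : dpoly d X (sg +i* t)%C =
  (csum coef (Num.truncn X) t +i* - ssum coef (Num.truncn X) t)%C.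
Proof.
rewrite /dpoly big_add1 /= big_mkord; apply: complex_eqP.
  rewrite Re_sum /csum; apply: eq_bigr => l _; rewrite ReRM Re_cpow ReN ImN /= /coef.
  by rewrite -(natr1 l) addrC mulNr cosN mulrA.
rewrite [LHS]Im_sum [RHS]/= /ssum -sumrN; apply: eq_bigr => l _; rewrite ImRM Im_cpow ReN ImN /= /coef.
by rewrite -(natr1 l) addrC mulNr sinN !mulrN mulrA.
Qed.

Variables (Z : R -> C) (X T H : R) (M L : nat).
Let N := X + L%:R.
Hypothesis T1 : 1 <= T.
Hypothesis XM : M%:R + 4^-1 <= X.
Hypothesis MX : X <= M%:R + 3 / 4.
Hypothesis M0 : (0 < M)%N.
Hypothesis cZr : forall t, 1 <= t <= T -> {for t, continuous (fun t => complex.Re (Z t))}.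
Hypothesis cZi : forall t, 1 <= t <= T -> {for t, continuous (fun t => complex.Im (Z t))}.
Hypothesis ZE : forall t, 1 <= t <= T -> Z t = approx d be J (sg +i* t)%C N +
  (sg +i* t)%C * tail_mellin De (sg +i* t)%C N.
Hypothesis H1 : 1 <= H.
Hypothesis TXb : T * X `^ b <= X.
Hypothesis dH : forall n, (0 < n)%N -> (n <= M)%N -> d n <= H.
Hypothesis hML : harm M <= H.
Hypothesis hLH : harm L <= H.
Hypothesis lnTH : ln T <= H.
Hypothesis DeX : De X ^+ 2 <= H * X `^ (2 * b).
Hypothesis G1H : \int[mu]_(y in `[X, N]) `|gker y| <= H * X `^ (b - sg).
Hypothesis G2H : \int[mu]_(y in `[X, N]) (gker y ^+ 2 * y) <= H * X `^ (2 * b - 2 * sg).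
Hypothesis logH : 2 * (\sum_(j < J) `|be j| * j.+1%:R) * (1 + ln X) ^+ J <= H.
Hypothesis tailH : 4 * T ^+ 2 * (N `^ (c - sg) *
   \int[mu]_(y in `[1, +oo[) (`|De y| * y `^ (- c - 1))) <= 1.

Lemma X_gt1 : 1 <= X.
Proof. have h := XM; have : 1 <= M%:R :> R by rewrite ler1n. lra. Qed.

Lemma truncn_X : Num.truncn X = M.
Proof.
apply/eqP; rewrite truncn_eq ?(le_trans ler01 X_gt1)//.
by have h1 := XM; have h2 := MX; rewrite -natr1; apply/andP; split; lra.
Qed.

Let Y := X `^ (1 - sg).

Lemma coef_le (l : 'I_M) : coef l <= H * Y * l.+1%:R^-1.
Proof.
have l1 : 0 < l.+1%:R :> R by [].
have lX : l.+1%:R <= X.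
  by have : l.+1%:R <= M%:R :> R; [rewrite ler_nat|have := XM; lra].
rewrite /coef -mulrA ler_pM ?powR_ge0 ?dH//.
rewrite (_ : - sg = (1 - sg) + - 1); last by ring.
rewrite powRD ?(gt_eqF l1) ?implybT// powR_inv1 ?(ltW l1)// ler_wpM2r ?invr_ge0 ?(ltW l1)//.
by apply: ge0_ler_powR; rewrite ?nnegrE ?subr_ge0 ?(ltW sg1)// (le_trans ler01 X_gt1).
Qed.

Lemma coef_ge0 l : 0 <= coef l.
Proof. by rewrite mulr_ge0 ?powR_ge0. Qed.

Lemma line_bound t : 1 <= t -> 1 <= nc ((sg +i* t)%C - 1) /\ t <= nc ((sg +i* t)%C - 1).
Proof.
move=> t1; suff h : t <= nc ((sg +i* t)%C - 1) by rewrite h (le_trans t1).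
apply: le_trans (Im_le_nc _); rewrite ImD ImN /= oppr0 addr0; exact: ler_norm.
Qed.

(** The polar part is at most H Y / t by [nc_log_polar]. The tail beyond N is at most 1/T by
    [tailH], hence at most 1/t, which is absorbed because H Y >= 1. *)
Lemma remainder_bound t : 1 <= t <= T ->
  nc ((sg +i* t)%C * log_tails be J (sg +i* t)%C X - (log_poly be J X)%:C%C * cpow X (- (sg +i* t)%C)
     + (sg +i* t)%C * tail_mellin De (sg +i* t)%C N) <= 2 * H * Y / t.
Proof.
move=> /andP[t1 tT]; have [s1 ts] := line_bound t1; set s := (sg +i* t)%C.
have X1 := X_gt1; have t0 : 0 < t by apply: lt_le_trans t1.
have T0 : 0 < T by apply: lt_le_trans tT.
have Y1 : 1 <= Y by rewrite -[leLHS](powRr0 X); apply: ler_powR => //; rewrite subr_ge0 ltW.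
have H1' := H1; have HY1 : 1 <= H * Y by rewrite -[leLHS]mulr1 ler_pM.
have N1 : 1 <= N by rewrite (le_trans X1)// lerDl.
rewrite -2!mulrA (_ : 2 * (H * (Y / t)) = H * Y / t + H * Y / t); last by ring.
apply: le_trans (ncD _ _) _; apply: lerD.
  apply: le_trans (nc_log_polar be J s1 X1) _; rewrite -/Y.
  rewrite [leLHS](_ : _ = 2 * (\sum_(j < J) `|be j| * j.+1%:R) * (1 + ln X) ^+ J * Y / nc (s - 1)); last by ring.
  apply: ler_pM; rewrite ?invr_ge0 ?nc_ge0//.
  - rewrite !mulr_ge0 ?powR_ge0 ?exprn_ge0 ?addr_ge0 ?ln_ge0//.
    by apply: sumr_ge0 => j _; rewrite mulr_ge0.
  - by rewrite ler_wpM2r ?powR_ge0.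
  - by rewrite lef_pV2 ?posrE//; exact: lt_le_trans ts.
apply: (@le_trans _ _ T^-1); last first.
  by apply: (@le_trans _ _ t^-1); [rewrite lef_pV2 ?posrE|rewrite ler_peMl ?invr_ge0 ?(ltW t0)].
rewrite ncM; have mD := measurable_error be J d0.
have cs : c <= complex.Re s by exact: ltW.
have sT : nc s <= 2 * T.
  apply: le_trans (nc_le_ReIm _) _ => /=; rewrite (ger0_norm (ltW sg0)) (ger0_norm (ltW t0)).
  by have h1 := sg1; have h2 := T1; lra.
apply: le_trans (ler_pM (nc_ge0 _) (nc_ge0 _) sT (nc_tail_mellin mD N1 cs ig)) _.
rewrite /= -[leRHS]mul1r ler_pdivlMr//; apply: le_trans tailH.
by rewrite le_eqVlt; apply/orP; left; apply/eqP; ring.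
Qed.

(** The representation at N is moved down to X by [cint_error], which splits off the integral over
    [X, N]; its components then have the form required by [second_moment]. *)
Lemma fixed_bound :
  `|\int[mu]_(t in `[1, T]) (complex.Re (Z t) ^+ 2 + complex.Im (Z t) ^+ 2) -
     (T - 1) * \sum_(l < M) coef l ^+ 2| <= 185 * (H ^+ 4 * Y ^+ 2).
Proof.
have X1 := X_gt1; have X0 : 0 < X by apply: lt_le_trans X1.
have H1' := H1; have H0 : 0 <= H by lra.
have Y0 : 0 <= Y by exact: powR_ge0.
have T1' := T1; have T0 : 0 <= T by lra.
have mX : M%:R < X by have := XM; lra.
have XN : X <= N by rewrite lerDl.
have Xb1 : 1 <= X `^ b by rewrite -[leLHS](powRr0 X); apply: ler_powR.
have TX : T <= X by apply: le_trans TXb; rewrite ler_peMr.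
pose Zb := X `^ (b - sg); have Z0 : 0 <= Zb by exact: powR_ge0.
have XD (u v : R) : X `^ (u + v) = X `^ u * X `^ v by rewrite powRD// (gt_eqF X0) implybT.
have TZ : T * Zb <= Y.
  rewrite /Zb XD /Y XD powRr1 ?(ltW X0)// mulrA ler_wpM2r ?powR_ge0//.
have ZY : Zb <= Y by apply: ler_powR => //; rewrite lerD2r.
pose S := 5 * H ^+ 2 * Y; have S0 : 0 <= S by rewrite !mulr_ge0 ?exprn_ge0.
have HS (y : R) : X <= y -> \sum_(l < M) coef l * (ln y - ln (1 + l%:R))^-1 <= S.
  move=> Xy; apply: (@le_trans _ _ (H * Y * \sum_(l < M) l.+1%:R^-1 * (ln y - ln (1 + l%:R))^-1)).
    rewrite mulr_sumr; apply: ler_sum => l _; rewrite mulrA ler_wpM2r ?coef_le//.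
    by rewrite invr_ge0 ltW// (gap_gt0 mX X1).
  apply: (@le_trans _ _ (H * Y * (5 * harm M))).
    rewrite ler_wpM2l ?mulr_ge0//; apply: inv_gap_sum; exact: le_trans Xy.
  rewrite /S (_ : 5 * H ^+ 2 * Y = H * Y * (5 * H)); last by ring.
  by rewrite ler_wpM2l ?mulr_ge0// ler_wpM2l.
have HSA : \sum_(l < M) coef l <= H ^+ 2 * Y.
  apply: (@le_trans _ _ (H * Y * harm M)).
    by rewrite mulr_sumr; apply: ler_sum => l _; exact: coef_le.
  by rewrite (_ : H ^+ 2 * Y = H * Y * H); [rewrite ler_wpM2l ?mulr_ge0|ring].
have HA2 : \sum_(l < M) coef l ^+ 2 * (1 + l%:R) <= H ^+ 3 * Y ^+ 2.
  apply: (@le_trans _ _ (H ^+ 2 * Y ^+ 2 * harm M)).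
    rewrite mulr_sumr; apply: ler_sum => l _.
    have l1 : 0 < l.+1%:R :> R by [].
    rewrite [1 + _]addrC natr1 -ler_pdivlMr//.
    rewrite (_ : _ / _ = (H * Y * l.+1%:R^-1) ^+ 2); last by ring.
    by rewrite lerXn2r ?nnegrE ?coef_le ?coef_ge0// !mulr_ge0// invr_ge0 ltW.
  rewrite (_ : H ^+ 3 * Y ^+ 2 = H ^+ 2 * Y ^+ 2 * H); last by ring.
  by rewrite ler_wpM2l ?mulr_ge0 ?exprn_ge0.
pose c0 := - De X * X `^ (- sg).
have Hc0 : `|c0| <= H * Zb.
  rewrite /c0 normrM normrN (ger0_norm (powR_ge0 _ _)) /Zb XD mulrA ler_wpM2r ?powR_ge0//.
  rewrite -(@ler_pXn2r _ 2) ?nnegrE ?mulr_ge0 ?powR_ge0// real_normK ?num_real//.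
  apply: (le_trans DeX); rewrite exprMn -[(X `^ b) ^+ 2]powR_mulrn ?powR_ge0// -powRrM [b * 2]mulrC.
  by rewrite ler_wpM2r ?powR_ge0// expr2 ler_peMr.
have [B HB] := gker_bounded N.
have gB (y : R) : X <= y <= X + L%:R -> `|gker y| <= B.
  by move=> /andP[h1 h2]; apply: HB; rewrite h2 andbT (le_trans X1).
pose F t := cint `[X, N] (fun y => (De y)%:C%C * cpow y (- (sg +i* t)%C - 1)).
(* The boundary term of [approx] contains the full summatory function. Its main-term part is joined
   here to the polar tails, with which it cancels, and only [De X] is left for [c0]. *)
pose q t : C := (sg +i* t)%C * log_tails be J (sg +i* t)%C X - (log_poly be J X)%:C%C * cpow X (- (sg +i* t)%C)
     + (sg +i* t)%C * tail_mellin De (sg +i* t)%C N.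
have FE t : F t = (\int[mu]_(y in `[X, N]) (gker y * cos (t * ln y)) +i*
                 - \int[mu]_(y in `[X, N]) (gker y * sin (t * ln y)))%C.
  rewrite /F /cint; congr (_ +i* _)%C.
    apply: eq_Rintegral => y _; rewrite ReRM Re_cpow ReD ImD !ReN !ImN /= subr0 /gker.
    by rewrite mulNr cosN mulrA.
  have mI : measurable (`[X, N]%classic : set R) by exact: measurable_itv.
  have isn := integrable_gtr measurable_gker gB t (@continuous_sin R) (@sin_abs_le1 R).
  have E1 : \int[mu]_(y in `[X, N]) (-1 * (gker y * sin (t * ln y))) =
    -1 * \int[mu]_(y in `[X, N]) (gker y * sin (t * ln y)) by exact: RintegralZl.
  rewrite -[RHS]mulN1r -E1; apply: eq_Rintegral => y _.
  rewrite ImRM Im_cpow ReD ImD !ReN !ImN /= subr0 /gker.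
  by rewrite mulN1r !mulNr sinN !mulrN mulrA.
have ZE' t : 1 <= t <= T -> Z t = dpoly d X (sg +i* t)%C + (- De X)%:C%C * cpow X (- (sg +i* t)%C) +
    (sg +i* t)%C * F t + q t.
  move=> ht; have /andP[t1 _] := ht; have [s1 _] := line_bound t1.
  have sn1 : (sg +i* t)%C != 1 :> C.
    by apply: contraTneq s1 => ->; rewrite subrr nc0 -ltNge.
  have [_ e] := cint_error d be J sn1 X0 XN.
  rewrite ZE// -e -/(F t) /approx /q {2}/error_term rmorphN rmorphB /=; ring.
have ncRe (z : C) (u : R) : nc z <= u -> `|complex.Re z| <= u := le_trans (Re_le_nc z).
have ncIm (z : C) (u : R) : nc z <= u -> `|complex.Im z| <= u := le_trans (Im_le_nc z).
have zrE t : 1 <= t <= T -> complex.Re (Z t) = csum coef M t + c0 * cos (t * ln X) +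
    (sg * \int[mu]_(y in `[X, X + L%:R]) (gker y * cos (t * ln y)) +
     t * \int[mu]_(y in `[X, X + L%:R]) (gker y * sin (t * ln y))) + complex.Re (q t).
  move=> ht; rewrite ZE'// 3!ReD dpoly_ReIm truncn_X FE ReRM Re_cpow ReN ImN ReM /=.
  by rewrite (mulNr t) cosN /c0 -/N; ring.
have ziE t : 1 <= t <= T -> complex.Im (Z t) = - ssum coef M t - c0 * sin (t * ln X) +
    (t * \int[mu]_(y in `[X, X + L%:R]) (gker y * cos (t * ln y)) -
     sg * \int[mu]_(y in `[X, X + L%:R]) (gker y * sin (t * ln y))) + complex.Im (q t).
  move=> ht; rewrite ZE'// 3!ImD dpoly_ReIm truncn_X FE ImRM Im_cpow ReN ImN ImM /=.
  by rewrite (mulNr t) sinN /c0 -/N; ring.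
have Q0 : 0 <= 2 * H * Y by rewrite !mulr_ge0.
have := second_moment coef_ge0 mX X1 T1 (ltW sg0) (ltW sg1) HS measurable_gker gB TX hLH H1 HSA
  cZr cZi zrE ziE (fun t ht => ncRe _ _ (remainder_bound ht)) (fun t ht => ncIm _ _ (remainder_bound ht)).
move/le_trans; apply; rewrite -/N -[c0 ^+ 2]real_normK ?num_real//.
apply: (@moment_total H Y Zb) => //.
- exact: harm_ge0.
- by apply: sumr_ge0 => l _; rewrite mulr_ge0 ?sqr_ge0 ?addr_ge0.
- by apply: Rintegral_ge0.
- by apply: Rintegral_ge0 => y; rewrite /= in_itv /= => /andP[h _]; rewrite mulr_ge0 ?sqr_ge0// (le_trans (ltW X0)).
- exact: ln_ge0.
- apply: (le_trans G2H); rewrite /Zb -powR_mulrn ?powR_ge0// -powRrM.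
  by rewrite (_ : (b - sg) * 2 = 2 * b - 2 * sg)//; ring.
Qed.

End FixedLength.

(** * The mean value theorem *)

Section MeanValue.
Context {R : realType}.
Notation C := R[i].
Notation nc := (@Normc.normc R).
Notation mu := (@lebesgue_measure R).

Lemma log_pow_bound n (e : R) : 0 < e -> exists2 K : R, 0 < K &
  forall x, 1 <= x -> (1 + ln x) ^+ n <= K * x `^ e.
Proof.
move=> e0; have e'0 : 0 < e / n.+1%:R by rewrite divr_gt0.
set e' := e / n.+1%:R in e'0.
exists ((1 + e'^-1) ^+ n) => [|x x1]; first by rewrite exprn_gt0// addr_gt0// invr_gt0.
have x0 : 0 < x by apply: lt_le_trans x1.
have p1 : 1 <= x `^ e' by rewrite -[leLHS](powRr0 x); apply: ler_powR => //; exact: ltW.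
have h : ln x <= e'^-1 * x `^ e'.
  by rewrite -ler_pdivrMl ?invr_gt0// invrK -ln_powR; exact: ln_le_self.
apply: (@le_trans _ _ (((1 + e'^-1) * x `^ e') ^+ n)).
  rewrite lerXn2r ?nnegrE ?addr_ge0 ?ln_ge0 ?mulr_ge0 ?addr_ge0 ?invr_ge0 ?powR_ge0 ?(ltW e'0)//.
  by rewrite mulrDl mul1r lerD.
rewrite exprMn ler_wpM2l ?exprn_ge0 ?addr_ge0 ?invr_ge0 ?(ltW e'0)//.
rewrite -powR_mulrn ?powR_ge0// -powRrM; apply: ler_powR => //.
by rewrite /e' mulrAC ler_pdivrMr// ler_wpM2l ?(ltW e0)// ler_nat.
Qed.

Lemma harm_ln n : (0 < n)%N -> harm n <= 1 + ln n%:R :> R.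
Proof.
case: n => // n _; elim: n => [|n IH].
  by rewrite /harm big_ord1 invr1 ln1 addr0.
rewrite /harm big_ord_recr /= -/(harm _).
apply: (le_trans (lerD IH (lexx _))); rewrite -addrA lerD2l -lerBrDl.
have h := @ln_gap R n.+1%:R n.+2%:R; rewrite (_ : n.+2%:R - n.+1%:R = 1) in h.
  by rewrite mul1r in h; apply: h; rewrite ?ltr_nat.
by rewrite -[n.+2]addn1 natrD addrAC subrr add0r.
Qed.

(** The terms are at most K^2 n^(-(2 sg - 2 eta)) with exponent above 1, so the partial sums
    increase to a genuine limit and the tail is O(M^(1 - (2 sg - 2 eta))). *)
Lemma square_series (d : nat -> R) (sg K eta : R) (M : nat) : (forall n, 0 <= d n) ->
  (forall n, (0 < n)%N -> d n <= K * n%:R `^ eta) -> 1 < 2 * sg - 2 * eta -> (0 < M)%N ->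
  let l := limn (fun N : nat => \sum_(1 <= n < N) d n ^+ 2 * n%:R `^ (- (2 * sg)) : R) in
  \sum_(i < M) coef d sg i ^+ 2 <= l /\
  l <= \sum_(i < M) coef d sg i ^+ 2 + K ^+ 2 * (M%:R `^ (1 - (2 * sg - 2 * eta)) / (2 * sg - 2 * eta - 1)).
Proof.
move=> d0 dK q1 M0 l; pose S (N : nat) : R := \sum_(1 <= n < N) d n ^+ 2 * n%:R `^ (- (2 * sg)).
have t0 (n : nat) : 0 <= d n ^+ 2 * n%:R `^ (- (2 * sg)) by rewrite mulr_ge0 ?sqr_ge0 ?powR_ge0.
have SM : S M.+1 = \sum_(i < M) coef d sg i ^+ 2.
  rewrite /S big_add1 /= big_mkord; apply: eq_bigr => i _.
  rewrite /coef exprMn -[(_ `^ _) ^+ 2]powR_mulrn ?powR_ge0// -powRrM.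
  by rewrite (_ : - sg * 2 = - (2 * sg))//; ring.
have nd : {homo S : n m / (n <= m)%N >-> n <= m}.
  move=> n m nm; rewrite /S; case: n nm => [|n] nm; first by rewrite big_geq// sumr_ge0.
  by rewrite [leRHS](@big_cat_nat _ _ _ n.+1)//= lerDl sumr_ge0.
pose U := S M.+1 + K ^+ 2 * (M%:R `^ (1 - (2 * sg - 2 * eta)) / (2 * sg - 2 * eta - 1)).
have ub N : S N <= U.
  have [NM|MN] := leqP N M.+1.
    apply: (le_trans (nd _ _ NM)); rewrite lerDl mulr_ge0 ?sqr_ge0// divr_ge0 ?powR_ge0//.
    by rewrite subr_ge0 ltW.
  rewrite /S (@big_cat_nat _ _ _ M.+1)//=; last exact: ltnW.
  rewrite lerD2l; apply: le_trans (ler_wpM2l (sqr_ge0 K) (tail_pow N.-1 q1 M0)).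
  rewrite mulr_sumr -{1}[N](ltn_predK MN) big_add1 /=.
  rewrite big_nat [leRHS]big_nat; apply: ler_sum => n /andP[n1 n2].
  have n0 : 0 < n.+1%:R :> R by [].
  apply: (@le_trans _ _ ((K * n.+1%:R `^ eta) ^+ 2 * n.+1%:R `^ (- (2 * sg)))).
    rewrite ler_wpM2r ?powR_ge0// lerXn2r ?nnegrE ?dK//; exact: le_trans (d0 n.+1) (dK n.+1 _).
  rewrite exprMn -[(_ `^ _) ^+ 2]powR_mulrn ?powR_ge0// -powRrM -mulrA ler_wpM2l ?sqr_ge0//.
  rewrite -powRD; last by rewrite (gt_eqF n0) implybT.
  by rewrite (_ : eta * 2 + - (2 * sg) = - (2 * sg - 2 * eta))//; ring.
have cS : cvgn S by apply: nondecreasing_is_cvgn => //; exists U => _ [N _ <-]; exact: ub.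
rewrite -SM; split; first exact: nondecreasing_cvgn_le.
by apply: limr_le => //; apply: nearW => N; exact: ub.
Qed.

Lemma add1_le_double (x u : R) : x <= u -> 1 <= u -> x + 1 <= 2 * u.
Proof. by move=> *; lra. Qed.

Lemma add34_le_double (x : R) : 1 <= x -> x + 3 / 4 <= 2 * x.
Proof. by move=> *; lra. Qed.

Lemma le_of_add_le (x y : R) : x + 4^-1 <= y -> x <= y.
Proof. by move=> *; lra. Qed.

Lemma quadruple_bound (x y u z : R) : x + 1 <= 2 * y -> y <= 2 * u -> z <= x + 3 / 4 -> z <= 4 * u.
Proof. by move=> *; lra. Qed.

Lemma log_arith (p l : R) : 0 <= p -> 0 <= l -> 1 + (1 + p * l) <= (2 + p) * (1 + l).
Proof. by move=> p0 l0; rewrite mulrDl !mulrDr; have := mulr_ge0 p0 l0; lra. Qed.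

Lemma const_le_pow (a K x : R) : a <= K -> 0 <= K -> 1 <= x -> a <= K * x.
Proof. by move=> aK K0 x1; apply: (le_trans aK); rewrite ler_peMr. Qed.

(** With N >= X^p and p e = 3, the tail decays like X^-3: two powers of X absorb T^2 and the third
    absorbs the constant 4 I0. *)
Lemma tail_small (T X N I0 p e : R) : 0 < T -> 0 <= I0 -> 1 <= X -> T <= X -> 4 * I0 <= X ->
  X `^ p <= N -> 0 < e -> p * e = 3 ->
  4 * T ^+ 2 * (N `^ (- e) * I0) <= 1.
Proof.
move=> T0 I00 X1 TX IX XN e0 pe; have X0 : 0 < X by lra.
have Xp0 : 0 < X `^ p by exact: powR_gt0.
have N3 : N `^ (- e) <= (X ^+ 3)^-1.
  rewrite powRN lef_pV2 ?posrE ?exprn_gt0 ?powR_gt0//; last exact: lt_le_trans XN.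
  rewrite -(powR_mulrn 3 (ltW X0)) -pe powRrM.
  by apply: ge0_ler_powR; rewrite ?nnegrE ?(ltW e0) ?(ltW Xp0)//; apply: (le_trans (ltW Xp0)).
have q1 : T / X <= 1 by rewrite ler_pdivrMr// mul1r.
have q2 : 4 * I0 / X <= 1 by rewrite ler_pdivrMr// mul1r.
have q3 : 0 <= T / X by rewrite divr_ge0// ltW.
have q4 : 0 <= 4 * I0 / X by rewrite divr_ge0 ?(ltW X0)// mulr_ge0.
have T4 : 0 <= 4 * T ^+ 2 by rewrite mulr_ge0// sqr_ge0.
apply: (le_trans (ler_wpM2l T4 (ler_wpM2r I00 N3))).
rewrite (_ : 4 * T ^+ 2 * ((X ^+ 3)^-1 * I0) = (T / X) ^+ 2 * (4 * I0 / X)); last by field; rewrite gt_eqF.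
have q5 : (T / X) ^+ 2 <= 1 by rewrite expr_le1.
by rewrite -[leRHS](mulr1 1); apply: ler_pM => //; exact: sqr_ge0.
Qed.

Variable zeta : C -> C.
Hypothesis hz : is_riemann_zeta zeta.
Variables (k : nat) (be : nat -> R) (b sg Cb eta : R).
Let d := (fun n : nat => (divk k n)%:R : R).
Notation De := (error_term d be k).
Hypothesis b0 : 0 <= b.
Hypothesis bsg : b < sg.
Hypothesis sg2 : 2^-1 < sg.
Hypothesis sg1 : sg < 1.
Hypothesis Cb0 : 0 <= Cb.
Hypothesis HC : forall x : R, 1 <= x ->
    (\int[mu]_(y in `[1%R, x]) (De y ^+ 2)%:E <= (Cb * x `^ (1 + 2 * b))%:E)%E.
Hypothesis eta0 : 0 < eta.
Hypothesis etas : 2 * eta < 2 * sg - 1.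

Let d0 (n : nat) : 0 <= d n. Proof. exact: ler0n. Qed.

Lemma sigma_gt0 : 0 < sg.
Proof. by apply: lt_trans sg2; rewrite invr_gt0. Qed.

(* The parameters of [fixed_bound]: X is of order T ^ (1 / (1 - b)) and every
   logarithm, divisor and error-term factor is absorbed in H = K0 X ^ eta. *)
Lemma moment_at_scale : exists K0 T0 : R, 0 <= K0 /\ 1 <= T0 /\ forall T, T0 <= T ->
  exists (M : nat) (X : R), [/\ (0 < M)%N, T <= X, X <= 4 * T `^ (1 - b)^-1, X <= 2 * M%:R &
  `|\int[mu]_(t in `[1, T]) (complex.Re (zeta (sg +i* t)%C ^+ k) ^+ 2 + complex.Im (zeta (sg +i* t)%C ^+ k) ^+ 2) -
     (T - 1) * \sum_(l < M) coef d sg l ^+ 2| <= K0 * (X `^ eta) ^+ 4 * (X `^ (1 - sg)) ^+ 2].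
Proof.
have s0 := sigma_gt0; have b0' := b0; have bsg' := bsg; have sg1' := sg1.
(* Strictly between b and sigma: c > b makes the Mellin integral converge, and c < sigma gives decay
   in N. *)
pose c := (b + sg) / 2; have bc : b < c by rewrite /c; lra.
have csg : c < sg by rewrite /c; lra.
have cs1 : sg - c <= 3 by rewrite /c; lra.
clearbody c.
have ig := (error_abs_tail d0 b0 Cb0 HC bc (lexx 1)).1.
pose I0 := \int[mu]_(y in `[1, +oo[) (`|De y| * y `^ (- c - 1)).
have I00 : 0 <= I0 by apply: Rintegral_ge0 => y _; rewrite mulr_ge0 ?powR_ge0.
pose p := 3 / (sg - c); have p0 : 0 < p by rewrite divr_gt0// subr_gt0.
have p1 : 1 <= p by rewrite ler_pdivlMr ?subr_gt0// mul1r.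
have pe : p * (sg - c) = 3 by rewrite divfK// gt_eqF// subr_gt0.
clearbody p.
have [Kd Kd0 dK] := divk_bound k eta0.
(* The exponent k + 1 bounds both 1 + ln X and (1 + ln X)^k, even for k = 0. *)
have [Cl Cl0 logK] := log_pow_bound k.+1 eta0.
pose Bs := 2 * (\sum_(j < k) `|be j| * j.+1%:R).
have Bs0 : 0 <= Bs by rewrite mulr_ge0// sumr_ge0// => j _; rewrite mulr_ge0.
pose G1 := (1 + Cb) * 2 `^ (1 + b) / (1 - 2 `^ (b - sg)).
pose G2 := Cb * 2 `^ (1 + 2 * b) / (1 - 2 `^ (2 * b - 2 * sg)).
pose G3 := (Cb + 1) * 2 `^ (3 + 2 * b).
have G30 : 0 <= G3 by rewrite mulr_ge0 ?powR_ge0 ?addr_ge0.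
pose K := Kd + (2 + p) * Cl + Bs * Cl + `|G1| + `|G2| + G3 + 1.
have [a1 a2 a3] : [/\ 0 <= (2 + p) * Cl, 0 <= Bs * Cl & G1 <= `|G1|].
  by split; [rewrite mulr_ge0 ?addr_ge0 ?ltW|rewrite mulr_ge0// ltW|exact: ler_norm].
have [a4 a5 a6] : [/\ G2 <= `|G2|, 0 <= `|G1| & 0 <= `|G2|] by split; [exact: ler_norm| |].
have [k1 k2 k3 k4] : [/\ Kd <= K, (2 + p) * Cl <= K, Bs * Cl <= K & G1 <= K].
  by rewrite /K; split; lra.
have [k5 k6 k7] : [/\ G2 <= K, G3 <= K & 1 <= K] by rewrite /K; split; lra.
have K0 : 0 <= K := le_trans ler01 k7.
clearbody K; clear a1 a2 a3 a4 a5 a6.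
(* The threshold ensures 4 I0 <= T <= X, as [tail_small] requires. *)
exists (185 * K ^+ 4), (1 + 4 * I0); split; first by rewrite mulr_ge0 ?exprn_ge0.
split; first by rewrite lerDl mulr_ge0.
move=> T TT; have T1 : 1 <= T by apply: le_trans TT; rewrite lerDl mulr_ge0.
have T0 : 0 < T := lt_le_trans ltr01 T1.
have TI : 4 * I0 <= T by apply: le_trans TT; rewrite lerDr.
have b1 : 0 < 1 - b by rewrite subr_gt0 (lt_trans bsg).
pose u := T `^ (1 - b)^-1.
have u0 : 0 <= u by exact: powR_ge0.
have u1 : 1 <= u by rewrite -[leLHS](powRr0 T); apply: ler_powR => //; rewrite invr_ge0 ltW.
have uT : u `^ (1 - b) = T by rewrite /u -powRrM mulVf ?gt_eqF// powRr1// ltW.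
(* The good point lies between N0 and 2 N0, so u <= X <= 4 u: the lower bound yields T X^b <= X, and
   the upper one later turns powers of X into powers of T. *)
pose N0 := (Num.truncn u).+1.
have uN : u < N0%:R by exact: truncnS_gt.
have Nu : N0%:R <= 2 * u.
  by have h : (Num.truncn u)%:R <= u; [rewrite truncn_le|rewrite /N0 -natr1; exact: add1_le_double].
have Wb x : exists B, forall y, 1 <= y <= x -> `|De y ^+ 2| <= B.
  have [B HB] := error_term_bounded be k d0 x; exists (B ^+ 2) => y /HB h.
  by rewrite normrX lerXn2r ?nnegrE// (le_trans _ h).
have mW : measurable_fun setT (fun y => De y ^+ 2).
  by apply: measurable_funX; exact: measurable_error.
have [m [X [mN mN2 mX Xm XD]]] := good_point mW (fun y => sqr_ge0 _) Wb b0 Cb0 HC (isT : (0 < N0)%N).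
have m0 : (0 < m)%N by exact: leq_trans mN.
have m1 : 1 <= m%:R :> R by rewrite ler1n.
have uX : u <= X.
  by have h : N0%:R <= m%:R :> R; [rewrite ler_nat|exact: (le_trans (ltW uN) (le_trans h (le_of_add_le mX)))].
have Xu : X <= 4 * u.
  have h : m.+1%:R <= 2 * N0%:R :> R by rewrite -natrM ler_nat.
  by move: h; rewrite -natr1 => h; exact: quadruple_bound h Nu Xm.
have X1 : 1 <= X := le_trans u1 uX.
have X0 : 0 < X := lt_le_trans ltr01 X1.
have TXb : T * X `^ b <= X.
  apply: (@le_trans _ _ (X `^ (1 - b) * X `^ b)).
    rewrite ler_wpM2r ?powR_ge0// -uT; apply: ge0_ler_powR => //; rewrite ?nnegrE ?(ltW X0)//; exact: ltW.
  by rewrite -powRD ?subrK ?powRr1 ?(ltW X0)// (gt_eqF X0) implybT.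
have TX : T <= X.
  apply: le_trans TXb; rewrite ler_peMr ?(ltW T0)//.
  by rewrite -[leLHS](powRr0 X); apply: ler_powR.
(* Long enough for X + L >= X^p, which kills the tail, and short enough for ln L to stay of order 1
   + p ln X. *)
pose L := (Num.truncn (X `^ p)).+1.
have Xp1 : 1 <= X `^ p by rewrite -[leLHS](powRr0 X); apply: ler_powR => //; exact: ltW.
have XpL : X `^ p <= X + L%:R.
  by apply: (le_trans (ltW (truncnS_gt _))); rewrite lerDr ltW.
have LXp : L%:R <= 2 * X `^ p.
  have h : (Num.truncn (X `^ p))%:R <= X `^ p by rewrite truncn_le powR_ge0.
  by rewrite /L -natr1; exact: add1_le_double.
have lX0 : 0 <= ln X by exact: ln_ge0.
have e1 : 1 <= X `^ eta by rewrite -[leLHS](powRr0 X); apply: ler_powR => //; exact: ltW.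
have Xe0 : 0 <= X `^ eta := le_trans ler01 e1.
pose H := K * X `^ eta.
have lin : 1 + ln X <= Cl * X `^ eta.
  by apply: le_trans (logK X X1); rewrite -[leLHS]expr1; apply: ler_weXn2l => //; rewrite lerDl.
have toH (v : R) : v <= K -> v * X `^ eta <= H by move=> vK; rewrite ler_wpM2r.
have harmH n : (0 < n)%N -> ln n%:R <= 1 + p * ln X -> harm n <= H.
  move=> n0 hn; apply: (le_trans (harm_ln n0)); apply: le_trans (toH _ k2).
  apply: (@le_trans _ _ ((2 + p) * (1 + ln X))).
    exact: le_trans (lerD (lexx 1) hn) (log_arith (ltW p0) lX0).
  by rewrite -mulrA ler_wpM2l// addr_ge0// ltW.
have line1 (t : R) : 1 <= t -> (sg +i* t)%C != 1 :> C.
  by move=> t1; apply/eqP => -[_ t00]; move: t1; rewrite t00 ler10.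
have zan t : 1 <= t -> analytic_at (fun s => zeta s ^+ k) (sg +i* t)%C.
  by move=> t1; apply: analyticX; apply: hz.2; exact: line1.
exists m, X; split => //; first exact: (le_trans Xm (add34_le_double m1)).
apply: (@le_trans _ _ (185 * (H ^+ 4 * (X `^ (1 - sg)) ^+ 2))); last first.
  by rewrite /H le_eqVlt; apply/orP; left; apply/eqP; ring.
apply: (@fixed_bound R d be k b c sg d0 s0 sg1 b0 (ltW (lt_trans bsg sg1)) csg ig
  (fun t => zeta (sg +i* t)%C ^+ k) X T H m L T1 mX Xm m0) => //.
- by move=> t /andP[t1 _]; exact: line_continuous_Re (zan t t1).
- by move=> t /andP[t1 _]; exact: line_continuous_Im (zan t t1).
- move=> t /andP[t1 _]; apply: (zeta_power_split hz (X := X + L%:R) ig (line1 t t1) csg).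
  by rewrite (le_trans X1)// lerDl.
- by rewrite /H -[leLHS]mulr1 ler_pM.
- move=> n n0 nm; apply: (le_trans (dK n n0)); apply: le_trans (toH _ k1).
  rewrite ler_wpM2l ?(ltW Kd0)//; apply: ge0_ler_powR; rewrite ?nnegrE ?(ltW eta0) ?(ltW X0)//.
  have h : n%:R <= m%:R :> R by rewrite ler_nat.
  exact: (le_trans h (le_of_add_le mX)).
- apply: harmH => //.
  apply: (@le_trans _ _ (ln X)).
    by rewrite ler_ln ?posrE//; [exact: le_of_add_le mX|exact: lt_le_trans m1].
  by have h : ln X <= p * ln X; [rewrite ler_peMl|apply: (le_trans h); rewrite lerDr].
- apply: harmH => //.
  apply: (@le_trans _ _ (ln (2 * X `^ p))).
    by rewrite ler_ln ?posrE// mulr_gt0// powR_gt0.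
  rewrite lnM ?posrE ?powR_gt0// ln_powR lerD2r.
  have := @le_ln1Dx R 1; rewrite (_ : 1 + 1 = 2); last by [].
  by apply; rewrite (lt_trans _ ltr01)// ltrN10.
- apply: (@le_trans _ _ (1 + ln X)).
    by apply: (@le_trans _ _ (ln X)); [rewrite ler_ln ?posrE|rewrite lerDr].
  apply: (le_trans lin); apply: toH; apply: le_trans k2.
  by rewrite ler_peMl ?(ltW Cl0)// (le_trans p1)// lerDr.
- apply: (le_trans XD); rewrite ler_wpM2r ?powR_ge0//; exact: const_le_pow.
- have [i1 h1] := error_abs_tail d0 b0 Cb0 HC bsg X1.
  apply: (@le_trans _ _ (\int[mu]_(y in `[X, +oo[) (`|De y| * y `^ (- sg - 1)))).
    have sub : (`[X, X + L%:R]%classic : set R) `<=` `[X, +oo[%classic.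
      by move=> y /=; rewrite !in_itv /= andbT => /andP[].
    have E y : `|gker d be k sg y| = `|De y| * y `^ (- sg - 1).
      by rewrite /gker normrM (ger0_norm (powR_ge0 _ _)).
    rewrite (@eq_Rintegral _ _ _ mu _ (fun y => `|De y| * y `^ (- sg - 1))) => [|y _]; last exact: E.
    rewrite /Rintegral; apply: fine_le.
    + by apply: integrable_fin_num => //; apply: integrableS i1.
    + exact: integrable_fin_num.
    + apply: ge0_subset_integral => //.
      * by case/integrableP: i1.
      * by move=> y _; rewrite lee_fin mulr_ge0 ?powR_ge0.
  apply: (le_trans h1); rewrite -/G1 ler_wpM2r ?powR_ge0//; exact: const_le_pow.
- have [i1 h1] := error_sqr_tail d0 b0 Cb0 HC bsg X1.
  apply: (@le_trans _ _ (\int[mu]_(y in `[X, +oo[) (De y ^+ 2 * y `^ (- (1 + 2 * sg))))).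
    have sub : (`[X, X + L%:R]%classic : set R) `<=` `[X, +oo[%classic.
      by move=> y /=; rewrite !in_itv /= andbT => /andP[].
    have E y : y \in (`[X, X + L%:R]%classic : set R) ->
        gker d be k sg y ^+ 2 * y = De y ^+ 2 * y `^ (- (1 + 2 * sg)).
      rewrite inE /= in_itv /= => /andP[y1 _]; have y0 : 0 < y by apply: lt_le_trans y1.
      rewrite /gker exprMn -mulrA -[(_ `^ _) ^+ 2]powR_mulrn ?powR_ge0// -powRrM.
      rewrite -[X in _ * (_ * X)](powRr1 (ltW y0)) -powRD; last by rewrite (gt_eqF y0) implybT.
      by congr (_ * _ `^ _); ring.
    rewrite (@eq_Rintegral _ _ _ mu _ (fun y => De y ^+ 2 * y `^ (- (1 + 2 * sg)))) => [|y]; last exact: E.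
    rewrite /Rintegral; apply: fine_le.
    + by apply: integrable_fin_num => //; apply: integrableS i1.
    + exact: integrable_fin_num.
    + apply: ge0_subset_integral => //.
      * by case/integrableP: i1.
      * by move=> y _; rewrite lee_fin mulr_ge0 ?sqr_ge0 ?powR_ge0.
  apply: (le_trans h1); rewrite -/G2 ler_wpM2r ?powR_ge0//; exact: const_le_pow.
- rewrite -/Bs; apply: (@le_trans _ _ (Bs * (1 + ln X) ^+ k.+1)).
    by rewrite ler_wpM2l//; apply: ler_weXn2l => //; rewrite lerDl.
  apply: (@le_trans _ _ (Bs * Cl * X `^ eta)); last exact: toH.
  by rewrite -mulrA ler_wpM2l// logK.
- rewrite -/I0; apply: (le_trans _ (@tail_small T X (X + L%:R) I0 p (sg - c) T0 I00 X1 TX (le_trans TI TX) XpL _ _)).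
  + by rewrite opprB.
  + by rewrite subr_gt0.
  + exact: pe.
Qed.

(** What remains after [moment_at_scale] is to complete the diagonal sum to the full series and to
    eliminate X through X <= 4 T^(1/(1-b)). *)
Lemma mean_value_error_bound : exists K T0 : R, forall T, T0 <= T ->
  `|mean_value_error zeta k sg T| <= K * T `^ ((2 * (1 - sg) + 4 * eta) / (1 - b)).
Proof.
have [K0 [T0 [K00 [T01 H]]]] := moment_at_scale.
have [Kd Kd0 dK] := divk_bound k eta0.
have b0' := b0; have bsg' := bsg; have sg1' := sg1; have etas' := etas; have eta0' := eta0.
pose q := 2 * sg - 2 * eta - 1; have q0 : 0 < q by rewrite /q; lra.
pose l := limn (fun N : nat => \sum_(1 <= n < N) d n ^+ 2 * n%:R `^ (- (2 * sg)) : R).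
pose E := 2 * (1 - sg) + 4 * eta; have E0 : 0 < E by rewrite /E; lra.
pose K1 := K0 + Kd ^+ 2 / q * 2 `^ q + `|l|.
exists (K1 * 4 `^ E), T0 => T TT; have [M [X [M0 TX Xu XM HX]]] := H T TT.
have T1 : 1 <= T by lra.
have X1 : 1 <= X by lra.
have X0 : 0 < X by lra.
have Mp : 0 < M%:R :> R by rewrite ltr0n.
have h1 : 1 < 2 * sg - 2 * eta by lra.
have [l1 l2] := square_series d0 dK h1 M0; rewrite -/l in l1 l2.
set A := \sum_(i < M) coef d sg i ^+ 2 in l1 l2 HX.
have A0 : 0 <= A by apply: sumr_ge0 => i _; exact: sqr_ge0.
have eqI : mean_value_error zeta k sg T = \int[mu]_(t in `[1, T])
   (complex.Re (zeta (sg +i* t)%C ^+ k) ^+ 2 + complex.Im (zeta (sg +i* t)%C ^+ k) ^+ 2) - T * l.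
  rewrite /mean_value_error; congr (_ - _ * _).
  apply: eq_Rintegral => t _; by rewrite normcE [complex.Re _]/(nc _) -ncE ncX -exprM mulnC.
have XE (a : R) : a <= E -> X `^ a <= X `^ E by move=> aE; exact: ler_powR.
have bnd : `|mean_value_error zeta k sg T| <= K1 * X `^ E.
  rewrite eqI; set J := \int[mu]_(t in _) _ in HX *.
  (* Besides the moment estimate there is T times the tail of the series, where T <= X <= 2M turns
     M^-q into X^(1 - q), and one copy of A, since [1, T] has length T - 1. *)
  rewrite (_ : J - T * l = (J - (T - 1) * A) - (T * (l - A) + A)); last by ring.
  apply: (le_trans (ler_normB _ _)); 
  rewrite [leRHS](_ : _ = K0 * X `^ E + (Kd ^+ 2 / q * 2 `^ q * X `^ E + `|l| * X `^ E)); last by rewrite /K1; ring.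
  apply: lerD.
    apply: (le_trans HX); rewrite -mulrA ler_wpM2l// le_eqVlt; apply/orP; left; apply/eqP.
    rewrite -!powR_mulrn ?powR_ge0// -!powRrM -powRD; last by rewrite (gt_eqF X0) implybT.
    by congr (_ `^ _); rewrite /E; ring.
  rewrite ger0_norm; last by rewrite addr_ge0// mulr_ge0 ?subr_ge0//; lra.
  apply: lerD; last first.
    apply: (le_trans (le_trans l1 (ler_norm _))); rewrite ler_peMr//.
    by rewrite -[leLHS](powRr0 X); apply: ler_powR => //; exact: ltW.
  have l3 : l - A <= Kd ^+ 2 / q * M%:R `^ (- q).
    rewrite lerBlDl; apply: (le_trans l2); rewrite lerD2l le_eqVlt; apply/orP; left; apply/eqP.
    by rewrite (_ : - q = 1 - (2 * sg - 2 * eta)) /q; ring.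
  have c0 : 0 <= Kd ^+ 2 / q by rewrite divr_ge0 ?sqr_ge0// ltW.
  apply: (@le_trans _ _ (X * (Kd ^+ 2 / q * M%:R `^ (- q)))).
    by apply: ler_pM => //; rewrite ?subr_ge0//; lra.
  rewrite mulrCA -mulrA ler_wpM2l//.
  apply: (@le_trans _ _ (X * (2 `^ q * X `^ (- q)))).
    rewrite ler_wpM2l ?(ltW X0)// [X in _ <= _ * X]powRN ler_pdivlMr ?powR_gt0// powRN mulrC.
    rewrite ler_pdivrMr ?powR_gt0// -powRM ?(ltW Mp)//.
    by apply: ge0_ler_powR; rewrite ?nnegrE ?(ltW q0) ?(ltW X0)// mulr_ge0// ltW.
  rewrite mulrCA ler_wpM2l ?powR_ge0// -{1}(powRr1 (ltW X0)) -powRD; last by rewrite (gt_eqF X0) implybT.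
  by apply: XE; rewrite /E /q; lra.
apply: (le_trans bnd); rewrite -mulrA ler_wpM2l//.
  by rewrite /K1 !addr_ge0// mulr_ge0 ?powR_ge0// divr_ge0 ?sqr_ge0// ltW.
apply: (@le_trans _ _ ((4 * T `^ (1 - b)^-1) `^ E)).
  by apply: ge0_ler_powR; rewrite ?nnegrE ?(ltW E0) ?(ltW X0)// mulr_ge0 ?powR_ge0.
by rewrite powRM ?powR_ge0// -powRrM [_^-1 * E]mulrC.
Qed.

End MeanValue.

Theorem theorem1 (R : realType) (zeta : R[i] -> R[i])
  (hzeta : is_riemann_zeta zeta)
  (k : nat) (hk : (3 <= k)%N)
  (sigma : R) (hsigma : Num.max (beta zeta k) 2^-1 < sigma) (hsigma1 : sigma < 1)
  (eps : R) (heps : 0 < eps) :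
  vinogradov (fun T => mean_value_error zeta k sigma T)
    (fun T => T `^ (2 * (1 - sigma) / (1 - beta zeta k) + eps)).
Proof.
move: hsigma; rewrite gt_max => /andP[betas sig2].
have [be Hbe] := main_term_log_poly hzeta (ltnW (ltnW hk)).
pose d := (fun n : nat => (divk k n)%:R : R).
have d0 n : 0 <= d n by exact: ler0n.
have DE : (fun x : R => \int[lebesgue_measure]_(y in `[1, x]) Delta zeta k y ^+ 2) =
    (fun x : R => \int[lebesgue_measure]_(y in `[1, x]) error_term d be k y ^+ 2).
  apply/funext => x; apply: eq_Rintegral => y; rewrite inE /= in_itv /= => /andP[y1 _].
  by rewrite /Delta Hbe// (lt_le_trans ltr01).
pose A : set R := [set b : R | 0 <= b /\
    vinogradov (fun x => \int[lebesgue_measure]_(y in `[1, x]) Delta zeta k y ^+ 2)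
      (fun x => x `^ (1 + 2 * b))].
have betaE : beta zeta k = inf A by [].
(* Without an element the infimum would be a default value, and no admissible b near it could be
   extracted. *)
have A0 : A !=set0.
  have [K K0 dK] := @divk_bound R k 1 ltr01.
  have dK' n : (0 < n)%N -> d n <= K * n%:R by move=> n0; have := dK n n0; rewrite powRr1.
  have [b b0 hb] := error_beta_nonempty be k d0 dK'.
  by exists b; split => //; rewrite DE.
have lbA : lbound A 0 by move=> b [].
have hA : has_inf A by split => //; exists 0.
have beta0 : 0 <= beta zeta k by rewrite betaE; exact: lb_le_inf.
(* The first entry keeps b below sigma. The second makes the passage from beta_k to b change the
   exponent by at most eps/2, the denominators 1 - b and 1 - beta_k being at least 1 - sigma. *)
pose de := Num.min (sigma - beta zeta k) (eps * (1 - sigma) / 4).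
have de0 : 0 < de by rewrite lt_min subr_gt0 betas divr_gt0// mulr_gt0// subr_gt0.
have [b [b0 hb] bde] := inf_adherent de0 hA.
have betab : beta zeta k <= b by rewrite betaE; apply: ge_inf; [exists 0|split].
move: bde; rewrite -betaE => bde.
have d1 : de <= sigma - beta zeta k by rewrite ge_min lexx.
have d2 : de <= eps * (1 - sigma) / 4 by rewrite ge_min lexx orbT.
have bs : b < sigma by lra.
move: hb; rewrite DE => hb.
have [Cb Cb0 HC] := error_sqr_bound d0 b0 hb.
(* The first entry makes the diagonal series converge with room for d_k(n)^2; the second gives 4 eta
   / (1 - b) <= eps/2. *)
pose eta := Num.min ((2 * sigma - 1) / 4) (eps * (1 - sigma) / 8).
have eta0 : 0 < eta.
  by rewrite lt_min; apply/andP; split; [lra|rewrite divr_gt0// mulr_gt0// subr_gt0].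
have e1 : eta <= (2 * sigma - 1) / 4 by rewrite ge_min lexx.
have e2 : eta <= eps * (1 - sigma) / 8 by rewrite ge_min lexx orbT.
have etas : 2 * eta < 2 * sigma - 1 by lra.
have [K [T0 H]] := mean_value_error_bound hzeta b0 bs sig2 hsigma1 Cb0 HC eta0 etas.
exists (`|K|), (Num.max T0 1); split; first exact: num_real.
move=> T; rewrite gt_max => /andP[/ltW TT0 /ltW T1].
apply: (le_trans (H T TT0)); rewrite (ger0_norm (powR_ge0 _ _)).
apply: (@le_trans _ _ (`|K| * T `^ ((2 * (1 - sigma) + 4 * eta) / (1 - b)))).
  by rewrite ler_wpM2r ?powR_ge0// ler_norm.
rewrite ler_wpM2l//; apply: ler_powR => //.
set B := beta zeta k in betas beta0 betab bde d1 *.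
have p1 : 0 < 1 - sigma by lra.
have p2 : 0 < 1 - b by lra.
have p3 : 0 < 1 - B by lra.
have pb : 1 - sigma <= 1 - b by lra.
have pB : 1 - sigma <= 1 - B by lra.
have h1 : 4 * eta / (1 - b) <= eps / 2.
  rewrite ler_pdivrMr//; apply: (@le_trans _ _ (eps / 2 * (1 - sigma))); first lra.
  by rewrite ler_wpM2l// divr_ge0// ltW.
have h2 : 2 * (1 - sigma) / (1 - b) - 2 * (1 - sigma) / (1 - B) <= eps / 2.
  rewrite (_ : _ - _ = 2 * (1 - sigma) * (b - B) / ((1 - b) * (1 - B))); last first.
    by field; rewrite !gt_eqF.
  rewrite ler_pdivrMr ?mulr_gt0//.
  apply: (@le_trans _ _ (eps / 2 * ((1 - sigma) * (1 - sigma)))); last first.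
    by rewrite ler_wpM2l ?divr_ge0 ?(ltW heps)// ler_pM// ltW.
  rewrite (_ : eps / 2 * _ = 2 * (1 - sigma) * (eps * (1 - sigma) / 4)); last by field.
  by rewrite ler_wpM2l ?mulr_ge0 ?(ltW p1)//; lra.
by rewrite mulrDl; lra.
Qed.
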